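(* Let $n\geq 2$, $d\geq 1$, let $\Omega\subset\mathbb{R}^n$ be open, let $0\leq\lambda\leq n-1$ and $\alpha=1-\frac{\lambda}{n-1}$. Suppose $f\in W^{1,1}_{\mathrm{loc}}(\Omega;\mathbb{R}^d)$ satisfies $$\int_\Omega |Df|^n\log^{\lambda}(e+|Df|)\,dy<\infty,$$ and that there is $\mu>0$ such that for all $x,y\in\Omega$ with $0<|x-y|<1$, $$|f(x)-f(y)|\leq\begin{cases}\exp\bigl(-\mu\log^\alpha(1/|x-y|)\bigr), & \alpha>0,\\ \log^{-\mu}(1/|x-y|), & \alpha=0.\end{cases}$$ Then $f$ satisfies Luzin's condition (N) in the sense that for every set $Z\subset\Omega$ of zero $n$-dimensional Lebesgue measure, $\mathcal{H}^n(f(Z))=0$.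
   Context: $\mathcal{H}^n$ denotes the $n$-dimensional Hausdorff measure in $\mathbb{R}^d$, i.e. $\mathcal{H}^n(A)=\lim_{\delta\to0}\inf\{\sum_j(\operatorname{diam}C_j)^n: A\subset\bigcup_j C_j,\ \operatorname{diam}C_j\leq\delta\}$. $|Df|$ is the (Euclidean/operator) norm of the weak differential. *)

(* Defs.v *)
From HB Require Import structures.
From mathcomp Require Import all_boot all_order all_algebra.
From mathcomp Require Import all_classical all_reals all_analysis.
Set Implicit Arguments. Unset Strict Implicit. Unset Printing Implicit Defensive.
Import Order.TTheory GRing.Theory Num.Theory.
Import numFieldNormedType.Exports.
Local Open Scope classical_set_scope.
Local Open Scope ring_scope.

(* n-dimensional Lebesgue measure, built as the iterated product       *)
(*   R x (R x (... x (R x unit)))  of 1-dim Lebesgue measures          *)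
(* (the unit factor carries the Dirac mass, so it is neutral).         *)
Record lebspace (R : realType) := LebSpace {
  ls_d : measure_display;
  ls_T : measurableType ls_d;
  ls_mu : {sigma_finite_measure set ls_T -> \bar R} }.

Section lprod.
Local Open Scope ereal_scope.
Context d1 d2 (T1 : measurableType d1) (T2 : measurableType d2) (R : realType).
Variable m1 : {sigma_finite_measure set T1 -> \bar R}.
Variable m2 : {sigma_finite_measure set T2 -> \bar R}.

Definition lprod := (m1 \x m2)%E.
HB.instance Definition _ := Measure.on lprod.

Lemma lprod_sigma_finite : sigma_finite setT lprod.
Proof.
have /sigma_finiteP[F [TF ndF Foo]] := sigma_finiteT m1.
have /sigma_finiteP[G [TG ndG Goo]] := sigma_finiteT m2.
exists (fun n => F n `*` G n).
 rewrite -setXTT TF TG predeqE => -[x y]; split.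
    move=> [/= [n _ Fnx] [k _ Gky]]; exists (maxn n k) => //; split.
    - by move: x Fnx; exact/subsetPset/ndF/leq_maxl.
    - by move: y Gky; exact/subsetPset/ndG/leq_maxr.
  by move=> [n _ []/= ? ?]; split; exists n.
move=> k; have [? ?] := Foo k; have [? ?] := Goo k.
split; first exact: measurableX.
by rewrite /lprod product_measure1E// lte_mul_pinfty// ge0_fin_numE.
Qed.

HB.instance Definition _ := Measure_isSigmaFinite.Build _ _ _ lprod
  lprod_sigma_finite.
End lprod.

Fixpoint LS (R : realType) (n : nat) : lebspace R :=
  match n with
  | 0 => @LebSpace R _ unit (@dirac _ unit tt R)
  | k.+1 => let P := LS R k in
      @LebSpace R _ _
        (lprod (@lebesgue_measure R) (ls_mu P))
  end.

Definition Rn (R : realType) (n : nat) := ls_T (LS R n).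
Definition lebn (R : realType) (n : nat) := ls_mu (LS R n).

Fixpoint vecn (R : realType) (n : nat) : Rn R n -> 'rV[R]_n :=
  match n return Rn R n -> 'rV[R]_n with
  | 0 => fun _ => 0
  | k.+1 => fun x => @row_mx R 1 1 k (const_mx x.1) (@vecn R k x.2)
  end.

Definition leb_null (R : realType) (n : nat) (Z : set 'rV[R]_n) :=
  (lebn R n).-negligible (vecn (n:=n) @^-1` Z).

Definition leb_int (R : realType) (n : nat) (A : set 'rV[R]_n)
  (g : 'rV[R]_n -> \bar R) : \bar R :=
  (\int[lebn R n]_(x in vecn (n:=n) @^-1` A) g (vecn x))%E.

Definition leb_integrable (R : realType) (n : nat) (A : set 'rV[R]_n)
  (g : 'rV[R]_n -> R) : Prop :=
  (lebn R n).-integrable (vecn (n:=n) @^-1` A) (EFin \o g \o vecn (n:=n)).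

Definition enorm (R : realType) (m : nat) (v : 'rV[R]_m) : R :=
  Num.sqrt (\sum_(i < m) v ord0 i ^+ 2).

Definition mnorm (R : realType) (d n : nat) (A : 'I_d -> 'I_n -> R) : R :=
  Num.sqrt (\sum_(j < d) \sum_(i < n) A j i ^+ 2).

Definition eopen (R : realType) (n : nat) (O : set 'rV[R]_n) : Prop :=
  forall x, O x -> exists2 r : R, 0 < r &
    forall y, enorm (y - x) < r -> O y.

Definition ebase (R : realType) (n : nat) (i : 'I_n) : 'rV[R]_n :=
  delta_mx ord0 i.

Definition pder (R : realType) (n : nat) (i : 'I_n)
  (g : 'rV[R]_n -> R) : 'rV[R]_n -> R :=
  fun x => ('D_(ebase R i) g) x.

Definition smooth (R : realType) (n : nat) (g : 'rV[R]_n -> R) : Prop :=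
  forall s : seq 'I_n,
    continuous (foldr (@pder R n) g s) /\
    forall (i : 'I_n) x, derivable (foldr (@pder R n) g s) x (ebase R i).

Definition test_fun (R : realType) (n : nat) (O : set 'rV[R]_n)
  (phi : 'rV[R]_n -> R) : Prop :=
  smooth phi /\
  exists K : set 'rV[R]_n, [/\ compact K, K `<=` O &
    forall x, ~ K x -> phi x = 0].

Definition loc_integrable (R : realType) (n : nat) (O : set 'rV[R]_n)
  (g : 'rV[R]_n -> R) : Prop :=
  forall K, compact K -> K `<=` O -> leb_integrable K g.

(* G is the weak differential of f on O (so f \in W^{1,1}_loc(O;R^d)):
   G x j i is the weak partial derivative d f_j / d x_i *)
Definition weak_diff (R : realType) (n d : nat) (O : set 'rV[R]_n)
  (f : 'rV[R]_n -> 'rV[R]_d) (G : 'rV[R]_n -> 'I_d -> 'I_n -> R) : Prop :=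
  (forall j : 'I_d, loc_integrable O (fun x => f x ord0 j)) /\
  (forall (j : 'I_d) (i : 'I_n), loc_integrable O (fun x => G x j i)) /\
  (forall (j : 'I_d) (i : 'I_n) phi, test_fun O phi ->
     leb_int O (fun x => (f x ord0 j * pder i phi x)%:E) =
     (- leb_int O (fun x => (G x j i * phi x)%:E))%E).

Definition ediam (R : realType) (d : nat) (C : set 'rV[R]_d) : \bar R :=
  ereal_sup ([set 0%E] `|` [set (enorm (x - y))%:E | x in C & y in C]).

Definition epown (R : realType) (x : \bar R) (k : nat) : \bar R :=
  match x with
  | EFin r => (r ^+ k)%:E
  | +oo%E => +oo%E
  | -oo%E => 0%E
  end.

Definition hausdorff_delta (R : realType) (d k : nat) (delta : R)
  (A : set 'rV[R]_d) : \bar R :=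
  ereal_inf [set (\sum_(0 <= j <oo) epown (ediam (C j)) k)%E |
     C in [set C : nat -> set 'rV[R]_d |
        A `<=` \bigcup_j C j /\ forall j, (ediam (C j) <= delta%:E)%E]].

(* H^k(A) = lim_{delta -> 0} H^k_delta(A) = sup_{delta > 0} H^k_delta(A) *)
Definition hausdorff (R : realType) (d k : nat) (A : set 'rV[R]_d) : \bar R :=
  ereal_sup [set hausdorff_delta k delta A | delta in [set delta : R | 0 < delta]].

(* Main.v *)
(* The heart is a lower bound for the mass of preimages of balls: with
   Phi = |Df|^n log^lambda(e + |Df|), there is c > 0 such that for every x in Omega and
   arbitrarily large k the integral of Phi + 1 over {|f - f(x)| < 2^-k}, near x, is at least
   c 2^(-kn).  Given this, cover Z by an open U on which Phi + 1 has small integral and apply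
   a Vitali selection in the target: disjoint balls around points of f(Z) have disjoint
   preimages in U, so the sum of the r^n is at most a multiple of the integral over U.

   For the lower bound, let v_k be the distance |f - f(x)| truncated to go from 0 to 1 between
   2^-k and 2^(1-k), and Q_j the cube of radius 2^-j at x.  v_k vanishes near x, and would be 1
   on most of a fixed cube if the bound failed, so telescoping averages over the Q_j gives
   1 <= C \sum_j 2^(j(n-1)) \int_(Q_j) |D v_k|.  Now sum over k <= K.  The strips carrying the
   D v_k are disjoint, and pointwise each product is split into a part weighted by
   (1+j)^(-lambda/(n-1)) plus a multiple of 2^(kn) Phi; by the modulus of continuity only
   scales j <= J(K) with \sum_(j <= J(K)) (1+j)^(-lambda/(n-1)) <= C K matter.  With the
   constants small enough this reads K <= K/2 + O(1), a contradiction for large K. *)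

Require Import Defs.
From HB Require Import structures.
From mathcomp Require Import all_boot all_order all_algebra.
From mathcomp Require Import all_classical all_reals all_analysis.
From mathcomp Require Import measurable_realfun ring lra zify.
Set Implicit Arguments. Unset Strict Implicit. Unset Printing Implicit Defensive.
Import Order.TTheory GRing.Theory Num.Theory.
Import numFieldNormedType.Exports.
Local Open Scope classical_set_scope.
Local Open Scope ring_scope.

(** * Smooth bumps and tensor products *)

(** Why a single [k] is not enough: the scales cost \sum_(j <= J(K)) (1+j)^(-lambda/(n-1)), a
    quantity of order K, whereas one strip only has to pay 1. The K strips are disjoint and share
    this cost, so K stands against a small multiple of K. The modulus in the hypothesis is the one
    for which J(K) grows like K^(1/alpha), or exponentially when alpha = 0, and this keeps the
    weighted sum linear in K. Summing over the window k1 <= k < 2 k1 makes every error term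
    proportional to k1, so the contradiction holds for each k1 and not just asymptotically.

    No weak derivative of |f - f(x)| or of its truncation is ever formed. Averaging over cubes only
    needs a bound for the oscillation of v_k along almost every coordinate line. That bound comes
    from the fundamental theorem of calculus for the coordinates of f on the line, followed by an
    intermediate value argument. Almost every line is reached from the weak differential by testing
    with products of one-dimensional bumps with rational parameters. *)

Section bump.
Variable R : realType.
Implicit Types (p q : {poly R}) (x t a b : R).

(** The polynomial factor in [x^-1] makes the family closed under differentiation, so one formula
    yields all derivatives of the bumps, also at 0. *)
Definition flat p x : R := if 0 < x then p.[x^-1] * expR (- x^-1) else 0.

Definition dflat p : {poly R} := 'X^2 * (p - p^`()).

Lemma horner_le_pow p : exists2 C : R, 0 <= C &
  forall y, 1 <= y -> `|p.[y]| <= C * y ^+ size p.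
Proof.
exists (\sum_(i < size p) `|p`_i|); first by apply: sumr_ge0.
move=> y y1; rewrite horner_coef (le_trans (ler_norm_sum _ _ _))// mulr_suml.
apply: ler_sum => i _; rewrite normrM ler_wpM2l//.
rewrite ger0_norm ?exprn_ge0// ?(le_trans ler01)//.
by rewrite ler_weXn2l// ltnW.
Qed.

(** The exponential beats every power of [x^-1]: for [y = x^-1], [y ^+ (size p).+1] is at most a
    factorial times [expR y]. The linear bound is what differentiability at 0 needs. *)
Lemma flat_le p : exists2 C : R, 0 <= C &
  forall x, x <= 1 -> `|flat p x| <= C * `|x|.
Proof.
have [C C0 hC] := horner_le_pow p; exists (C * (size p).+1`!%:R).
  by rewrite mulr_ge0.
move=> x x1; rewrite /flat; case: ltP => x0; last by rewrite normr0 !mulr_ge0.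
rewrite normrM (ger0_norm (expR_ge0 _)).
set y := x^-1; have y1 : 1 <= y by rewrite /y invf_ge1.
have y0 : 0 < y by rewrite invr_gt0.
rewrite (le_trans (ler_wpM2r (expR_ge0 _) (hC _ y1)))// -!mulrA ler_wpM2l//.
rewrite expRN ler_pdivrMr ?expR_gt0// -mulrA.
have -> : `|x| = y^-1 by rewrite gtr0_norm// invrK.
have h := expR_ge1Dxn (size p) (ltW y0).
have {}h : y ^+ (size p).+1 / (size p).+1`!%:R <= expR y.
  by rewrite (le_trans _ h)// lerDr.
rewrite mulrCA ler_pdivlMl// -exprS -ler_pdivrMl ?ltr0n ?fact_gt0// mulrC//.
Qed.

Lemma is_derive_flat_pos p x : 0 < x -> is_derive x 1 (flat p) (flat (dflat p) x).
Proof.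
move=> x0.
have : is_derive x (1:R) (fun t => p.[t^-1] * expR (- t^-1)) (flat (dflat p) x).
  have xn : x != 0 by rewrite gt_eqF.
  have d1 : is_derive x (1:R) (fun t => t^-1) (- x ^- 2).
    have := @is_deriveV _ (fun t : R => t) x 1 1 xn (is_derive_id _ _).
    by move/is_derive_eq; apply; rewrite /GRing.scale/= mulr1.
  have d2 : is_derive x (1:R) (fun t => p.[t^-1]) (- x ^- 2 * p^`().[x^-1]).
    have := @is_derive1_comp _ (horner p) (fun t => t^-1) x _ _ (is_derive_poly p _) d1.
    by move/is_derive_eq; apply; rewrite mulrC.
  have d3 : is_derive x (1:R) (fun t => expR (- t^-1)) (x ^- 2 * expR (- x^-1)).
    have d4 : is_derive x (1:R) (fun t => - t^-1) (x ^- 2).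
      by have := is_deriveN d1; rewrite opprK.
    have := @is_derive1_comp _ expR (fun t => - t^-1) x _ _ (is_derive_expR _) d4.
    by move/is_derive_eq; apply; rewrite mulrC.
  have := @is_deriveM _ _ (fun t => p.[t^-1]) (fun t => expR (- t^-1)) x 1 _ _ d2 d3.
  move/is_derive_eq; apply; rewrite /flat x0 /dflat /GRing.scale/=.
  by rewrite hornerM hornerXn hornerD hornerN exprVn; ring.
apply: near_eq_is_derive.
near=> t; rewrite /flat ifT//; near: t; exact: lt_nbhsr.
Unshelve. all: by end_near. Qed.

Lemma is_derive_flat_neg p x : x < 0 -> is_derive x 1 (flat p) (flat (dflat p) x).
Proof.
move=> x0; rewrite {2}/flat ltNge ltW//=.
have : is_derive x (1:R) (cst (0:R)) 0 by exact: is_derive_cst.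
apply: near_eq_is_derive.
near=> t; rewrite /flat ltNge ltW//; near: t; exact: lt_nbhsl.
Unshelve. all: by end_near. Qed.

Lemma is_derive_flat p x : is_derive x 1 (flat p) (flat (dflat p) x).
Proof.
have [x0|x0|<-] := ltgtP 0 x; [exact: is_derive_flat_pos|exact: is_derive_flat_neg|].
rewrite {2}/flat ltxx.
have [C C0 hC] := flat_le ('X * p).
have h0 : (fun h : R => h^-1 *: (flat p (h *: 1 + 0) - flat p 0)) @ 0^' --> (0:R).
  (* Dividing by [h] only changes the polynomial, so the difference quotient at 0 is again a flat
     function and tends to 0 by the linear bound. *)
  have -> : (fun h : R => h^-1 *: (flat p (h *: 1 + 0) - flat p 0)) = flat ('X * p).
    apply/funext => h; rewrite /GRing.scale/= mulr1 addr0 /flat ltxx subr0.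
    by case: ltP => // h0; rewrite ?mulr0// hornerM hornerX mulrA.
  apply: (@cvg_to_0_linear _ _ C 1) => // h /andP[_ h1].
  exact/hC/(le_trans (ler_norm _))/ltW.
apply: DeriveDef; first by apply/cvg_ex; exists 0.
exact/cvg_lim.
Qed.

Lemma flat_le0 p x : x <= 0 -> flat p x = 0.
Proof. by rewrite leNgt /flat => /negbTE ->. Qed.

Lemma flatZ (c : R) p x : flat (c *: p) x = c * flat p x.
Proof. by rewrite /flat; case: ifP => _; rewrite ?mulr0// hornerZ mulrA. Qed.

Lemma flat1 x : 0 < x -> flat 1 x = expR (- x^-1).
Proof. by move=> x0; rewrite /flat x0 hornerE mul1r. Qed.

Lemma flat1_ge0 x : 0 <= flat 1 x.
Proof. by rewrite /flat; case: ifP => // _; rewrite hornerE mul1r expR_ge0. Qed.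

Lemma flat1_le1 x : flat 1 x <= 1.
Proof.
rewrite /flat; case: ifP => // x0; rewrite hornerE mul1r expR_le1 oppr_le0.
by rewrite invr_ge0 ltW.
Qed.

Lemma dflat1 x : 0 < x -> flat (dflat 1) x = x ^- 2 * expR (- x^-1).
Proof.
by move=> x0; rewrite /flat x0 /dflat !(hornerE, derivC) subr0 mulr1 exprVn.
Qed.

Section family.
Variables (a b m : R).

(** A list of pairs instead of one product, because the product rule turns each pair into two. *)
Definition bumps (l : seq ({poly R} * {poly R})) t : R :=
  \sum_(pq <- l) flat pq.1 (m * (t - a)) * flat pq.2 (m * (b - t)).

Definition dbumps (l : seq ({poly R} * {poly R})) :=
  flatten [seq [:: (m *: dflat pq.1, pq.2); (- m *: pq.1, dflat pq.2)] | pq <- l].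

(* [bump k] is the k-th derivative of the bump function
   exp (- 1 / (m (t - a)) - 1 / (m (b - t))) supported in [a, b]. *)
Definition bump k := bumps (iter k dbumps [:: (1, 1)]).

Lemma is_derive_bumps l t : is_derive t 1 (bumps l) (bumps (dbumps l) t).
Proof.
rewrite /bumps; elim: l => [|[p q] l IH].
  rewrite /dbumps/= big_nil.
  have -> : (fun t => \sum_(pq <- [::]) flat pq.1 (m * (t - a)) * flat pq.2 (m * (b - t))) = cst 0.
    by apply/funext => u; rewrite big_nil.
  exact: is_derive_cst.
have -> : (fun t => \sum_(pq <- (p, q) :: l) flat pq.1 (m * (t - a)) * flat pq.2 (m * (b - t)))
  = (fun t => flat p (m * (t - a)) * flat q (m * (b - t))) \+ bumps l.
  by apply/funext => u; rewrite big_cons.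
rewrite /dbumps/= !big_cons/= addrA.
apply: is_deriveD => //.
have dl c e : is_derive t (1:R) (fun u : R => c * u + e) c.
  have := is_deriveD (is_deriveZ c (is_derive_id t (1:R))) (is_derive_cst e t 1).
  by move/is_derive_eq; apply; rewrite /GRing.scale/= mulr1 addr0.
have d1 : is_derive t (1:R) (fun u => flat p (m * (u - a))) (m * flat (dflat p) (m * (t - a))).
  have -> : (fun u => flat p (m * (u - a))) = flat p \o (fun u => m * u + (- (m * a))).
    by apply/funext => u /=; rewrite mulrBr.
  have /= := @is_derive1_comp _ (flat p) _ t _ _ (is_derive_flat p _) (dl m (- (m * a))).
  by move/is_derive_eq; apply; rewrite -mulrBr mulrC.
have d2 : is_derive t (1:R) (fun u => flat q (m * (b - u))) (- m * flat (dflat q) (m * (b - t))).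
  have -> : (fun u => flat q (m * (b - u))) = flat q \o (fun u => (- m) * u + (m * b)).
    by apply/funext => u /=; congr flat; ring.
  have /= := @is_derive1_comp _ (flat q) _ t _ _ (is_derive_flat q _) (dl (- m) (m * b)).
  move/is_derive_eq; apply; rewrite mulrC; congr (_ * flat _ _); ring.
have := is_deriveM d1 d2.
move/is_derive_eq; apply; rewrite !flatZ /GRing.scale/=; ring.
Qed.

Lemma is_derive_bump k t : is_derive t 1 (bump k) (bump k.+1 t).
Proof. exact: is_derive_bumps. Qed.

Lemma bump_out k t : 0 <= m -> t <= a \/ b <= t -> bump k t = 0.
Proof.
move=> m0 h; rewrite /bump /bumps big1// => -[p q] _ /=.
have [|] := h => ht.
  by rewrite [flat p _]flat_le0 ?mul0r// mulr_ge0_le0// subr_le0.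
by rewrite [flat q _]flat_le0 ?mulr0// mulr_ge0_le0// subr_le0.
Qed.

Lemma bump0E t : bump 0 t = flat 1 (m * (t - a)) * flat 1 (m * (b - t)).
Proof. by rewrite /bump /bumps big_seq1. Qed.

Lemma bump0_ge0 t : 0 <= bump 0 t.
Proof. by rewrite bump0E mulr_ge0// flat1_ge0. Qed.

Lemma bump0_le1 t : bump 0 t <= 1.
Proof. by rewrite bump0E mulr_ile1// ?flat1_ge0// flat1_le1. Qed.

Lemma bump1E t : 0 < m -> a < t < b ->
  bump 1 t = m^-1 * ((t - a) ^- 2 - (b - t) ^- 2) * bump 0 t.
Proof.
move=> m0 /andP[at0 tb]; rewrite bump0E /bump /bumps/= !big_cons big_nil/= addr0.
rewrite !flatZ !dflat1 ?mulr_gt0 ?subr_gt0// !flat1 ?mulr_gt0 ?subr_gt0//.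
rewrite !exprMn !invfM.
have mE : m * (m^-1 / m) = m^-1 by rewrite mulrA mulfV ?mul1r ?gt_eqF.
rewrite ?expr2 ?invfM; set e1 := expR _; set e2 := expR _; set c := m^-1 in mE *.
set A := _^-1 * _^-1; set B := _^-1 * _^-1; rewrite -[in RHS]mE; ring.
Qed.

Lemma bump_m0 k t : m = 0 -> bump k t = 0.
Proof.
by move=> m0; rewrite /bump /bumps big1// => -[p q] _; rewrite m0 mul0r flat_le0 ?mul0r.
Qed.

(** The sign of the derivative is that of [(t - a) ^- 2 - (b - t) ^- 2]: the bump rises up to the
    midpoint and falls after it. For large [m] the derivative therefore acts as a positive unit mass
    near [a] and a negative one near [b]. *)
Lemma bump1_ge0 t : 0 <= m -> t <= (a + b) / 2 -> 0 <= bump 1 t.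
Proof.
rewrite le_eqVlt => /predU1P[/esym/bump_m0 ->//|m0] th; have [ta|at0] := leP t a; first by rewrite bump_out ?(ltW m0)//; left.
have tb : t < b by lra.
rewrite bump1E ?at0// mulr_ge0 ?bump0_ge0// mulr_ge0 ?invr_ge0 ?(ltW m0)// subr_ge0.
rewrite lef_pV2 ?posrE ?exprn_gt0 ?subr_gt0//.
by rewrite ler_pXn2r ?nnegrE ?subr_ge0 ?(ltW at0) ?(ltW tb)//; lra.
Qed.

Lemma bump1_le0 t : 0 <= m -> (a + b) / 2 <= t -> bump 1 t <= 0.
Proof.
rewrite le_eqVlt => /predU1P[/esym/bump_m0 ->//|m0] th; have [ta|tb] := leP b t; first by rewrite bump_out ?(ltW m0)//; right.
have at0 : a < t by lra.
rewrite bump1E ?at0// mulr_le0_ge0 ?bump0_ge0// mulr_ge0_le0 ?invr_ge0 ?(ltW m0)//.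
rewrite subr_le0 lef_pV2 ?posrE ?exprn_gt0 ?subr_gt0//.
by rewrite ler_pXn2r ?nnegrE ?subr_ge0 ?(ltW at0) ?(ltW tb)//; lra.
Qed.

Lemma continuous_bump k : continuous (bump k).
Proof.
move=> t; apply: differentiable_continuous; apply/derivable1_diffP.
exact: (@ex_derive _ _ _ _ _ _ _ (is_derive_bump k t)).
Qed.

End family.

Lemma flat1_cvg (u : R^nat) : u @ \oo --> +oo -> flat 1 (u k) @[k --> \oo] --> (1 : R).
Proof.
move=> uoo.
have h : expR (- (u k)^-1) @[k --> \oo] --> (1:R).
  rewrite -expR0 -oppr0; apply: continuous_cvg; first exact: continuous_expR.
  apply: cvgN; apply/cvgr0Pnorm_lt => e e0; near=> k.
  have uk : e^-1 < u k by near: k; exact: cvgry_gt.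
  have u0 : 0 < u k by rewrite (lt_trans _ uk)// invr_gt0.
  by rewrite gtr0_norm ?invr_gt0// invf_plt.
apply: cvg_trans h; apply: near_eq_cvg; near=> k.
rewrite flat1//; near: k; exact: cvgry_gt.
Unshelve. all: by end_near. Qed.

Lemma bump0_cvg (ak bk : R^nat) a b t : ak @ \oo --> a -> bk @ \oo --> b ->
  a < t < b -> bump (ak k) (bk k) k%:R 0 t @[k --> \oo] --> (1 : R).
Proof.
move=> ha hb /andP[at0 tb].
under eq_fun do rewrite bump0E.
suff h : (fun k => flat 1 (k%:R * (t - ak k)) * flat 1 (k%:R * (bk k - t))) @ \oo --> (1 * 1 : R).
  by rewrite mulr1 in h.
have natoo : (fun k => k%:R : R) @ \oo --> +oo by exact: cvgr_idn.
have key (w : R^nat) (c : R) : 0 < c -> w @ \oo --> c ->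
    (fun k => k%:R * w k) @ \oo --> +oo.
  move=> c0 wc; apply: (@ger_cvgy _ _ _ _ (fun k => k%:R * (c / 2))); last first.
    apply/cvgryPgt => A; near=> k; rewrite -ltr_pdivrMr ?divr_gt0//.
    by near: k; exact: cvgry_gt.
  near=> k; rewrite ler_wpM2l//; near: k; apply: cvgr_ge wc _ _.
  by rewrite ltr_pdivrMr// mulr_natr mulr2n ltrDl.
apply: cvgM; apply: flat1_cvg.
  by apply: (key _ (t - a)); [rewrite subr_gt0|apply: cvgB => //; exact: cvg_cst].
by apply: (key _ (b - t)); [rewrite subr_gt0|apply: cvgB => //; exact: cvg_cst].
Unshelve. all: by end_near. Qed.

End bump.

Section tensor.
Variables (R : realType) (n : nat) (F : 'I_n -> nat -> R -> R).
Hypothesis dF : forall i k (t : R), is_derive t (1 : R) (F i k) (F i k.+1 t).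

(** [F i k] is the k-th derivative of the i-th factor and [c] is a multi-index, so every iterated
    partial derivative of a tensor is again a tensor. *)
Definition tensor (c : 'I_n -> nat) (x : 'rV[R]_n) : R :=
  \prod_(i < n) F i (c i) (x ord0 i).

Lemma is_derive_tensor c i x :
  is_derive x (ebase R i) (tensor c) (tensor (fun l => ((l == i) + c l)%N) x).
Proof.
set P := \prod_(l < n | l != i) F l (c l) (x ord0 l).
have tE h : tensor c (h *: ebase R i + x) = P * F i (c i) (h + x ord0 i).
  rewrite /tensor (bigD1 i)//= mulrC; congr (_ * _).
    apply: eq_bigr => l li; rewrite !mxE eqxx/= (negbTE li) mulr0 add0r//.
  by rewrite !mxE !eqxx mulr1.
have dFi := dF i (c i) (x ord0 i).
have h0 : (fun h : R => h^-1 *: (tensor c (h *: ebase R i + x) - tensor c x)) @ 0^' -->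
    tensor (fun l => ((l == i) + c l)%N) x.
  have -> : tensor (fun l => ((l == i) + c l)%N) x = P * F i (c i).+1 (x ord0 i).
    rewrite /tensor (bigD1 i)//= eqxx mulrC; congr (_ * _).
    by apply: eq_bigr => l li; rewrite (negbTE li).
  have -> : (fun h : R => h^-1 *: (tensor c (h *: ebase R i + x) - tensor c x)) =
     (fun h : R => P * (h^-1 *: (F i (c i) (h *: 1 + x ord0 i) - F i (c i) (x ord0 i)))).
    apply/funext => h; rewrite tE; have := tE 0; rewrite scale0r !add0r => ->.
    by rewrite /GRing.scale/= mulr1 -mulrBr mulrCA.
  apply: cvgM; first exact: cvg_cst.
  have [/cvg_ex[l hl] dE] := dFi.
  suff -> : F i (c i).+1 (x ord0 i) = l by [].
  by rewrite -dE; apply/cvg_lim.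
apply: DeriveDef; first by apply/cvg_ex; exists (tensor (fun l => ((l == i) + c l)%N) x).
exact/cvg_lim.
Qed.

Lemma pder_tensor c i : pder i (tensor c) = tensor (fun l => ((l == i) + c l)%N).
Proof. by apply/funext => x; rewrite /pder (@derive_val _ _ _ _ _ _ _ (is_derive_tensor c i x)). Qed.

Lemma continuous_tensor c : continuous (tensor c).
Proof.
move=> x; rewrite /tensor.
apply: (@cvg_big R _ *%R 1 xpredT) => /=; first exact: mul_continuous.
  exact: (@nbhs_filter _ (x : 'rV[R]_n)).
move=> i _; apply: (@continuous_comp _ _ _ (fun x : 'rV[R]_n => x ord0 i) (F i (c i))).
    exact: coord_continuous.
  apply: differentiable_continuous; apply/derivable1_diffP.
  exact: (@ex_derive _ _ _ _ _ _ _ (dF i (c i) _)).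
Qed.

Lemma smooth_tensor c : smooth (tensor c).
Proof.
move=> s; have [c' ->] : exists c', foldr (@pder R n) (tensor c) s = tensor c'.
  elim: s => [|i s [c' IH]]/=; first by exists c.
  by exists (fun l => ((l == i) + c' l)%N); rewrite IH pder_tensor.
split; first exact: continuous_tensor.
by move=> i x; exact: (@ex_derive _ _ _ _ _ _ _ (is_derive_tensor c' i x)).
Qed.

Lemma test_fun_tensor c (O : set 'rV[R]_n) (a b : 'I_n -> R) :
  (forall i t, t <= a i \/ b i <= t -> F i (c i) t = 0) ->
  (forall x : 'rV[R]_n, (forall i, a i <= x ord0 i <= b i) -> O x) ->
  test_fun O (tensor c).
Proof.
move=> F0 hO; split; first exact: smooth_tensor.
exists [set v : 'rV[R]_n | forall i, `[a i, b i]%classic (v ord0 i)]; split.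
- by apply: (@rV_compact _ _ (fun i => `[a i, b i]%classic)) => i; exact: segment_compact.
- by move=> x hx; apply: hO => i; have := hx i; rewrite /= in_itv.
- move=> x /existsNP[i /negP]; rewrite in_itv/= negb_and -!ltNge => hi.
  rewrite /tensor (bigD1 i)//= F0 ?mul0r//.
  by case/orP: hi => /ltW; [left|right].
Qed.

End tensor.

(** * Lebesgue measure and sup-norm cubes *)

Section space.
Variable R : realType.
Local Notation mu1 := (@lebesgue_measure R).

(** Recursive along [LS], so that measure and Fubini unfold one coordinate at a time; [cubeP] gives
    the description by coordinates. The radius is half the side. *)
Fixpoint cube (n : nat) : Rn R n -> R -> set (Rn R n) :=
  match n return Rn R n -> R -> set (Rn R n) with
  | 0 => fun _ _ => setT
  | k.+1 => fun x r => [set y : Rn R k.+1 | `|y.1 - x.1| < r /\ cube x.2 r y.2]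
  end.

Lemma cubeSE k (x : Rn R k.+1) r : cube x r = ball (x.1 : R) r `*` cube x.2 r.
Proof.
by apply/seteqP; split => -[t y] /= [h1 h2]; split => //; move: h1; rewrite /ball/= distrC.
Qed.

Lemma measurable_cube n (x : Rn R n) r : measurable (cube x r).
Proof.
elim: n x => [|k IH] x; first exact: measurableT.
rewrite cubeSE; apply: measurableX; last exact: IH.
exact: measurable_ball.
Qed.

Lemma lebn_cube n (x : Rn R n) r : 0 <= r -> lebn R n (cube x r) = ((2 * r) ^+ n)%:E.
Proof.
move=> r0; elim: n x => [|k IH] x.
  by rewrite /= diracT.
rewrite cubeSE.
have := @product_measure1E _ _ _ _ _ mu1 (lebn R k) (ball (x.1 : R) r) (cube x.2 r)
  (measurable_ball _ _) (measurable_cube _ _).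
rewrite /lebn/= /lprod => ->.
rewrite [X in (_ * X)%E]IH lebesgue_measure_ball// -EFinM exprS; congr (_%:E); ring.
Qed.

Lemma cubexx n (x : Rn R n) r : 0 < r -> cube x r x.
Proof.
move=> r0; elim: n x => [//|k IH] x /=; split => //; by rewrite subrr normr0.
Qed.

Lemma cube_sub n (x y : Rn R n) r s : cube x s y ->  cube y r `<=` cube x (s + r).
Proof.
elim: n x y => [//|k IH] x y /= [h1 h2] z /= [h3 h4]; split; last exact: (IH _ _ h2).
rewrite -(subrK y.1 z.1) -addrA (le_lt_trans (ler_normD _ _))//.
by rewrite [ltRHS]addrC ltrD.
Qed.

Lemma cubeS n (x : Rn R n) r s : r <= s -> cube x r `<=` cube x s.
Proof.
move=> rs; elim: n x => [//|k IH] x z /= [h1 h2]; split; last exact: IH.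
exact: lt_le_trans rs.
Qed.

Lemma cubeC n (x y : Rn R n) r : cube x r y -> cube y r x.
Proof.
elim: n x y => [//|k IH] x y /= [h1 h2]; split; last exact: IH.
by rewrite distrC.
Qed.

Fixpoint unvec (n : nat) : 'rV[R]_n -> Rn R n :=
  match n return 'rV[R]_n -> Rn R n with
  | 0 => fun _ => tt
  | k.+1 => fun v => (v ord0 ord0, @unvec k (\row_i v ord0 (lift ord0 i)))
  end.

Lemma vecn0E k (x : Rn R k.+1) : vecn x ord0 ord0 = x.1.
Proof.
rewrite /= mxE; case: splitP => [j _|j h]; first by rewrite mxE.
by exfalso; move: h => /=.
Qed.

Lemma vecnSE k (x : Rn R k.+1) i : vecn x ord0 (lift ord0 i) = vecn x.2 ord0 i.
Proof.
rewrite /= mxE; case: splitP => [j h|j]; first by case: j h => -[].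
by rewrite /= /bump/= !add1n => -[] h; congr (vecn _ _ _); exact/val_inj.
Qed.

Lemma unvecK n : cancel (@unvec n) (@vecn R n).
Proof.
elim: n => [|k IH] v; first by apply/rowP => -[].
apply/rowP => i; case: (unliftP ord0 i) => [j|] ->.
  by rewrite vecnSE [X in vecn X]/= IH mxE.
by rewrite vecn0E.
Qed.

Lemma cubeP n (x y : Rn R n) r :
  cube x r y <-> forall i, `|vecn y ord0 i - vecn x ord0 i| < r.
Proof.
elim: n x y => [|k IH] x y; first by split => // _ [].
split => [[h1 /IH h2] i|h].
  case: (unliftP ord0 i) => [j|] ->; first by rewrite !vecnSE.
  by rewrite !vecn0E.
split; first by have := h ord0; rewrite !vecn0E.
by apply/IH => i; have := h (lift ord0 i); rewrite !vecnSE.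
Qed.

(** Openness for the sup norm, spelled out because [Rn] is only a measurable type. *)
Definition cubeopen n (U : set (Rn R n)) :=
  forall x, U x -> exists2 r, 0 < r & cube x r `<=` U.

Lemma cube_dense n (x : Rn R n) e : 0 < e ->
  exists q : seq rat, cube x e (unvec (\row_(i < n) ratr (nth 0 q i))).
Proof.
move=> e0.
have hq i : exists q : rat, `|ratr q - vecn x ord0 i| < e.
  have [q] := @rat_in_itvoo R (vecn x ord0 i - e) (vecn x ord0 i + e) ltac:(lra).
  by rewrite in_itv/= -ltr_distlC distrC; exists q.
have [q hqi] := fin_all_exists hq.
exists [seq q i | i <- enum 'I_n]; apply/cubeP => i; rewrite unvecK mxE.
by rewrite (nth_map i) ?size_enum_ord// nth_ord_enum.
Qed.

(** Rational centres and radii [m.+1%:R^-1] suffice. The doubled cube is kept inside [U] so that the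
    closed cube also lies there, where local integrability can be applied to it. *)
Lemma cubeopen_cover n (U : set (Rn R n)) : cubeopen U -> exists V : nat -> set (Rn R n),
  U = \bigcup_i V i /\
  forall i, V i = set0 \/ exists x r, [/\ 0 < r, V i = cube x r & cube x (r + r) `<=` U].
Proof.
move=> oU; pose c (q : seq rat) : Rn R n := unvec (\row_(i < n) ratr (nth 0 q i)).
pose P (p : seq rat * nat) := cube (c p.1) (p.2.+1%:R^-1 + p.2.+1%:R^-1) `<=` U.
pose V i := if unpickle i is Some p then if `[< P p >] then cube (c p.1) p.2.+1%:R^-1 else set0
  else set0.
exists V; split; last first.
  move=> i; rewrite /V; case: unpickle => [p|]; last by left.
  case: asboolP => hp; last by left.
  by right; exists (c p.1), p.2.+1%:R^-1; rewrite invr_gt0.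
apply/seteqP; split => [x Ux|x [i _]]; last first.
  rewrite /V; case: unpickle => // p; case: asboolP => // hp hx; apply: hp.
  by apply: cubeS hx; rewrite lerDl.
have [r r0 hr] := oU x Ux.
(* Three small radii must fit into [r]: one for the distance from [x] to the rational centre, two
   for the doubled cube. *)
pose m := Num.truncn (3 / r).
have hm : 3 / r < m.+1%:R by rewrite truncnS_gt.
have m0 : 0 < m.+1%:R^-1 :> R by rewrite invr_gt0.
have hm2 : m.+1%:R^-1 + (m.+1%:R^-1 + m.+1%:R^-1) <= r.
  have : m.+1%:R^-1 < (3 / r)^-1 by rewrite ltf_pV2 ?posrE// divr_gt0.
  by rewrite invf_div; move: (_^-1 : R) => q; lra.
have [q hq] := cube_dense x m0.
exists (pickle (q, m)) => //; rewrite /V pickleK; case: asboolP => [_|]; first exact: cubeC.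
by case; move=> z /(cube_sub hq)/(cubeS hm2)/hr.
Qed.

Lemma measurable_cubeopen n (U : set (Rn R n)) : cubeopen U -> measurable U.
Proof.
move=> /cubeopen_cover[V [-> hV]]; apply: bigcup_measurable => i _.
by have [->|[x [r [_ -> _]]]] := hV i; [exact: measurable0|exact: measurable_cube].
Qed.

Lemma cubeopen_cube n (x : Rn R n) r : cubeopen (cube x r).
Proof.
elim: n x => [|k IH] x; first by move=> y _; exists 1.
move=> y /= [h1 /IH[s s0 hs]].
have e0 : 0 < Num.min s (r - `|y.1 - x.1|) by rewrite lt_min s0 subr_gt0.
exists (Num.min s (r - `|y.1 - x.1|)) => // z /= [h3 h4]; split.
  rewrite -(subrK y.1 z.1) -addrA (le_lt_trans (ler_normD _ _))//.
  by rewrite -ltrBrDr (lt_le_trans h3)// ge_min lexx orbT.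
by apply: hs; apply: cubeS h4; rewrite ge_min lexx.
Qed.

Lemma cubeopenI n (U V : set (Rn R n)) : cubeopen U -> cubeopen V -> cubeopen (U `&` V).
Proof.
move=> oU oV x [/oU[r r0 hr] /oV[s s0 hs]].
exists (Num.min r s); first by rewrite lt_min r0.
by move=> y hy; split; [apply: hr|apply: hs]; apply: cubeS hy; rewrite ge_min lexx ?orbT.
Qed.

Lemma enorm_coord m (v : 'rV[R]_m) i : `|v ord0 i| <= enorm v.
Proof.
rewrite -sqrtr_sqr /enorm ler_wsqrtr// (bigD1 i)//= lerDl.
by apply: sumr_ge0 => j _; exact: sqr_ge0.
Qed.

Lemma enorm_le m (v : 'rV[R]_m) r : 0 <= r -> (forall i, `|v ord0 i| <= r) ->
  enorm v <= m%:R * r.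
Proof.
move=> r0 hv; rewrite -[leRHS]ger0_norm ?mulr_ge0// -sqrtr_sqr ler_wsqrtr//.
apply: (@le_trans _ _ (\sum_(i < m) r ^+ 2)).
  apply: ler_sum => i _.
  by rewrite -[leLHS]ger0_norm ?sqr_ge0// normrX ler_pXn2r ?nnegrE.
rewrite sumr_const card_ord -[leLHS]mulr_natl exprMn ler_wpM2r ?sqr_ge0//.
by rewrite -natrX ler_nat; case: m {v hv} => // m; rewrite expnS expn1 leq_pmulr.
Qed.

Lemma cubeopen_eopen n (O : set 'rV[R]_n) : eopen O -> cubeopen (@vecn R n @^-1` O).
Proof.
move=> oO x /oO[r r0 hr]; exists (r / n.+1%:R); first by rewrite divr_gt0.
move=> y /cubeP hy; apply: hr.
rewrite (@le_lt_trans _ _ (n%:R * (r / n.+1%:R)))//.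
  by apply: enorm_le => [|i]; [rewrite divr_ge0 ?ltW|rewrite !mxE ltW].
by rewrite mulrCA -[ltRHS]mulr1 ltr_pM2l// ltr_pdivrMr// mul1r ltr_nat.
Qed.

Definition cubecont n (D : set (Rn R n)) (u : Rn R n -> R) :=
  forall z, D z -> forall e, 0 < e -> exists2 r, 0 < r &
    forall w, cube z r w -> D w -> `|u w - u z| < e.

End space.

(** * Absolute continuity on lines *)

Section ae.
Context d (T : measurableType d) (R : realType) (m : {measure set T -> \bar R}).

Lemma ae_mono (P Q : T -> Prop) : (forall x, P x -> Q x) ->
  {ae m, forall x, P x} -> {ae m, forall x, Q x}.
Proof.
move=> PQ [N [mN N0 sN]]; exists N; split => // x nQ; apply: sN.
by apply: contra_not nQ; exact: PQ.
Qed.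

Lemma ae_and (P Q : T -> Prop) :
  {ae m, forall x, P x} -> {ae m, forall x, Q x} -> {ae m, forall x, P x /\ Q x}.
Proof.
move=> [N [mN N0 sN]] [M [mM M0 sM]]; exists (N `|` M); split.
- exact: measurableU.
- by apply: null_set_setU.
- by move=> x /not_andP[/sN|/sM]; [left|right].
Qed.

Lemma ae_forall_count (I : countType) (P : I -> T -> Prop) :
  (forall i, {ae m, forall x, P i x}) -> {ae m, forall x, forall i, P i x}.
Proof.
move=> h; pose Q n x := if unpickle n is Some i then P i x else True.
have hQ n : {ae m, forall x, Q n x}.
  by rewrite /Q; case: unpickle => [i|]; [exact: h|exact: aeW].
apply: ae_mono (ae_foralln hQ) => x Qx i.
by have := Qx (pickle i); rewrite /Q pickleK.
Qed.

End ae.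

(** * Approximate identities and limits of real-valued integrals *)

Lemma integrable_mul_bounded d (T : measurableType d) (R : realType)
    (m : {measure set T -> \bar R}) (D : set T) (F h : T -> R) (C : R) :
  measurable D -> m.-integrable D (EFin \o F) -> measurable_fun D h ->
  (forall x, D x -> `|h x| <= C) ->
  m.-integrable D (EFin \o (fun x => F x * h x)).
Proof.
move=> mD iF mh hC.
apply: (le_integrable mD) (integrableZl mD C iF) => /=.
  apply/measurable_EFinP; apply: measurable_funM => //.
  exact/measurable_EFinP/(measurable_int m iF).
move=> x Dx; rewrite lee_fin normrM mulrC [leRHS]normrM ler_wpM2r//.
exact: le_trans (hC x Dx) (ler_norm _).
Qed.

Lemma integrableZlr d (T : measurableType d) (R : realType)
    (m : {measure set T -> \bar R}) (D : set T) (f : T -> R) (c : R) :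
  measurable D -> m.-integrable D (EFin \o f) ->
  m.-integrable D (EFin \o (fun x => c * f x)).
Proof. by move=> mD /(integrableZl mD c). Qed.

Lemma integrableDr d (T : measurableType d) (R : realType)
    (m : {measure set T -> \bar R}) (D : set T) (f g : T -> R) :
  measurable D -> m.-integrable D (EFin \o f) -> m.-integrable D (EFin \o g) ->
  m.-integrable D (EFin \o (fun x => f x + g x)).
Proof. by move=> mD mf mg; exact: (integrableD mD mf mg). Qed.

(** An approximate identity. Off [E] the function [u] is within e / 4 of [c], against a mass of at
    most 2; on [E] the difference is at most [M + M], against a mass tending to 0. *)
Lemma Rintegral_concentrates d (T : measurableType d) (R : realType)
    (mu : {measure set T -> \bar R}) (D : set T) (kappa : nat -> T -> R)
    (u : T -> R) (c M : R) :
  measurable D -> (forall k, mu.-integrable D (EFin \o kappa k)) ->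
  (forall k t, D t -> 0 <= kappa k t) ->
  measurable_fun D u -> (forall t, D t -> `|u t| <= M) -> `|c| <= M ->
  (forall e : R, 0 < e -> exists E : set T,
    [/\ measurable E, (forall t, D t -> ~ E t -> `|u t - c| <= e) &
    (fun k => \int[mu]_(t in D `&` E) kappa k t)%R @ \oo --> (0 : R)]) ->
  (fun k => \int[mu]_(t in D) kappa k t)%R @ \oo --> (1 : R) ->
  (fun k => \int[mu]_(t in D) (u t * kappa k t))%R @ \oo --> c.
Proof.
move=> mD ik k0 mu_ uM cM cu c1.
have M0 : 0 <= M by rewrite (le_trans _ cM).
have iuk2 k : mu.-integrable D (EFin \o (fun t => (u t - c) * kappa k t)).
  under eq_fun do rewrite mulrC; apply: (@integrable_mul_bounded _ _ _ mu D (kappa k) _ (M + M)) => //.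
    exact: measurable_funB.
  by move=> t Dt; rewrite (le_trans (ler_normB _ _))// lerD// uM.
have -> : (fun k => \int[mu]_(t in D) (u t * kappa k t))%R =
  (fun k => c * (\int[mu]_(t in D) kappa k t) + \int[mu]_(t in D) ((u t - c) * kappa k t))%R.
  apply/funext => k; rewrite -RintegralZl// -RintegralD//; last exact: integrableZlr.
  by apply: eq_Rintegral => t _; ring.
rewrite -[X in _ --> X]addr0 -[X in _ --> (X + _)]mulr1.
apply: cvgD; first by apply: cvgM => //; exact: cvg_cst.
apply/cvgr0Pnorm_le => e e0.
have [E [mE hE c0]] := cu (e / 4) ltac:(by rewrite divr_gt0).
have mDE : measurable (D `&` E) by exact: measurableI.
have M1 : 0 < e / (4 * (M + 1)) by rewrite divr_gt0// mulr_gt0// ltr_wpDl.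
near=> k.
have h2 : (\int[mu]_(t in D) kappa k t)%R <= 2.
  by near: k; apply: cvgr_le c1 _ _; rewrite ltr1n.
have h3 : (\int[mu]_(t in D `&` E) kappa k t)%R <= e / (4 * (M + 1)).
  by near: k; apply: cvgr_le c0 _ _.
rewrite (le_trans (le_normr_Rintegral _ _))//.
have ie : mu.-integrable D (EFin \o (fun t => e / 4 * kappa k t)) by exact: integrableZlr.
have ikE : mu.-integrable D (EFin \o (kappa k \_ E)).
  by rewrite -restrict_EFin; apply/integrable_restrict => //; apply: integrableS (ik k) => //; rewrite setIC.
have iE : mu.-integrable D (EFin \o (fun t => (M + M) * ((kappa k \_ E) t))) by exact: integrableZlr.
apply: (@le_trans _ _ (\int[mu]_(t in D) (e / 4 * kappa k t + (M + M) * ((kappa k \_ E) t)))%R).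
  apply: le_Rintegral => //.
  - exact: integrable_norm.
  - exact: integrableDr.
  move=> t Dt; rewrite normrM (ger0_norm (k0 _ _ Dt)) patchE.
  case: ifPn => [/set_mem tE|/negP tE].
    rewrite (@le_trans _ _ ((M + M) * kappa k t))//.
      by rewrite ler_wpM2r ?k0// (le_trans (ler_normB _ _))// lerD// uM.
    by rewrite lerDr mulr_ge0 ?k0// divr_ge0// ltW.
  by rewrite mulr0 addr0 ler_wpM2r ?k0// hE// => ?; apply: tE; exact: mem_set.
rewrite (RintegralD mD ie iE) (RintegralZl _ mD (ik k)) (RintegralZl _ mD ikE).
rewrite -Rintegral_mkcondr.
have h4 : e / 4 * (\int[mu]_(t in D) kappa k t)%R <= e / 2.
  by rewrite (le_trans (ler_wpM2l _ h2)) ?divr_ge0 ?(ltW e0)//; lra.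
have h5 : (M + M) * (\int[mu]_(t in D `&` E) kappa k t)%R <= e / 2.
  rewrite (le_trans (ler_wpM2l _ h3)) ?addr_ge0//.
  rewrite mulrA ler_pdivrMr ?mulr_gt0 ?ltr_wpDl//; nra.
lra.
Unshelve. all: by end_near. Qed.

Lemma dominated_cvg_indic d (T : measurableType d) (R : realType)
    (mu : {measure set T -> \bar R}) (g : T -> R) (h : nat -> T -> R) (E : set T) :
  measurable E -> mu.-integrable setT (EFin \o g) ->
  (forall k, measurable_fun setT (h k)) -> (forall k t, `|h k t| <= 1) ->
  (forall t, (fun k => h k t) @ \oo --> (\1_E t : R)) ->
  (fun k => \int[mu]_t (g t * h k t))%R @ \oo --> (\int[mu]_(t in E) g t)%R.
Proof.
move=> mE ig mh h1 hc.
have mg : measurable_fun setT g by have /integrableP[/measurable_EFinP] := ig.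
have [] := @dominated_convergence _ _ R mu setT measurableT
  (fun k t => (g t * h k t)%:E) (fun t => (g t * \1_E t)%:E) (fun t => `|(g t)%:E|%E).
- by move=> k; apply/measurable_EFinP/measurable_funM.
- by apply/measurable_EFinP/measurable_funM.
- apply: aeW => t _; apply: cvg_EFin; first exact: nearW.
  by apply: cvgM; [exact: cvg_cst|exact: hc].
- exact: integrable_abse.
- apply: aeW => t k _ /=; rewrite lee_fin normrM -[leRHS]mulr1.
  by rewrite ler_wpM2l// h1.
move=> i1 _ c; rewrite Rintegral_mkcond.
have -> : (g \_ E) = (fun t => g t * \1_E t).
  by apply/funext => t; rewrite patchE indicE; case: ifP => _; rewrite ?mulr1 ?mulr0.
suff c' : [sequence (\int[mu]_x (g x * h n x)%:E)%E]_n @ \oo -->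
    (\int[mu]_x (g x * \1_E x))%R%:E by exact: (fine_cvg c').
by rewrite fineK//; apply: integrable_fin_num.
Qed.

Lemma integrable_patchT d (T : measurableType d) (R : realType)
    (m : {measure set T -> \bar R}) (D : set T) (f : T -> R) :
  measurable D -> m.-integrable setT (EFin \o f) -> m.-integrable setT (EFin \o (f \_ D)).
Proof.
move=> mD h; rewrite -restrict_EFin; apply/(integrable_mkcond _ mD).
exact: integrableS h.
Qed.

(** * Weak derivatives in one variable *)

Section bump_limits.
Variable R : realType.
Local Notation mu := (@lebesgue_measure R).

Lemma Rintegral_bump1 (a b m p q : R) : p <= q ->
  (\int[mu]_(t in `[p, q]) bump a b m 1 t)%R = bump a b m 0 q - bump a b m 0 p.
Proof.
rewrite le_eqVlt => /predU1P[<-|pq].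
  by rewrite set_itv1 Rintegral_set1 subrr.
rewrite /Rintegral (@continuous_FTC2 _ _ (bump a b m 0))//.
- by apply: continuous_subspaceT; exact: continuous_bump.
- split.
  + by move=> t _; apply: ex_derive; exact: is_derive_bump.
  + by apply: cvg_at_right_filter; exact: continuous_bump.
  + by apply: cvg_at_left_filter; exact: continuous_bump.
- by move=> t _; rewrite derive1E; apply: derive_val; exact: is_derive_bump.
Qed.

Lemma integrable_bump (a b m : R) k p q :
  mu.-integrable `[p, q] (EFin \o bump a b m k).
Proof.
apply: continuous_compact_integrable; first exact: segment_compact.
by apply: continuous_subspaceT; exact: continuous_bump.
Qed.

Lemma measurable_bump (a b m : R) k : measurable_fun setT (bump a b m k).
Proof. by apply: continuous_measurable_fun; exact: continuous_bump. Qed.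

Lemma ler_mid (a b : R) : a < b -> a < (a + b) / 2 < b.
Proof. by move=> ab; apply/andP; split; lra. Qed.

(** The approximation is from inside the interval, so that the bumps with these end points stay
    admissible. *)
Lemma rat_approx (a b : R) : a < b -> exists ab : nat -> rat * rat,
  [/\ forall k, [/\ a < ratr (ab k).1, ratr (ab k).1 < (ratr (ab k).2 : R) & ratr (ab k).2 < b],
   (fun k => ratr (ab k).1 : R) @ \oo --> a & (fun k => ratr (ab k).2 : R) @ \oo --> b].
Proof.
move=> ab; have /andP[am mb] := ler_mid ab; set m := (a + b) / 2 in am mb.
have k0 (k : nat) : 0 < k.+1%:R^-1 :> R by rewrite invr_gt0.
have hp (k : nat) : exists p : rat * rat,
   [/\ a < ratr p.1, ratr p.1 < Num.min m (a + k.+1%:R^-1),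
    Num.max m (b - k.+1%:R^-1) < ratr p.2 & ratr p.2 < b].
  have h1 : a < Num.min m (a + k.+1%:R^-1) by rewrite lt_min am ltrDl k0.
  have h2 : Num.max m (b - k.+1%:R^-1) < b by rewrite gt_max mb ltrBlDr ltrDl k0.
  have [p] := rat_in_itvoo h1; have [q] := rat_in_itvoo h2.
  rewrite !in_itv/= => /andP[q1 q2] /andP[p1 p2].
  by exists (p, q).
have [f hf] := choice hp; exists f; split.
- move=> k; have [h1 h2 h3 h4] := hf k; split => //.
  move: h2 h3; rewrite lt_min gt_max => /andP[h2 _] /andP[h3 _]; exact: lt_trans h3.
- have hc : (fun k => a + k.+1%:R^-1 : R) @ \oo --> a.
    rewrite -[X in _ --> X]addr0; apply: cvgD; [exact: cvg_cst|exact: cvg_harmonic].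
  apply: (squeeze_cvgr _ (cvg_cst a) hc); apply: nearW => k.
  by have [h1 + _ _] := hf k; rewrite lt_min => /andP[_ h2]; rewrite !ltW.
- have hc : (fun k => b - k.+1%:R^-1 : R) @ \oo --> b.
    rewrite -[X in _ --> X]subr0; apply: cvgB; [exact: cvg_cst|exact: cvg_harmonic].
  apply: (squeeze_cvgr _ hc (cvg_cst b)); apply: nearW => k.
  by have [_ _ + h4] := hf k; rewrite gt_max => /andP[_ h2]; rewrite !ltW.
Qed.

Lemma bump0_cvg_indic (ak bk : R^nat) a b t : ak @ \oo --> a -> bk @ \oo --> b ->
  (forall k, a <= ak k) -> (forall k, bk k <= b) ->
  (fun k => bump (ak k) (bk k) k%:R 0 t) @ \oo --> (\1_(`]a, b[) t : R).
Proof.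
move=> ha hb ak_ bk_; rewrite indicE.
case: (boolP (t \in `]a, b[)) => htab.
  rewrite mem_set//; apply: (bump0_cvg ha hb).
  by move: htab; rewrite in_itv.
rewrite memNset; last by apply/negP.
rewrite (_ : (fun k => _) = cst 0); first exact: cvg_cst.
apply/funext => k; rewrite bump_out//; move: htab; rewrite in_itv/= negb_and -!leNgt.
by case/orP => h; [left; exact: le_trans (ak_ k)|right; exact: le_trans (bk_ k) h].
Qed.

(* Bumps with rational parameters: countably many test functions, so that the exceptional null
   set can be chosen independently of the test function. *)
Definition prm := (rat * rat * nat)%type.

Definition psi (q : prm) (k : nat) (t : R) : R :=
  bump (ratr q.1.1) (ratr q.1.2) q.2%:R k t.

(** No order between the two end points is asked for: a bump with reversed end points vanishes
    identically. *)
Definition adm1 (c r : R) (q : prm) := c - r < ratr q.1.1 /\ ratr q.1.2 < c + r.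

Lemma Rintegral_psi_itv (c r : R) (F : R -> R) a b : a < b -> c - r <= a -> b <= c + r ->
  mu.-integrable setT (EFin \o F) ->
  (forall q, adm1 c r q -> \int[mu]_t (F t * psi q 0 t) = 0)%R ->
  (\int[mu]_(t in `]a, b[) F t = 0)%R.
Proof.
move=> ab ca bc iF h0.
have [ab_ [h1 ha hb]] := rat_approx ab.
suff h : (fun k => \int[mu]_t (F t * psi (ab_ k, k) 0 t))%R @ \oo --> (\int[mu]_(t in `]a, b[) F t)%R.
  suff h' : (fun k => \int[mu]_t (F t * psi (ab_ k, k) 0 t))%R @ \oo --> (0 : R).
    exact: (cvg_unique _ h h').
  rewrite (_ : (fun k => _) = cst 0); first exact: cvg_cst.
  apply/funext => k; rewrite h0//; have [h2 h3 h4] := h1 k.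
  by split => /=; [exact: le_lt_trans h2|exact: lt_le_trans h4 _].
apply: (dominated_cvg_indic _ iF) => //.
- by move=> k; exact: measurable_bump.
- by move=> k t; rewrite ger0_norm ?bump0_ge0// bump0_le1.
- move=> t; apply: bump0_cvg_indic => // k.
  by have [/ltW] := h1 k.
  by have [_ _ /ltW] := h1 k.
Qed.

(** Bumps converging to indicators show that all interval integrals of [F] vanish, so the primitive
    of the truncated [F] is 0 on the interval; Lebesgue differentiation then gives [F = 0] almost
    everywhere. *)
Lemma psi_fundamental (c r : R) (F : R -> R) :
  mu.-integrable setT (EFin \o F) ->
  (forall q, adm1 c r q -> \int[mu]_t (F t * psi q 0 t) = 0)%R ->
  {ae mu, forall t, `|t - c| < r -> F t = 0}.
Proof.
move=> iF h0.
pose I := `]c - r, c + r[%classic : set R.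
have mI : measurable I by exact: measurable_itv.
pose F0 := F \_ I.
have iF0 : mu.-integrable setT (EFin \o F0).
  exact: integrable_patchT.
have mF0 : measurable_fun setT F0 by have /integrableP[/measurable_EFinP] := iF0.
have lF0 : locally_integrable setT F0 by apply: integrable_locally_restrict => //; apply: integrableS iF.
have := @FTC1Ny R F0 _ lF0.
move=> h; apply: ae_mono (h _); last first.
  by move=> y; apply: integrableS iF0.
move=> x [dx Hx] xI.
have xI' : I x by rewrite /I/= in_itv/= -ltr_distlC distrC.
have -> : F x = F0 x by rewrite /F0 patchE mem_set.
have H0 y : I y -> (\int[mu]_(t in `]-oo, y]) F0 t = 0)%R.
  rewrite /I/= in_itv/= => /andP[y1 y2].
  rewrite Rintegral_mkcond.
  have -> : F0 \_ `]-oo, y] = F \_ `]c - r, y].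
    apply/funext => t; rewrite !patchE !mem_setE /F0 patchE !in_itv/=.
    case: ifPn => ty; last by rewrite andbF.
    rewrite andbT mem_setE /I/= in_itv/= (le_lt_trans ty y2) andbT//.
  rewrite -Rintegral_mkcond -Rintegral_itv_bndo_bndc; last first.
    by apply: (integrableS measurableT _ _ iF).
  by apply: (Rintegral_psi_itv y1 _ _ iF h0) => //; exact: ltW.
rewrite -Hx derive1E (@near_eq_derive _ _ _ _ (cst 0)) ?derive_cst//.
near=> y; apply: H0; rewrite /I/=; near: y; exact: near_in_itvoo.
Unshelve. all: by end_near. Qed.

Lemma bump_bounded (a b m : R) k : 0 <= m -> exists C, forall t, `|bump a b m k t| <= C.
Proof.
move=> m0; have [ab|ba] := leP a b; last first.
  exists 0 => t; rewrite bump_out ?normr0//.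
  by have [?|?] := leP t a; [left|right; apply: ltW; exact: lt_trans ba _].
have cn : {within `[a, b], continuous (fun t => `|bump a b m k t|)}.
  apply: continuous_subspaceT => t; apply: cvg_norm; exact: continuous_bump.
have [c _ hc] := EVT_max ab cn.
exists `|bump a b m k c| => t; have [htab|] := boolP (t \in `[a, b]); first exact: hc.
rewrite in_itv/= negb_and -!ltNge => h; rewrite bump_out ?normr0//.
by case/orP: h => /ltW; [left|right].
Qed.

Lemma integrable_mul_psik (F : R -> R) (q : prm) k :
  mu.-integrable setT (EFin \o F) -> mu.-integrable setT (EFin \o (fun t => F t * psi q k t)).
Proof.
move=> iF; have [C hC] := @bump_bounded (ratr q.1.1) (ratr q.1.2) q.2%:R k (ler0n _ _).
apply: (integrable_mul_bounded _ iF) (measurable_bump _ _ _ _) (_ : forall x, _ -> _ <= C) => //.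
Qed.

Section acl.
Variables (c r M : R) (u g : R -> R).
Hypothesis iu : mu.-integrable setT (EFin \o u).
Hypothesis ig : mu.-integrable setT (EFin \o g).
Hypothesis uM : forall t, `|t - c| < r -> `|u t| <= M.
Hypothesis cu : forall t, `|t - c| < r -> forall e : R, 0 < e ->
  exists2 de : R, 0 < de & forall s, `|s - c| < r -> `|s - t| < de -> `|u s - u t| <= e.
Hypothesis h0 : forall q, adm1 c r q ->
  (\int[mu]_t (u t * psi q 1 t + g t * psi q 0 t))%R = 0.

Let mu_ D : measurable_fun D u.
Proof. by have /integrableP[/measurable_EFinP h _] := iu; exact: measurable_funS h. Qed.

(** The end points stay fixed while the slope tends to infinity. The bumps converge to the indicator
    of the interval, which produces the integral of [g]; their derivatives converge to a difference
    of unit masses at the end points, which produces the values of [u]. *)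
Lemma psi_acl_rat (a b : rat) : c - r < ratr a -> ratr a < (ratr b : R) -> ratr b < c + r ->
  (\int[mu]_(t in `](ratr a : R), (ratr b : R)[) g t)%R = u (ratr b) - u (ratr a).
Proof.
set A : R := ratr a; set B : R := ratr b => ca ab br.
have /andP[am mb] := ler_mid ab; set m := (A + B) / 2 in am mb.
pose q k : prm := (a, b, k).
have adm k : adm1 c r (q k) by [].
have I_ t : A <= t <= B -> `|t - c| < r.
  by move=> /andP[h1 h2]; rewrite distrC ltr_distlC (lt_le_trans ca)// (le_lt_trans h2).
have c0 t : A < t < B -> (fun k => psi (q k) 0 t) @ \oo --> (1 : R).
  by move=> ht; exact: (bump0_cvg (cvg_cst A) (cvg_cst B) ht).
have psi0 k : psi (q k) 0 A = 0 /\ psi (q k) 0 B = 0.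
  by split; apply: bump_out => //; [left|right].
have ip k p p' : mu.-integrable `[p, p'] (EFin \o psi (q k) 1) by exact: integrable_bump.
have Ipsi k p p' : p <= p' -> (\int[mu]_(t in `[p, p']) psi (q k) 1 t)%R =
    psi (q k) 0 p' - psi (q k) 0 p by exact: Rintegral_bump1.
have iup k D : measurable D -> mu.-integrable D (EFin \o (fun t => u t * psi (q k) 1 t)).
  by move=> mD; apply: integrableS (integrable_mul_psik _ _ iu).
have ugint k : (\int[mu]_t (u t * psi (q k) 1 t))%R = - (\int[mu]_t (g t * psi (q k) 0 t))%R.
  apply/eqP; rewrite -addr_eq0 -RintegralD//; first by rewrite h0.
  exact: integrable_mul_psik. exact: integrable_mul_psik.
(* The derivative changes sign at the midpoint, so each half is, up to sign, a nonnegative kernel as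
   concentration requires. *)
have split_ k : (\int[mu]_t (u t * psi (q k) 1 t))%R =
   (\int[mu]_(t in `[A, m]) (u t * psi (q k) 1 t))%R
   - (\int[mu]_(t in `[m, B]) (u t * (- psi (q k) 1 t)))%R.
  have -> : (\int[mu]_t (u t * psi (q k) 1 t))%R = (\int[mu]_(t in `[A, B]) (u t * psi (q k) 1 t))%R.
    rewrite [RHS]Rintegral_mkcond; apply: eq_Rintegral => t _; rewrite patchE.
    case: ifPn => //; rewrite mem_setE in_itv/= negb_and -!ltNge => h.
    rewrite /psi bump_out ?mulr0//.
    by case/orP: h => /ltW; [left|right].
  have -> : `[A, B]%classic = `[A, m]%classic `|` `]m, B]%classic :> set R.
    by rewrite -itv_bndbnd_setU// bnd_simp; exact: ltW.
  rewrite Rintegral_setU//; last 2 first.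
  - apply: iup; exact: measurableU.
  - by apply/disj_set2P; rewrite -subset0 => t []/=; rewrite !in_itv/= => /andP[_ h1] /andP[h2 _]; move: (lt_le_trans h2 h1); rewrite ltxx.
  congr (_ + _).
  rewrite Rintegral_itv_obnd_cbnd; last by apply: iup.
  under [in RHS]eq_Rintegral do rewrite mulrN -mulN1r.
  by rewrite RintegralZl ?mulN1r ?opprK//; exact: iup.
have lim1 : (fun k => \int[mu]_(t in `[A, m]) (u t * psi (q k) 1 t))%R @ \oo --> u A.
  apply: (@Rintegral_concentrates _ _ _ mu _ _ _ _ M) => //.
  - by move=> k t; rewrite /= in_itv/= => /andP[_ tm]; exact: bump1_ge0.
  - exact: mu_.
  - by move=> t; rewrite /= in_itv/= => /andP[t1 t2]; apply/uM/I_; rewrite t1 (le_trans t2)// ltW.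
  - by apply/uM/I_; rewrite lexx ltW.
  - move=> e e0; have [de de0 hde] := cu (I_ A ltac:(by rewrite lexx ltW)) e0.
    pose p := Num.min (A + de / 2) ((A + m) / 2).
    have Ap : A < p by rewrite lt_min; apply/andP; split; lra.
    have pm : p < m by rewrite gt_min; apply/orP; right; lra.
    exists `[p, m]%classic; split => //.
    + move=> t; rewrite /= !in_itv/= => /andP[t1 t2] /negP; rewrite t2 andbT -ltNge => tp.
      apply: hde; first by apply: I_; rewrite t1 (le_trans t2)// ltW.
      rewrite ger0_norm ?subr_ge0//.
      have : p <= A + de / 2 by rewrite ge_min lexx.
      lra.
    + have -> : `[A, m]%classic `&` `[p, m]%classic = `[p, m]%classic :> set R.
        by rewrite setIC; apply: setIidl; apply: subset_itvr; rewrite bnd_simp ltW.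
      under eq_fun do rewrite (Ipsi _ _ _ (ltW pm)).
      rewrite -(subrr (1 : R)); apply: cvgB; apply: c0; rewrite ?am// Ap (lt_trans pm)//.
  - under eq_fun do rewrite (Ipsi _ _ _ (ltW am)) (psi0 _).1 subr0.
    by apply: c0; rewrite am.
have RintegralN1 k p p' : (\int[mu]_(t in `[p, p']) (- psi (q k) 1 t))%R =
    - (\int[mu]_(t in `[p, p']) psi (q k) 1 t)%R.
  under eq_Rintegral do rewrite -mulN1r.
  by rewrite RintegralZl// mulN1r.
have lim2 : (fun k => \int[mu]_(t in `[m, B]) (u t * (- psi (q k) 1 t)))%R @ \oo --> u B.
  apply: (@Rintegral_concentrates _ _ _ mu _ _ _ _ M) => //.
  - by move=> k; exact: (integrableN (ip k m B)).
  - by move=> k t; rewrite /= in_itv/= => /andP[tm _]; rewrite oppr_ge0; exact: bump1_le0.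
  - exact: mu_.
  - by move=> t; rewrite /= in_itv/= => /andP[t1 t2]; apply/uM/I_; rewrite t2 (le_trans _ t1)// ltW.
  - by apply/uM/I_; rewrite lexx ltW.
  - move=> e e0; have [de de0 hde] := cu (I_ B ltac:(by rewrite lexx ltW)) e0.
    pose p := Num.max (B - de / 2) ((B + m) / 2).
    have pB : p < B by rewrite gt_max; apply/andP; split; lra.
    have mp : m < p by rewrite lt_max; apply/orP; right; lra.
    exists `[m, p]%classic; split => //.
    + move=> t; rewrite /= !in_itv/= => /andP[t1 t2] /negP; rewrite t1/= -ltNge => tp.
      apply: hde; first by apply: I_; rewrite t2 (le_trans _ t1)// ltW.
      rewrite ler0_norm ?subr_le0//.
      have : B - de / 2 <= p by rewrite le_max lexx.
      lra.
    + have -> : `[m, B]%classic `&` `[m, p]%classic = `[m, p]%classic :> set R.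
        by rewrite setIC; apply: setIidl; apply: subset_itvl; rewrite bnd_simp ltW.
      under eq_fun do rewrite RintegralN1 (Ipsi _ _ _ (ltW mp)).
      rewrite -oppr0 -(subrr (1 : R)); apply: cvgN.
      apply: cvgB; apply: c0; rewrite ?am ?mb ?pB ?(lt_trans am)//.
  - under eq_fun do rewrite RintegralN1 (Ipsi _ _ _ (ltW mb)) (psi0 _).2 sub0r opprK.
    by apply: c0; rewrite am.
have h1 : (fun k => \int[mu]_t (u t * psi (q k) 1 t))%R @ \oo --> u A - u B.
  under eq_fun do rewrite split_; exact: cvgB.
have h2 : (fun k => \int[mu]_t (u t * psi (q k) 1 t))%R @ \oo -->
   - (\int[mu]_(t in `]A, B[) g t)%R.
  under eq_fun do rewrite ugint; apply: cvgN.
  apply: dominated_cvg_indic => //.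
  - by move=> k; exact: measurable_bump.
  - by move=> k t; rewrite ger0_norm ?bump0_ge0// bump0_le1.
  - by move=> t; exact: (@bump0_cvg_indic (cst A) (cst B) A B t (cvg_cst A) (cvg_cst B) (fun _ => lexx _) (fun _ => lexx _)).
have h12 : u A - u B = - (\int[mu]_(t in `]A, B[) g t)%R by exact: (cvg_unique _ h1 h2).
by rewrite -[LHS]opprK -h12 opprB.
Qed.

(** Continuity of [u] and dominated convergence pass from rational to real end points, so countably
    many tests on a line determine all increments of [u] there. *)
Lemma psi_acl (a b : R) : c - r < a -> a < b -> b < c + r ->
  (\int[mu]_(t in `]a, b[) g t)%R = u b - u a.
Proof.
move=> ca ab br.
have [ab_ [h1 ha hb]] := rat_approx ab.
pose A k : R := ratr (ab_ k).1; pose B k : R := ratr (ab_ k).2.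
have I_ t : a <= t <= b -> `|t - c| < r.
  by move=> /andP[h2 h3]; rewrite distrC ltr_distlC (lt_le_trans ca)// (le_lt_trans h3).
have AI k : `|A k - c| < r.
  by apply: I_; have [h2 h3 h4] := h1 k; rewrite ltW//= ltW// (lt_trans h3).
have BI k : `|B k - c| < r.
  by apply: I_; have [h2 h3 h4] := h1 k; rewrite ltW//= ?ltW// (lt_trans _ h3).
have cvu (s : nat -> R) t : (forall k, `|s k - c| < r) -> `|t - c| < r ->
    s @ \oo --> t -> (fun k => u (s k)) @ \oo --> u t.
  move=> sI tI st; apply/cvgrPdist_le => e e0.
  have [de de0 hde] := cu tI e0; near=> k.
  rewrite distrC; apply: hde => //; near: k.
  by move/cvgrPdist_lt : st => /(_ _ de0); apply: filterS => k; rewrite distrC.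
have lim1 : (fun k => \int[mu]_(t in `]A k, B k[) g t)%R @ \oo --> u b - u a.
  have -> : (fun k => \int[mu]_(t in `]A k, B k[) g t)%R = (fun k => u (B k) - u (A k)).
    apply/funext => k; have [h2 h3 h4] := h1 k; apply: psi_acl_rat => //.
      exact: lt_trans h2.
    exact: lt_trans br.
  by apply: cvgB; apply: cvu => //; apply: I_; rewrite lexx ltW.
have lim2 : (fun k => \int[mu]_(t in `]A k, B k[) g t)%R @ \oo --> (\int[mu]_(t in `]a, b[) g t)%R.
  have -> : (fun k => \int[mu]_(t in `]A k, B k[) g t)%R =
     (fun k => \int[mu]_t (g t * \1_(`]A k, B k[) t))%R.
    apply/funext => k; rewrite Rintegral_mkcond; apply: eq_Rintegral => t _.
    by rewrite patchE indicE; case: ifP => _; rewrite ?mulr1 ?mulr0.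
  apply: dominated_cvg_indic => //.
  - by move=> k; exact: measurable_indic.
  - by move=> k t; rewrite indicE ger0_norm//; case: (_ \in _).
  - move=> t; case: (boolP (t \in `]a, b[)) => htab; last first.
      rewrite indicE memNset; last by apply/negP.
      rewrite (_ : (fun k => _) = cst 0); first exact: cvg_cst.
      apply/funext => k; rewrite indicE memNset//=; apply/negP; apply: contra htab.
      have [h2 h3 h4] := h1 k; rewrite !in_itv/= => /andP[t1 t2].
      by rewrite (lt_trans h2)//= (lt_trans t2).
    have : (fun k => 1 : R) @ \oo --> (\1_`]a, b[ t : R).
      by rewrite indicE mem_set//; exact: cvg_cst.
    apply: cvg_trans; apply: near_eq_cvg; near=> k.
    rewrite indicE mem_set// /= in_itv/=; apply/andP; split; near: k.
      by apply: cvgr_lt ha _ _; move: htab; rewrite in_itv/= => /andP[].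
    by apply: cvgr_gt hb _ _; move: htab; rewrite in_itv/= => /andP[].
exact: (cvg_unique _ lim2 lim1).
Unshelve. all: by end_near. Qed.

End acl.

End bump_limits.

(** * Fubini for real-valued integrals and almost every slice *)

Lemma Rintegral_ae_eq d (T : measurableType d) (R : realType)
    (m : {measure set T -> \bar R}) (f g : T -> R) :
  m.-integrable setT (EFin \o f) -> m.-integrable setT (EFin \o g) ->
  {ae m, forall x, f x = g x} -> (\int[m]_x f x = \int[m]_x g x)%R.
Proof.
move=> /integrableP[mf _] /integrableP[mg _] fg; congr fine.
by apply: ae_eq_integral => //; apply: ae_mono fg => x /= ->.
Qed.

Section Rfubini.
Context d1 d2 (T1 : measurableType d1) (T2 : measurableType d2) (R : realType).
Variables (m1 : {sigma_finite_measure set T1 -> \bar R})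
  (m2 : {sigma_finite_measure set T2 -> \bar R}).
Variable G : T1 * T2 -> R.
Hypothesis iG : (m1 \x m2)%E.-integrable setT (EFin \o G).

Let fine_int d (T : measurableType d) (m : {sigma_finite_measure set T -> \bar R}) (F : T -> \bar R) :
  m.-integrable setT F -> m.-integrable setT (EFin \o (fun x => fine (F x))) /\
  (\int[m]_x fine (F x) = fine (\int[m]_x F x))%R.
Proof.
move=> iF; have /integrableP[mF _] := iF.
have mf : measurable_fun setT (fun x => (fine (F x))%:E).
  by apply/measurable_EFinP; exact: measurableT_comp.
split; first by apply: (le_integrable _ mf _ iF) => // x _ /=; case: (F x) => //= *; rewrite ?normr0 ?leey.
congr fine; apply: ae_eq_integral => //.
apply: ae_mono (integrable_ae measurableT iF) => x /(_ I) h _.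
by rewrite fineK.
Qed.

Lemma Rfubini1 : m1.-integrable setT (EFin \o (fun t => \int[m2]_y G (t, y))%R) /\
  (\int[(m1 \x m2)%E]_z G z = \int[m1]_t \int[m2]_y G (t, y))%R.
Proof.
have [h1 h2] := fine_int (integrable_fubini_F iG); split => //.
by rewrite [RHS]h2 [in RHS]integral12_prod_meas1.
Qed.

Lemma Rfubini2 : m2.-integrable setT (EFin \o (fun y => \int[m1]_t G (t, y))%R) /\
  (\int[(m1 \x m2)%E]_z G z = \int[m2]_y \int[m1]_t G (t, y))%R.
Proof.
have /integrableP[mG _] := iG.
have iGG : m2.-integrable setT (fubini_G m1 (EFin \o G)).
  apply/integrableP; split; first exact: (measurable_fubini_G iG).
  apply: le_lt_trans ((integrable21ltyP m1 m2 mG).1 iG).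
  apply: ge0_le_integral => //.
  - by apply: measurableT_comp => //; exact: (measurable_fubini_G iG).
  - by apply: (@measurable_fun_fubini_tonelli_G _ _ _ _ _ m1 (abse \o (EFin \o G))) => //=;
      exact: measurableT_comp.
  - move=> y _; apply: le_abse_integral => //.
    exact: (measurableT_comp mG (pair2_measurable y)).
have [h1 h2] := fine_int iGG; split => //.
by rewrite [RHS]h2 [in RHS]integral21_prod_meas1.
Qed.

Lemma ae_slices : {ae m1, forall t, m2.-integrable setT (EFin \o (fun y => G (t, y)))} /\
  {ae m2, forall y, m1.-integrable setT (EFin \o (fun t => G (t, y)))}.
Proof. by split; [exact: ae_integrable1 iG|exact: ae_integrable2 iG]. Qed.

End Rfubini.

Lemma ae_product d1 d2 (T1 : measurableType d1) (T2 : measurableType d2) (R : realType)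
    (m1 : {sigma_finite_measure set T1 -> \bar R})
    (m2 : {sigma_finite_measure set T2 -> \bar R}) (N : set (T1 * T2)) :
  measurable N -> {ae m1, forall t, {ae m2, forall y, ~ N (t, y)}} ->
  (m1 \x m2)%E.-negligible N.
Proof.
move=> mN h; exists N; split => //.
have -> : (m1 \x m2)%E N = (\int[m1 \x m2]_z (\1_N z)%:E)%E by rewrite integral_indic ?setIT.
rewrite fubini_tonelli1//; last by apply/measurable_EFinP.
rewrite -(integral0 m1 setT); apply: ae_eq_integral => //.
  apply: (@measurable_fun_fubini_tonelli_F _ _ _ _ _ m2 (fun z => (\1_N z)%:E)) => //.
  by apply/measurable_EFinP.
apply: ae_mono h => t ht _; rewrite /fubini_F -(integral0 m2 setT).
apply: ae_eq_integral => //.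
  apply/measurable_EFinP.
  exact: (measurableT_comp (measurable_indic mN) (pair1_measurable t)).
by apply: ae_mono ht => y hy _ /=; rewrite indicE memNset.
Qed.

(** * Products of bumps as test functions in several variables *)

Section tens.
Variable R : realType.
Local Notation mu1 := (@lebesgue_measure R).
Local Notation psi := (@psi R).

Definition prm0 : prm := (0, 0, 0%N).

(** Recursive over the coordinates to match Fubini; [tensE] identifies it with [tensor]. The list is
    read in order, and a missing entry defaults to [prm0], whose bump is identically 0. *)
Fixpoint tens (n : nat) (s : seq prm) : Rn R n -> R :=
  match n return Rn R n -> R with
  | 0 => fun _ => 1
  | k.+1 => fun z => psi (head prm0 s) 0 z.1 * @tens k (behead s) z.2
  end.

Fixpoint dtens (n i : nat) (s : seq prm) : Rn R n -> R :=
  match n return Rn R n -> R with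
  | 0 => fun _ => 0
  | k.+1 => match i with
    | 0 => fun z => psi (head prm0 s) 1 z.1 * @tens k (behead s) z.2
    | i.+1 => fun z => psi (head prm0 s) 0 z.1 * @dtens k i (behead s) z.2
    end
  end.

Fixpoint adm (n : nat) : Rn R n -> R -> seq prm -> Prop :=
  match n return Rn R n -> R -> seq prm -> Prop with
  | 0 => fun _ _ _ => True
  | k.+1 => fun x r s => adm1 (x.1 : R) r (head prm0 s) /\ @adm k x.2 r (behead s)
  end.

Lemma measurable_psi q k : measurable_fun setT (psi q k).
Proof. exact: measurable_bump. Qed.

Lemma measurable_mulS k (f : R -> R) (g : Rn R k -> R) :
  measurable_fun setT f -> measurable_fun setT g ->
  measurable_fun setT (fun z : Rn R k.+1 => f z.1 * g z.2).
Proof.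
move=> mf mg; apply: measurable_funM.
- exact: (measurableT_comp mf (@measurable_fst _ _ _ (Rn R k))).
- exact: (measurableT_comp mg (@measurable_snd _ _ (measurableTypeR R) _)).
Qed.

Lemma measurable_tens n s : measurable_fun setT (@tens n s).
Proof.
elim: n s => [|k IH] s; first exact: measurable_cst.
by apply: measurable_mulS; [exact: measurable_psi|exact: IH].
Qed.

Lemma measurable_dtens n i s : measurable_fun setT (@dtens n i s).
Proof.
elim: n i s => [|k IH] i s; first exact: measurable_cst.
case: i => [|i]; apply: measurable_mulS; try exact: measurable_psi; try exact: IH.
exact: measurable_tens.
Qed.

Lemma tens_bounded n s z : `|@tens n s z| <= 1.
Proof.
elim: n s z => [|k IH] s z; first by rewrite normr1.
rewrite [tens _ _]/= normrM mulr_ile1 ?IH//.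
by rewrite ger0_norm ?bump0_ge0// bump0_le1.
Qed.

Lemma dtens_bounded n i s : exists C, forall z, `|@dtens n i s z| <= C.
Proof.
elim: n i s => [|k IH] i s; first by exists 0 => z; rewrite normr0.
case: i => [|i].
  have [C hC] := @bump_bounded R (ratr (head prm0 s).1.1) (ratr (head prm0 s).1.2) (head prm0 s).2%:R 1 (ler0n _ _).
  exists (C * 1) => z; rewrite [dtens _ _ _]/= normrM ler_pM//; [exact: hC|exact: tens_bounded].
have [C hC] := IH i (behead s).
exists (1 * C) => z; rewrite [dtens _ _ _]/= normrM ler_pM ?hC//.
by rewrite ger0_norm ?bump0_ge0// bump0_le1.
Qed.

Lemma integrable_mul_tens n (F : Rn R n -> R) s : (lebn R n).-integrable setT (EFin \o F) ->
  (lebn R n).-integrable setT (EFin \o (fun z => F z * tens s z)).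
Proof.
move=> iF; apply: (integrable_mul_bounded _ iF (@measurable_tens n s) (C := 1)) => //.
by move=> z _; exact: tens_bounded.
Qed.

Lemma integrable_mul_dtens n (F : Rn R n -> R) i s : (lebn R n).-integrable setT (EFin \o F) ->
  (lebn R n).-integrable setT (EFin \o (fun z => F z * dtens i s z)).
Proof.
move=> iF; have [C hC] := @dtens_bounded n i s.
by apply: (integrable_mul_bounded _ iF (@measurable_dtens n i s) (C := C)).
Qed.

Lemma lebnS_fubini_head k (F : Rn R k.+1 -> R) (f : R -> R) (g : Rn R k -> R) :
  (lebn R k.+1).-integrable setT (EFin \o F) ->
  measurable_fun setT g -> (exists C, forall y, `|g y| <= C) ->
  measurable_fun setT f -> (exists C, forall t, `|f t| <= C) ->
  mu1.-integrable setT (EFin \o (fun t => \int[lebn R k]_y (F (t, y) * g y))%R) /\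
  (\int[lebn R k.+1]_z (F z * (f z.1 * g z.2)) =
   \int[mu1]_t ((\int[lebn R k]_y (F (t, y) * g y)) * f t))%R.
Proof.
move=> iF mg [C gC] mf [C' fC].
have iFg : (lebn R k.+1).-integrable setT (EFin \o (fun z : Rn R k.+1 => F z * g z.2)).
  apply: (integrable_mul_bounded _ iF (C := C)) => //.
  exact: (measurableT_comp mg (@measurable_snd _ _ (measurableTypeR R) _)).
have iFfg : (lebn R k.+1).-integrable setT (EFin \o (fun z : Rn R k.+1 => F z * (f z.1 * g z.2))).
  apply: (integrable_mul_bounded _ iF (C := C' * C)) => //.
    exact: measurable_mulS.
  by move=> z _; rewrite normrM ler_pM.
have [i1 _] := @Rfubini1 _ _ _ _ _ mu1 (lebn R k) _ iFg.
have [i2 e2] := @Rfubini1 _ _ _ _ _ mu1 (lebn R k) _ iFfg.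
split => //; rewrite [LHS]e2.
apply: Rintegral_ae_eq => //.
  by apply: (integrable_mul_bounded _ i1 mf (C := C')).
apply: ae_mono (@ae_slices _ _ _ _ _ mu1 (lebn R k) _ iFg).1 => t it /=.
rewrite -RintegralZr//; apply: eq_Rintegral => y _ /=; ring.
Qed.

(** Induction on the dimension. Integrating out all but the first coordinate reduces to
    [psi_fundamental] for each parameter list; the lists being countable, almost every slice passes
    all tests at once and the induction hypothesis applies to it. *)
Lemma tens_fundamental n (x : Rn R n) r (F : Rn R n -> R) :
  (lebn R n).-integrable setT (EFin \o F) ->
  (forall s, adm x r s -> (\int[lebn R n]_z (F z * tens s z) = 0)%R) ->
  {ae lebn R n, forall z, cube x r z -> F z = 0}.
Proof.
elim: n x F => [|k IH] x F iF h0.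
  have := h0 [::] I; rewrite /Rintegral/= integral_dirac//.
  rewrite diracT mul1e/= mulr1 => F0.
  by apply: aeW => -[] _.
have mF : measurable_fun setT F by have /integrableP[/measurable_EFinP] := iF.
have h1 s : adm x.2 r s ->
    {ae mu1, forall t, `|t - x.1| < r -> (\int[lebn R k]_y (F (t, y) * tens s y))%R = 0}.
  move=> adms; apply: psi_fundamental.
    have [] := @lebnS_fubini_head k F (cst 0) (@tens k s) iF (@measurable_tens _ _) _ _ _ => //.
    - by exists 1 => y; exact: tens_bounded.
    - by exists 0 => t; rewrite normr0.
  move=> q admq; have := h0 (q :: s) (conj admq adms).
  have [] := @lebnS_fubini_head k F (psi q 0) (@tens k s) iF (@measurable_tens _ _) _ (measurable_psi _ _) _.
  - by exists 1 => y; exact: tens_bounded.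
  - by exists 1 => t; rewrite ger0_norm ?bump0_ge0// bump0_le1.
  by move=> _ <-.
pose N := [set z : Rn R k.+1 | cube x r z /\ F z != 0].
have mN : measurable N.
  apply: measurableI; first exact: measurable_cube.
  have := mF measurableT _ (measurableC (measurable_set1 0)); rewrite setTI.
  by congr measurable; apply/seteqP; split => z /= /eqP.
suff [N' [mN' N0 sN]] : (lebn R k.+1).-negligible N.
  exists N'; split => // z /= /not_implyP[h2 h3]; apply: sN; split => //.
  by apply/negP => /eqP.
apply: (@ae_product _ _ _ _ _ mu1 (lebn R k)) => //.
have h2 : {ae mu1, forall t, forall s, adm x.2 r s -> `|t - x.1| < r ->
    (\int[lebn R k]_y (F (t, y) * tens s y))%R = 0}.
  apply: ae_forall_count => s; have [a|na] := pselect (adm x.2 r s).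
    by apply: ae_mono (h1 s a).
  by apply: aeW.
apply: ae_mono (ae_and h2 (@ae_slices _ _ _ _ _ mu1 (lebn R k) _ iF).1) => t [ht it].
have [tr|tr] := ltP `|t - x.1| r; last first.
  by apply: aeW => y -[[]]; rewrite /= ltNge tr.
apply: ae_mono (IH x.2 _ it _) => [y hy [[_ /hy Fy]]|s adms]; last exact: ht.
by rewrite Fy eqxx.
Qed.

End tens.

Lemma measurable_fun_indic_in d (T : measurableType d) (R : realType) (D S : set T) :
  measurable (D `&` S) -> measurable_fun D (\1_S : T -> R).
Proof.
move=> mDS; apply: (eq_measurable_fun (\1_(D `&` S) : T -> R)).
  by move=> t tD; rewrite !indicE in_setI tD.
exact/measurable_funTS/measurable_indic.
Qed.

(** * Truncated distances *)

Section lines.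
Variable R : realType.
Local Notation mu1 := (@lebesgue_measure R).

(** [a'] is the last point where [D] is at most [al], and [b'] the first point after it where [D] is
    at least [be]; continuity puts the inequalities at the two points themselves. *)
Lemma crossing (D : R -> R) (a b al be : R) : a < b -> al < be ->
  (forall t, a <= t <= b -> forall e : R, 0 < e -> exists2 de : R, 0 < de &
     forall s, a <= s <= b -> `|s - t| < de -> `|D s - D t| < e) ->
  D a <= al -> be <= D b ->
  exists a' b', [/\ a <= a', a' < b', b' <= b &
    [/\ D a' <= al, be <= D b' & forall t, a' < t < b' -> al < D t < be]].
Proof.
move=> ab albe cD Da Db.
pose S1 := [set t | a <= t <= b /\ D t <= al].
have S1a : S1 a by rewrite /S1/= lexx ltW.
have hS1 : has_sup S1 by split; [exists a|exists b => t [/andP[_ ?]]].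
pose a' := sup S1.
have aa' : a <= a' by apply: ub_le_sup => //; exact: hS1.2.
have a'b : a' <= b by apply: ge_sup; [exists a|move=> t [/andP[_ ?]]].
have Da' : D a' <= al.
  rewrite leNgt; apply/negP => h.
  have [|de de0 hde] := cD a' _ (D a' - al) ltac:(by rewrite subr_gt0); first by rewrite aa'.
  have [t [tab Dt] ht] := sup_adherent de0 hS1.
  have ta' : t <= a' by apply: ub_le_sup => //; exact: hS1.2.
  have := hde t tab; rewrite distrC ger0_norm ?subr_ge0// => /(_ _)/ltr_normlP[|h1 h2].
    by rewrite -/a' in ht; lra.
  lra.
have Dgt t : a' < t <= b -> al < D t.
  move=> /andP[t1 t2]; rewrite ltNge; apply/negP => h.
  have : t <= a' by apply: ub_le_sup; [exact: hS1.2|split => //; rewrite t2 andbT (le_trans aa')// ltW].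
  by rewrite leNgt t1.
pose S2 := [set t | a' <= t <= b /\ be <= D t].
have S2b : S2 b by rewrite /S2/= lexx a'b.
have hS2 : has_inf S2 by split; [exists b|exists a' => t [/andP[? _]]].
pose b' := inf S2.
have b'b : b' <= b by apply: ge_inf => //; exact: hS2.2.
have a'b' : a' <= b' by apply: lb_le_inf; [exists b|move=> t [/andP[? _]]].
have Db' : be <= D b'.
  rewrite leNgt; apply/negP => h.
  have [|de de0 hde] := cD b' _ (be - D b') ltac:(by rewrite subr_gt0).
    by rewrite b'b andbT (le_trans aa').
  have [t [/andP[t1 t2] Dt] ht] := inf_adherent de0 hS2.
  have b't : b' <= t by apply: ge_inf => //; [exact: hS2.2|split => //; rewrite t1].
  have tab : a <= t <= b by rewrite t2 (le_trans aa').
  have := hde t tab; rewrite ger0_norm ?subr_ge0// => /(_ _)/ltr_normlP[|h1 h2].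
    by rewrite -/b' in ht; lra.
  lra.
exists a', b'; split => //.
  rewrite lt_neqAle a'b' andbT; apply/eqP => h; move: Db'; rewrite -h; lra.
split => // t /andP[t1 t2]; rewrite Dgt/=; last by rewrite t1 ltW// (lt_le_trans t2).
rewrite ltNge; apply/negP => h.
have : b' <= t by apply: ge_inf; [exact: hS2.2|split => //; rewrite (ltW t1)/= ltW// (lt_le_trans t2)].
by rewrite leNgt t2.
Qed.

(** With [s = 2 ^- k] and the distance to f(x) for the argument this is the function v_k of the
    overview. *)
Definition trunc (s x : R) : R := Num.min 1 (Num.max 0 (x / s - 1)).

Lemma truncE s x : 0 < s -> trunc s x = (Num.max s (Num.min x (s + s)) - s) / s.
Proof.
move=> s0; rewrite /trunc.
have -> : x / s - 1 = (x - s) / s by rewrite mulrBl divff ?gt_eqF.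
have [h1|h1] := leP x s.
  rewrite [Num.max 0 _]max_l; last by rewrite pmulr_lle0 ?invr_gt0// subr_le0.
  rewrite [Num.min 1 0]min_r// [Num.min x _]min_l; last lra.
  by rewrite max_l// subrr mul0r.
rewrite [Num.max 0 _]max_r; last by rewrite divr_ge0 ?(ltW s0)// subr_ge0 ltW.
have [h2|h2] := leP x (s + s).
  rewrite [Num.max s x]max_r ?ltW// min_r// ler_pdivrMr//; lra.
rewrite [Num.max s _]max_r; last lra.
rewrite addrK divff ?gt_eqF// min_l// ler_pdivlMr//; lra.
Qed.

Lemma trunc01 s x : 0 <= trunc s x <= 1.
Proof. by rewrite /trunc le_min ge_min lexx ler01 le_max lexx. Qed.

Definition shell (s : R) (D : R -> R) : set R := [set t | s < D t < s + s].

(** If the truncation changes, [D] must cross the range between its two values clamped to [s, 2s].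
    On a crossing interval [D] stays in the shell and its increment is bounded by the integral of
    [H] there. This takes the place of a chain rule. *)
Lemma trunc_line (c r s : R) (D H : R -> R) : 0 < s ->
  (forall t, `|t - c| < r -> forall e : R, 0 < e -> exists2 de : R, 0 < de &
     forall s, `|s - c| < r -> `|s - t| < de -> `|D s - D t| < e) ->
  (forall t, 0 <= H t) -> measurable_fun (ball c r) H -> measurable_fun (ball c r) D ->
  (forall a b, `|a - c| < r -> `|b - c| < r -> a < b ->
     (`|D b - D a|%:E <= \int[mu1]_(t in `]a, b[) (H t)%:E)%E) ->
  forall a b, `|a - c| < r -> `|b - c| < r -> a < b ->
   (`|trunc s (D b) - trunc s (D a)|%:E <=
     \int[mu1]_(t in ball c r) (s^-1 * H t * \1_(shell s D) t)%:E)%E.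
Proof.
move=> s0 cD H0 mH mD hD a b ac bc ab.
have I_ t : a <= t <= b -> `|t - c| < r.
  move: ac bc; rewrite !ltr_norml => /andP[a1 a2] /andP[b1 b2] /andP[t1 t2].
  by apply/andP; split; lra.
have mball : measurable (ball c r) by exact: measurable_ball.
have mS : measurable (ball c r `&` shell s D).
  rewrite (_ : shell s D = D @^-1` `]s, (s + s)[%classic).
    exact: mD.
  by apply/seteqP; split => t /=; rewrite in_itv.
have m1S : measurable_fun (ball c r) (fun t => s^-1 * H t * \1_(shell s D) t).
  rewrite (_ : (fun t => _) = (fun t => s^-1 * (H t * \1_(shell s D) t))); last first.
    by apply/funext => t; rewrite mulrA.
  apply: measurable_funM => //; apply: measurable_funM => //.
  exact: measurable_fun_indic_in.
have key al be a' b' : s <= al -> al < be -> be <= s + s -> a <= a' -> a' < b' -> b' <= b ->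
   be - al <= `|D b' - D a'| -> (forall t, a' < t < b' -> al < D t < be) ->
   (((be - al) / s)%:E <= \int[mu1]_(t in ball c r) (s^-1 * H t * \1_(shell s D) t)%:E)%E.
  move=> sal albe be2 aa' a'b' b'b hbe hsh.
  have sub : `]a', b'[%classic `<=` ball c r.
    move=> t; rewrite /= in_itv/= => /andP[t1 t2]; rewrite /ball/= distrC; apply: I_.
    by rewrite (le_trans aa') ?ltW// (lt_le_trans t2).
  apply: (@le_trans _ _ (s^-1%:E * \int[mu1]_(t in `]a', b'[) (H t)%:E)%E).
    rewrite mulrC EFinM lee_pmul2l ?lte_fin ?invr_gt0//.
    apply: le_trans (hD a' b' _ _ a'b'); first by rewrite lee_fin.
    - by apply: I_; rewrite aa' (le_trans (ltW a'b')).
    - by apply: I_; rewrite b'b andbT (le_trans aa')// ltW.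
  rewrite -ge0_integralZl_EFin//; last 3 first.
  - by move=> t _; rewrite lee_fin.
  - by apply/measurable_EFinP; apply: measurable_funS mH.
  - by rewrite invr_ge0 ltW.
  apply: (@le_trans _ _ (\int[mu1]_(t in `]a', b'[) (s^-1 * H t * \1_(shell s D) t)%:E)%E).
    rewrite le_eqVlt; apply/orP; left; apply/eqP; apply: eq_integral => t.
    rewrite inE/= in_itv/= => /hsh /andP[h1 h2].
    rewrite indicE mem_set ?mulr1//; apply/andP; split; lra.
  apply: ge0_subset_integral => //; first exact/measurable_EFinP.
  by move=> t _; rewrite lee_fin !mulr_ge0// invr_ge0 ltW.
rewrite !truncE// -mulrBl opprB addrA subrK normrM [`|s^-1|]gtr0_norm ?invr_gt0//.
set be := Num.max s (Num.min (D b) (s + s)); set al := Num.max s (Num.min (D a) (s + s)).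
have cl x : s <= Num.max s (Num.min x (s + s)) <= s + s.
  by rewrite le_max lexx/= ge_max ge_min lexx orbT andbT; lra.
have /andP[al1 al2] := cl (D a); have /andP[be1 be2] := cl (D b).
rewrite -/al -/be in al1 al2 be1 be2.
have cD' : forall t, a <= t <= b -> forall e : R, 0 < e -> exists2 de : R, 0 < de &
     forall s, a <= s <= b -> `|s - t| < de -> `|D s - D t| < e.
  move=> t tab e e0; have [de de0 hde] := cD t (I_ t tab) e e0.
  by exists de => // s' s'ab; apply: hde; exact: I_.
have [h|h|h] := ltgtP al be; last first.
- by rewrite h subrr normr0 mul0r integral_ge0// => t _; rewrite lee_fin !mulr_ge0// invr_ge0 ltW.
- rewrite ltr0_norm ?subr_lt0// opprB.
  have D1 : - D a <= - al.
    by rewrite lerN2 /al ge_max ge_min lexx/= andbT leNgt; apply/negP => h'; move: h; rewrite /al max_l ?ltNge ?be1// ge_min ltW.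
  have D2 : - be <= - D b.
    by rewrite lerN2; move: h al2; rewrite /be; have [|] := leP (D b) (s + s); rewrite ?le_max ?lexx ?orbT// => ?; rewrite max_r; lra.
  have cDN : forall t, a <= t <= b -> forall e : R, 0 < e -> exists2 de : R, 0 < de &
     forall s, a <= s <= b -> `|s - t| < de -> `|(- D s) - (- D t)| < e.
    move=> t tab e e0; have [de de0 hde] := cD' t tab e e0; exists de => // s' s'ab h'.
    by rewrite -opprD normrN; exact: hde.
  have [a' [b' [h1 h2 h3 [h4 h5 h6]]]] := @crossing (fun t => - D t) a b (- al) (- be) ab ltac:(by rewrite ltrN2) cDN D1 D2.
  apply: (key be al a' b') => //.
    by rewrite ler_normr; apply/orP; right; lra.
  by move=> t /h6; rewrite !ltrN2 andbC.
- rewrite gtr0_norm ?subr_gt0//.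
  have D1 : D a <= al.
    by move: h be2; rewrite /al; have [|] := leP (D a) (s + s); rewrite ?le_max ?lexx ?orbT// => ?; rewrite max_r; lra.
  have D2 : be <= D b.
    by rewrite /be ge_max ge_min lexx/= andbT leNgt; apply/negP => h'; move: h; rewrite /be max_l ?ltNge ?al1// ge_min ltW.
  have [a' [b' [h1 h2 h3 [h4 h5 h6]]]] := @crossing D a b al be ab h cD' D1 D2.
  apply: (key al be a' b') => //.
  by rewrite ler_normr; apply/orP; left; lra.
Qed.

End lines.

(** * From the weak differential to almost every coordinate line *)

Section acl_test.
Variable R : realType.
Local Notation mu1 := (@lebesgue_measure R).

Lemma measurable_slice1 k (F : Rn R k.+1 -> R) t :
  measurable_fun setT F -> measurable_fun setT (fun y : Rn R k => F (t, y)).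
Proof. by move=> mF; exact: (measurableT_comp mF (@pair1_measurable _ _ (measurableTypeR R) (Rn R k) t)). Qed.

Lemma measurable_slice2 k (F : Rn R k.+1 -> R) y :
  measurable_fun setT F -> measurable_fun setT (fun t : R => F (t, y)).
Proof. by move=> mF; exact: (measurableT_comp mF (@pair2_measurable _ _ (measurableTypeR R) (Rn R k) y)). Qed.

Lemma lebnS_fubini_tail k (F : Rn R k.+1 -> R) (f : R -> R) (g : Rn R k -> R) :
  (lebn R k.+1).-integrable setT (EFin \o F) ->
  measurable_fun setT g -> (exists C, forall y, `|g y| <= C) ->
  measurable_fun setT f -> (exists C, forall t, `|f t| <= C) ->
  (lebn R k).-integrable setT (EFin \o (fun y => \int[mu1]_t (F (t, y) * f t))%R) /\
  (\int[lebn R k.+1]_z (F z * (f z.1 * g z.2)) =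
   \int[lebn R k]_y ((\int[mu1]_t (F (t, y) * f t)) * g y))%R.
Proof.
move=> iF mg [C gC] mf [C' fC].
have iFf : (lebn R k.+1).-integrable setT (EFin \o (fun z : Rn R k.+1 => F z * f z.1)).
  apply: (integrable_mul_bounded _ iF (C := C')) => //.
  exact: (measurableT_comp mf (@measurable_fst _ _ _ (Rn R k))).
have iFfg : (lebn R k.+1).-integrable setT (EFin \o (fun z : Rn R k.+1 => F z * (f z.1 * g z.2))).
  apply: (integrable_mul_bounded _ iF (C := C' * C)) => //.
    exact: measurable_mulS.
  by move=> z _; rewrite normrM ler_pM.
have [i1 _] := @Rfubini2 _ _ _ _ _ mu1 (lebn R k) _ iFf.
have [i2 e2] := @Rfubini2 _ _ _ _ _ mu1 (lebn R k) _ iFfg.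
split => //; rewrite [LHS]e2.
apply: Rintegral_ae_eq => //.
  by apply: (integrable_mul_bounded _ i1 mg (C := C)).
apply: ae_mono (@ae_slices _ _ _ _ _ mu1 (lebn R k) _ iFf).2 => y iy /=.
rewrite -RintegralZr//; apply: eq_Rintegral => t _ /=; ring.
Qed.

Lemma tens_bounded_ex n s : exists C, forall z, `|@tens R n s z| <= C.
Proof. by exists 1 => z; exact: tens_bounded. Qed.

Section dist.
Variables (d : nat) (y0 : 'I_d -> R).

(** The sup norm is convenient in the target: a common bound for the increments of all coordinates
    bounds the increment of the distance, with no dimensional factor. *)
Definition dist (p : 'I_d -> R) : R := \big[Num.max/0]_(j < d) `|p j - y0 j|.

Lemma dist_ge0 p : 0 <= dist p.
Proof. by rewrite /dist; elim/big_rec: _ => // j x _ x0; rewrite le_max x0 orbT. Qed.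

Lemma dist_coord p j : `|p j - y0 j| <= dist p.
Proof. exact: (@le_bigmax _ _ _ _ (fun j => `|p j - y0 j|)). Qed.

Lemma dist_le p e : 0 <= e -> (forall j, `|p j - y0 j| <= e) -> dist p <= e.
Proof. by move=> e0 h; apply/bigmax_leP; split. Qed.

Lemma dist_lip p q e : 0 <= e -> (forall j, `|p j - q j| <= e) -> `|dist p - dist q| <= e.
Proof.
move=> e0 h; suff key p' q' : (forall j, `|p' j - q' j| <= e) -> dist p' <= dist q' + e.
  rewrite ler_norml; apply/andP; split.
    by rewrite lerBrDr addrC lerBlDr; apply: key => j; rewrite distrC.
  by rewrite lerBlDl; exact: key.
move=> h'; apply: dist_le => [|j]; first by rewrite addr_ge0// dist_ge0.
have -> : p' j - y0 j = (q' j - y0 j) + (p' j - q' j) by ring.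
by rewrite (le_trans (ler_normD _ _))// lerD// dist_coord.
Qed.

Lemma measurable_dist d' (T : measurableType d') (E : set T) (u : 'I_d -> T -> R) :
  (forall j, measurable_fun E (u j)) -> measurable_fun E (fun z => dist (fun j => u j z)).
Proof.
move=> mu_; rewrite /dist; elim: (index_enum _) => [|j s IH].
  by under eq_fun do rewrite big_nil; exact: measurable_cst.
under eq_fun do rewrite big_cons; apply: measurable_maxr => //.
by apply: measurableT_comp => //; apply: measurable_funB.
Qed.

End dist.

Lemma norm_lt_between (a b t c r : R) :
  `|a - c| < r -> `|b - c| < r -> a < t -> t < b -> `|t - c| < r.
Proof. by rewrite !ltr_norml => /andP[? _] /andP[_ ?] ? ?; apply/andP; split; lra. Qed.

(* The variation of v along almost every coordinate line of the cube is at most the integral of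
   h over that line. *)
Fixpoint acl (n : nat) : Rn R n -> R -> (Rn R n -> R) -> (Rn R n -> R) -> Prop :=
  match n return Rn R n -> R -> (Rn R n -> R) -> (Rn R n -> R) -> Prop with
  | 0 => fun _ _ _ _ => True
  | k.+1 => fun x r v h =>
    {ae lebn R k, forall y, cube x.2 r y ->
      forall a b, `|a - x.1| < r -> `|b - x.1| < r ->
      (`|v (b, y) - v (a, y)|%:E <= \int[mu1]_(t in ball (x.1 : R) r) (h (t, y))%:E)%E} /\
    {ae mu1, forall t, `|t - x.1| < r ->
      @acl k x.2 r (fun y => v (t, y)) (fun y => h (t, y))}
  end.

(** Weak partial derivatives tested on products of bumps only. Indexing [g] by all naturals makes
    the passage to a slice a mere shift of the index. *)
Definition tensor_weak n (x : Rn R n) r (u : Rn R n -> R) (g : nat -> Rn R n -> R) :=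
  forall i s, (i < n)%N -> adm x r s ->
  (\int[lebn R n]_z (u z * dtens i s z + g i z * tens s z) = 0)%R.

(** For each parameter of the first factor, the expression left after integrating in the first
    variable is orthogonal to all products in [y], hence 0 for almost every [y]. Countability merges
    the exceptional sets, and [psi_acl] applies on every remaining line. *)
Lemma tensor_weak_head k (x : Rn R k.+1) (r M : R) (u : Rn R k.+1 -> R) (g : nat -> Rn R k.+1 -> R) :
  (lebn R k.+1).-integrable setT (EFin \o u) ->
  (lebn R k.+1).-integrable setT (EFin \o g 0) ->
  (forall z, cube x r z -> `|u z| <= M) -> cubecont (cube x r) u ->
  tensor_weak x r u g ->
  {ae lebn R k, forall y, cube x.2 r y ->
    forall a b, `|a - x.1| < r -> `|b - x.1| < r -> a < b ->
    (\int[mu1]_(t in `]a, b[) g 0%N (t, y) = u (b, y) - u (a, y))%R}.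
Proof.
move=> iu ig uM cu T0.
have h1 (q : prm) : adm1 (x.1 : R) r q -> {ae lebn R k, forall y, cube x.2 r y ->
    (\int[mu1]_t (u (t, y) * psi q 1 t) + \int[mu1]_t (g 0%N (t, y) * psi q 0 t) = 0)%R}.
  move=> admq.
  have psib j : exists C, forall t, `|@psi R q j t| <= C by exact: bump_bounded.
  have A s := @lebnS_fubini_tail k u (psi q 1) (tens s) iu (@measurable_tens _ _ _)
    (tens_bounded_ex _ s) (@measurable_psi _ _ _) (psib 1%N).
  have B s := @lebnS_fubini_tail k (g 0%N) (psi q 0) (tens s) ig (@measurable_tens _ _ _)
    (tens_bounded_ex _ s) (@measurable_psi _ _ _) (psib 0%N).
  apply: tens_fundamental.
    by have [iA _] := A [::]; have [iB _] := B [::]; exact: integrableDr iA iB.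
  move=> s adms; have := T0 0%N (q :: s) isT (conj admq adms).
  have iA : (lebn R k.+1).-integrable setT (EFin \o (fun z => u z * dtens 0 (q :: s) z)).
    exact: integrable_mul_dtens.
  have iB : (lebn R k.+1).-integrable setT (EFin \o (fun z => g 0%N z * tens (q :: s) z)).
    exact: integrable_mul_tens.
  rewrite RintegralD// => T0s.
  have [iA' eA] := A s; have [iB' eB] := B s.
  rewrite -[RHS]T0s [X in _ = X + _]eA [X in _ = _ + X]eB.
  rewrite -RintegralD//.
  - by apply: eq_Rintegral => y _; rewrite mulrDl.
  - exact: (integrable_mul_tens s iA').
  - exact: (integrable_mul_tens s iB').
have h2 : {ae lebn R k, forall y, forall q : prm, cube x.2 r y -> adm1 (x.1 : R) r q ->
    (\int[mu1]_t (u (t, y) * psi q 1 t) + \int[mu1]_t (g 0%N (t, y) * psi q 0 t) = 0)%R}.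
  apply: ae_forall_count => q; have [a|na] := pselect (adm1 (x.1 : R) r q).
    by apply: ae_mono (h1 q a) => y /[apply].
  by apply: aeW.
have su := (@ae_slices _ _ _ _ _ mu1 (lebn R k) _ iu).2.
have sg := (@ae_slices _ _ _ _ _ mu1 (lebn R k) _ ig).2.
apply: ae_mono (ae_and h2 (ae_and su sg)) => y [hq [iuy igy]] xy a b ax bx ab.
apply: (@psi_acl R x.1 r M (fun t => u (t, y)) (fun t => g 0%N (t, y))) => //.
- by move=> t tx; apply: uM.
- move=> t tx e e0; have [de de0 hde] := cu (t, y) (conj tx xy) e e0.
  exists de => // s sx st; apply/ltW; apply: hde => //.
  by split => //=; exact: cubexx.
- move=> q admq; rewrite RintegralD//; first exact: hq.
  + exact: integrable_mul_psik.
  + exact: integrable_mul_psik.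
- by move: ax; rewrite distrC ltr_distlC => /andP[].
- by move: bx; rewrite distrC ltr_distlC => /andP[].
Qed.

(** The first factor of the test function is free, so [psi_fundamental] removes it: almost every
    slice satisfies the same hypothesis one dimension lower. *)
Lemma tensor_weak_tail k (x : Rn R k.+1) (r : R) (u : Rn R k.+1 -> R) (g : nat -> Rn R k.+1 -> R) :
  (lebn R k.+1).-integrable setT (EFin \o u) ->
  (forall i, (i < k.+1)%N -> (lebn R k.+1).-integrable setT (EFin \o g i)) ->
  tensor_weak x r u g ->
  {ae mu1, forall t, `|t - x.1| < r ->
    tensor_weak x.2 r (fun y => u (t, y)) (fun i y => g i.+1 (t, y))}.
Proof.
move=> iu ig T0.
suff h : {ae mu1, forall t, forall p : nat * seq prm, `|t - x.1| < r -> (p.1 < k)%N -> adm x.2 r p.2 ->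
   (\int[lebn R k]_y (u (t, y) * dtens p.1 p.2 y + g p.1.+1 (t, y) * tens p.2 y) = 0)%R}.
  by apply: ae_mono h => t ht tx i s ik adms; exact: (ht (i, s)).
apply: ae_forall_count => -[i s] /=.
have [ik|] := boolP (i < k)%N; last by move=> _; apply: aeW.
have [adms|] := pselect (adm x.2 r s); last by move=> ?; apply: aeW.
have [C hC] := @dtens_bounded R k i s.
have A q := @lebnS_fubini_head R k u (psi q 0) (dtens i s) iu (@measurable_dtens _ _ _ _)
    (ex_intro _ C hC) (@measurable_psi _ _ _) (@bump_bounded R _ _ _ _ (ler0n _ _)).
have B q := @lebnS_fubini_head R k (g i.+1) (psi q 0) (tens s) (ig i.+1 ik) (@measurable_tens _ _ _)
    (tens_bounded_ex _ s) (@measurable_psi _ _ _) (@bump_bounded R _ _ _ _ (ler0n _ _)).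
have [iA0 _] := A prm0; have [iB0 _] := B prm0.
have h1 : {ae mu1, forall t, `|t - x.1| < r ->
   (\int[lebn R k]_y (u (t, y) * dtens i s y) + \int[lebn R k]_y (g i.+1 (t, y) * tens s y) = 0)%R}.
  apply: psi_fundamental; first exact: integrableDr iA0 iB0.
  move=> q admq; have := T0 i.+1 (q :: s) ik (conj admq adms).
  have iA : (lebn R k.+1).-integrable setT (EFin \o (fun z => u z * dtens i.+1 (q :: s) z)).
    exact: integrable_mul_dtens.
  have iB : (lebn R k.+1).-integrable setT (EFin \o (fun z => g i.+1 z * tens (q :: s) z)).
    by apply: integrable_mul_tens; exact: ig.
  rewrite RintegralD// => T0s.
  have [iA' eA] := A q; have [iB' eB] := B q.
  rewrite -[RHS]T0s [X in _ = X + _]eA [X in _ = _ + X]eB.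
  rewrite -RintegralD//.
  - by apply: eq_Rintegral => t _; rewrite mulrDl.
  - exact: (integrable_mul_psik q 0 iA').
  - exact: (integrable_mul_psik q 0 iB').
have su := (@ae_slices _ _ _ _ _ mu1 (lebn R k) _ iu).1.
have sg := (@ae_slices _ _ _ _ _ mu1 (lebn R k) _ (ig i.+1 ik)).1.
apply: ae_mono (ae_and h1 (ae_and su sg)) => t [h2 [iut igt]] tx _ _.
rewrite RintegralD//; first exact: h2.
- exact: integrable_mul_dtens.
- exact: integrable_mul_tens.
Qed.

(** Induction on the dimension: lines in the first direction are handled by [tensor_weak_head] and
    [trunc_line], while all other lines lie in slices, to which [tensor_weak_tail] transfers the
    weak identity. *)
Lemma acl_trunc_dist n d (y0 : 'I_d -> R) (x : Rn R n) (r M s : R)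
    (u : 'I_d -> Rn R n -> R) (g : 'I_d -> nat -> Rn R n -> R) (H : Rn R n -> R) :
  0 < s ->
  (forall j, (lebn R n).-integrable setT (EFin \o u j)) ->
  (forall j i, (i < n)%N -> (lebn R n).-integrable setT (EFin \o g j i)) ->
  (forall j z, cube x r z -> `|u j z| <= M) ->
  (forall j, cubecont (cube x r) (u j)) ->
  (forall j, tensor_weak x r (u j) (g j)) ->
  (forall z, 0 <= H z) -> measurable_fun setT H ->
  (forall j i z, (i < n)%N -> cube x r z -> `|g j i z| <= H z) ->
  acl x r (fun z => trunc s (dist y0 (fun j => u j z)))
    (fun z => s^-1 * H z * \1_[set z | s < dist y0 (fun j => u j z) < s + s] z).
Proof.
move=> s0; elim: n x u g H => [//|k IH] x u g H iu ig uM cu T0 H0 mH gH.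
have mu_ j : measurable_fun setT (u j) by have /integrableP[/measurable_EFinP] := iu j.
split.
  have h : {ae lebn R k, forall y, forall j, cube x.2 r y ->
      (forall a b, `|a - x.1| < r -> `|b - x.1| < r -> a < b ->
      (\int[mu1]_(t in `]a, b[) g j 0%N (t, y) = u j (b, y) - u j (a, y))%R) /\
      mu1.-integrable setT (EFin \o (fun t => g j 0%N (t, y)))}.
    apply: ae_forall_count => j.
    have := @tensor_weak_head k x r M (u j) (g j) (iu j) (ig j 0%N isT) (uM j) (cu j) (T0 j).
    move=> h1; apply: ae_mono (ae_and h1 (@ae_slices _ _ _ _ _ mu1 (lebn R k) _ (ig j 0%N isT)).2).
    by move=> y [h2 ?] /h2.
  apply: ae_mono h => y hy xy.
  pose D t := dist y0 (fun j => u j (t, y)).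
  have cD t : `|t - x.1| < r -> forall e : R, 0 < e -> exists2 de : R, 0 < de &
      forall s, `|s - x.1| < r -> `|s - t| < de -> `|D s - D t| < e.
    move=> tx e e0.
    have hj j : exists de : R, 0 < de /\ forall s, `|s - x.1| < r -> `|s - t| < de ->
        `|u j (s, y) - u j (t, y)| <= e / 2.
      have [de de0 hde] := cu j (t, y) (conj tx xy) (e / 2) ltac:(by rewrite divr_gt0).
      exists de; split => // s' sx st; apply/ltW; apply: hde => //.
      by split => //=; exact: cubexx.
    have [de hde] := choice hj.
    exists (\big[Num.min/1]_j de j).
      by elim/big_rec: _ => // j z _ z0; rewrite lt_min z0 (hde j).1.
    move=> s' sx st; rewrite (@le_lt_trans _ _ (e / 2)) ?ltr_pdivrMr ?ltr_pMr ?ltr1n//.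
    apply: dist_lip => [|j]; first by rewrite divr_ge0// ltW.
    apply: (hde j).2 => //; apply: lt_le_trans st _.
    exact: bigmin_le_cond.
  have mD : measurable_fun setT D.
    by apply: measurable_dist => j; exact: measurable_slice2.
  have hD a b : `|a - x.1| < r -> `|b - x.1| < r -> a < b ->
      (`|D b - D a|%:E <= \int[mu1]_(t in `]a, b[) (H (t, y))%:E)%E.
    move=> ax bx ab; set X := (\int[mu1]_(t in _) _)%E.
    have X0 : (0 <= X)%E by apply: integral_ge0 => t _; rewrite lee_fin.
    have hX j : (`|u j (b, y) - u j (a, y)|%:E <= X)%E.
      have [h1 h2] := hy j xy; rewrite -(h1 a b ax bx ab).
      have ig' : mu1.-integrable `]a, b[ (EFin \o (fun t => g j 0%N (t, y))).
        by apply: integrableS h2.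
      rewrite EFin_normr_Rintegral//.
      apply: le_trans (le_abse_integral _ _ _) _ => //; first exact: measurable_int ig'.
      apply: ge0_le_integral => //.
      - by apply: measurableT_comp => //; exact: measurable_int ig'.
      - by apply/measurable_EFinP; apply: measurable_funTS; exact: measurable_slice2.
      move=> t; rewrite /= in_itv/= => /andP[t1 t2]; rewrite lee_fin; apply: gH => //.
      by split => //=; exact: (norm_lt_between ax bx).
    case: X X0 hX => [X|_ _|//]; last by rewrite leey.
    rewrite !lee_fin => X0 hX; apply: dist_lip => // j; by have := hX j; rewrite lee_fin.
  have tl := @trunc_line R x.1 r s D (fun t => H (t, y)) s0 cD (fun t => H0 _) _ _ hD.
  have {}tl a b : `|a - x.1| < r -> `|b - x.1| < r -> a < b ->
    (`|trunc s (D b) - trunc s (D a)|%:E <=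
      \int[mu1]_(t in ball (x.1 : R) r) (s^-1 * H (t, y) * \1_(shell s D) t)%:E)%E.
    by apply: tl; apply: measurable_funTS => //; exact: measurable_slice2.
  move=> a b ax bx; have [ab|ab|->] := ltgtP a b.
  - exact: tl.
  - by have := tl b a bx ax ab; rewrite distrC.
  - rewrite subrr normr0; apply: integral_ge0 => t _; rewrite lee_fin.
    by rewrite !mulr_ge0// invr_ge0 ltW.
have hw : {ae mu1, forall t, forall j, `|t - x.1| < r ->
    tensor_weak x.2 r (fun y => u j (t, y)) (fun i y => g j i.+1 (t, y))}.
  apply: ae_forall_count => j.
  exact: (@tensor_weak_tail k x r (u j) (g j) (iu j) (ig j) (T0 j)).
have hu : {ae mu1, forall t, forall j, (lebn R k).-integrable setT (EFin \o (fun y => u j (t, y)))}.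
  by apply: ae_forall_count => j; exact: (@ae_slices _ _ _ _ _ mu1 (lebn R k) _ (iu j)).1.
have hg : {ae mu1, forall t, forall p : 'I_d * 'I_k,
    (lebn R k).-integrable setT (EFin \o (fun y => g p.1 p.2.+1 (t, y)))}.
  apply: ae_forall_count => -[j i] /=.
  exact: (@ae_slices _ _ _ _ _ mu1 (lebn R k) _ (ig j i.+1 (ltn_ord i))).1.
apply: ae_mono (ae_and hw (ae_and hu hg)) => t [ht1 [ht2 ht3]] tx.
apply: (IH x.2 (fun j y => u j (t, y)) (fun j i y => g j i.+1 (t, y)) (fun y => H (t, y))) => //.
- by move=> j i ik; exact: (ht3 (j, Ordinal ik)).
- by move=> j z xz; apply: uM.
- move=> j z xz e e0; have [de de0 hde] := cu j (t, z) (conj tx xz) e e0.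
  exists de => // w zw xw; apply: hde => //; split => //=.
  by rewrite subrr normr0.
- by move=> j; exact: ht1.
- exact: measurable_slice1.
- by move=> j i z ik xz; apply: gH.
Qed.

End acl_test.

(** * Averages over nested cubes *)

Section average.
Variable R : realType.
Local Notation mu1 := (@lebesgue_measure R).
Local Open Scope ereal_scope.

Lemma integral_setX d1 d2 (T1 : measurableType d1) (T2 : measurableType d2)
    (m1 : {sigma_finite_measure set T1 -> \bar R})
    (m2 : {sigma_finite_measure set T2 -> \bar R}) (A : set T1) (B : set T2)
    (F : T1 * T2 -> \bar R) :
  measurable A -> measurable B -> measurable_fun setT F -> (forall z, 0 <= F z) ->
  (\int[(m1 \x m2)]_(z in A `*` B) F z = \int[m1]_(t in A) \int[m2]_(y in B) F (t, y)) /\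
  (\int[(m1 \x m2)]_(z in A `*` B) F z = \int[m2]_(y in B) \int[m1]_(t in A) F (t, y)).
Proof.
move=> mA mB mF F0.
have mAB : measurable (A `*` B) by exact: measurableX.
have mF' : measurable_fun setT (F \_ (A `*` B)).
  by apply/(measurable_restrictT _ mAB); exact: measurable_funTS.
have F0' z : 0 <= (F \_ (A `*` B)) z by rewrite patchE; case: ifP.
split; rewrite integral_mkcond.
  rewrite (fubini_tonelli1 _ mF' F0') [RHS]integral_mkcond; apply: eq_integral => t _.
  rewrite /fubini_F [RHS]patchE; case: ifPn => [/set_mem At|/negP nAt].
    rewrite [RHS]integral_mkcond; apply: eq_integral => y _; rewrite !patchE.
    have [yB|yB] := boolP (y \in B); first by rewrite mem_set//; split => //; exact: set_mem.
    by rewrite memNset// => -[_ /mem_set]; exact/negP.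
  by apply: integral0_eq => y _; rewrite patchE memNset// => -[/mem_set].
rewrite (fubini_tonelli2 _ mF' F0') [RHS]integral_mkcond; apply: eq_integral => y _.
rewrite /fubini_G [RHS]patchE; case: ifPn => [/set_mem By|/negP nBy].
  rewrite [RHS]integral_mkcond; apply: eq_integral => t _; rewrite !patchE.
  have [tA|tA] := boolP (t \in A); first by rewrite mem_set//; split => //; exact: set_mem.
  by rewrite memNset// => -[/mem_set + _]; exact/negP.
by apply: integral0_eq => t _; rewrite patchE memNset// => -[_ /mem_set].
Qed.

Lemma integral_setX_meas d1 d2 (T1 : measurableType d1) (T2 : measurableType d2)
    (m1 : {sigma_finite_measure set T1 -> \bar R})
    (m2 : {sigma_finite_measure set T2 -> \bar R}) (A : set T1) (B : set T2)
    (F : T1 * T2 -> \bar R) :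
  measurable A -> measurable B -> measurable_fun setT F -> (forall z, 0 <= F z) ->
  measurable_fun setT (fun t => \int[m2]_(y in B) F (t, y)) /\
  measurable_fun setT (fun y => \int[m1]_(t in A) F (t, y)).
Proof.
move=> mA mB mF F0.
have hX (P : set (T1 * T2)) : measurable P -> measurable_fun setT (F \_ P) /\ forall z, 0 <= (F \_ P) z.
  move=> mP; split; last by move=> z; rewrite patchE; case: ifP.
  by apply/(measurable_restrictT _ mP); exact: measurable_funTS.
split.
  have [m' p'] := hX (setT `*` B) (measurableX measurableT mB).
  have := @measurable_fun_fubini_tonelli_F _ _ _ _ _ m2 _ m' p'.
  congr (measurable_fun _ _); apply/funext => t; rewrite /fubini_F [RHS]integral_mkcond.
  apply: eq_integral => y _; rewrite !patchE.
  have [yB|yB] := boolP (y \in B); first by rewrite mem_set//; split => //; exact: set_mem.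
  by rewrite memNset// => -[_ /mem_set]; exact/negP.
have [m' p'] := hX (A `*` setT) (measurableX mA measurableT).
have := @measurable_fun_fubini_tonelli_G _ _ _ _ _ m1 _ m' p'.
congr (measurable_fun _ _); apply/funext => y; rewrite /fubini_G [RHS]integral_mkcond.
apply: eq_integral => t _; rewrite !patchE.
have [tA|tA] := boolP (t \in A); first by rewrite mem_set//; split => //; exact: set_mem.
by rewrite memNset// => -[/mem_set + _]; exact/negP.
Qed.

Lemma ae_ge0_le_integral d (T : measurableType d) (m : {measure set T -> \bar R})
   (D : set T) (f1 f2 : T -> \bar R) : measurable D ->
  measurable_fun setT f1 -> measurable_fun setT f2 ->
  (forall x, 0 <= f1 x) -> (forall x, 0 <= f2 x) ->
  {ae m, forall x, D x -> f1 x <= f2 x} ->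
  \int[m]_(x in D) f1 x <= \int[m]_(x in D) f2 x.
Proof.
move=> mD mf1 mf2 f10 f20 [N [mN N0 sN]].
rewrite (ge0_negligible_integral mN mD _ _ N0)//; last exact: measurable_funTS.
rewrite [leRHS](ge0_negligible_integral mN mD _ _ N0)//; last exact: measurable_funTS.
apply: ge0_le_integral => //; first exact: measurableD.
- exact: measurable_funTS.
- exact: measurable_funTS.
- by move=> x [Dx nN]; apply: contrapT => h; apply: nN; apply: sN => /= /(_ Dx).
Qed.

Lemma ae_integral_comb d (T : measurableType d) (m : {measure set T -> \bar R})
   (D : set T) (f1 f2 f3 : T -> \bar R) (c1 c2 c3 : R) : measurable D ->
  measurable_fun setT f1 -> measurable_fun setT f2 -> measurable_fun setT f3 ->
  (forall x, 0 <= f1 x) -> (forall x, 0 <= f2 x) -> (forall x, 0 <= f3 x) ->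
  (0 <= c1)%R -> (0 <= c2)%R -> (0 <= c3)%R ->
  {ae m, forall x, D x -> c1%:E * f1 x <= c2%:E * f2 x + c3%:E * f3 x} ->
  c1%:E * \int[m]_(x in D) f1 x <=
  c2%:E * \int[m]_(x in D) f2 x + c3%:E * \int[m]_(x in D) f3 x.
Proof.
move=> mD m1 m2 m3 f10 f20 f30 c10 c20 c30 h.
rewrite -!ge0_integralZl_EFin//; try exact: measurable_funTS.
rewrite -ge0_integralD//; try (by apply: measurable_funeM; exact: measurable_funTS);
  try (by move=> t _; rewrite mule_ge0// lee_fin).
apply: ae_ge0_le_integral => //.
- exact: measurable_funeM.
- by apply: emeasurable_funD; exact: measurable_funeM.
- by move=> x; rewrite mule_ge0 ?lee_fin.
- by move=> x; rewrite adde_ge0// mule_ge0 ?lee_fin.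
Qed.

(** The average over the larger interval exceeds the one over the smaller by at most the oscillation
    bound [X]. Both lengths are multiplied out because the integrals are extended reals. *)
Lemma line_average (c r r' : R) (v : R -> R) (X : \bar R) :
  (0 < r')%R -> (r' <= r)%R -> 0 <= X ->
  measurable_fun setT v -> (forall t, 0 <= v t)%R ->
  (forall a b : R, (`|a - c| < r)%R -> (`|b - c| < r)%R -> `|v b - v a|%R%:E <= X) ->
  (2 * r')%:E * \int[mu1]_(t in ball c r) (v t)%:E <=
  (2 * r)%:E * \int[mu1]_(t in ball c r') (v t)%:E + ((2 * r) * (2 * r'))%:E * X.
Proof.
move=> r'0 r'r X0 mv v0 hv.
have r0 : (0 < r)%R by exact: lt_le_trans r'r.
case: X X0 hv => [X|_ _|//]; last first.
  rewrite gt0_muley ?lte_fin ?mulr_gt0// addey ?leey// gt_eqF//.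
  rewrite (lt_le_trans ltNy0)// mule_ge0//.
    by rewrite lee_fin mulr_ge0// ltW.
  by rewrite integral_ge0// => t _; rewrite lee_fin.
rewrite lee_fin => X0 hv.
have mb s : measurable (ball c s) by exact: measurable_ball.
have vball s : (0 < s)%R -> mu1 (ball c s) = (2 * s)%:E.
  by move=> s0; rewrite lebesgue_measure_ball ?(ltW s0)// mulr_natl.
have cstE s e : (0 < s)%R -> \int[mu1]_(w in ball c s) e%:E = (2 * s * e)%:E.
  move=> s0; rewrite integral_cst//=; last exact: mb.
  by rewrite (vball s s0) -EFinM mulrC.
have mve D : measurable_fun D (fun t => (v t)%:E) by apply/measurable_EFinP; exact: measurable_funTS.
have hbd t : ball c r t -> (2 * r')%:E * (v t)%:E <= \int[mu1]_(t in ball c r') (v t)%:E + (2 * r' * X)%:E.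
  move=> tr.
  have -> : (2 * r')%:E * (v t)%:E = \int[mu1]_(w in ball c r') (v t)%:E.
    by rewrite -EFinM; exact: (esym (cstE _ _ r'0)).
  have -> : (2 * r' * X)%:E = \int[mu1]_(w in ball c r') X%:E.
    exact: (esym (cstE _ _ r'0)).
  have h : forall w, ball c r' w -> (v t)%:E <= (v w)%:E + X%:E.
    move=> w wr'; rewrite -EFinD lee_fin.
    have := hv w t; rewrite lee_fin => h.
    rewrite -lerBlDl; apply: le_trans (ler_norm _) (h _ _).
      by rewrite distrC; apply: lt_le_trans r'r.
    by rewrite distrC.
  have := @ae_integral_comb _ _ mu1 (ball c r') (cst (v t)%:E) (fun w => (v w)%:E) (cst X%:E) 1 1 1 (mb r').
  rewrite !mul1e; apply => //; try (by move=> w; rewrite lee_fin).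
  - exact: mve.
  - by apply: aeW => w /h; rewrite !mul1e.
have mcst (D : set R) (e : \bar R) : measurable_fun D (cst e) by exact: measurable_cst.
have := @ae_integral_comb _ _ mu1 (ball c r) (fun t => (v t)%:E)
  (cst (\int[mu1]_(t in ball c r') (v t)%:E)) (cst (2 * r' * X)%:E) (2 * r') 1 1 (mb r).
rewrite !mul1e => h; apply: le_trans (h _ _ _ _ _ _ _ _ _ _) _ => //.
- exact: mve.
- by move=> t; rewrite integral_ge0// => w _; rewrite lee_fin.
- by move=> t; rewrite lee_fin mulr_ge0// mulr_ge0// ltW.
- by rewrite mulr_ge0// ltW.
- by apply: aeW => t /hbd; rewrite !mul1e.
rewrite integral_cst//=; last exact: mb.
rewrite cstE//; have -> : mu1 (ball c r) = (2 * r)%:E := vball r r0.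
rewrite -EFinM; apply: leeD; first by rewrite muleC.
by rewrite lee_fin [leRHS](_ : _ = 2 * r * (2 * r' * X))%R//; ring.
Qed.

(** After division by both volumes: the average over the large cube is at most the average over the
    small cube plus [n] times [(2 * r') ^ (1 - n)] times the integral of [h]. The tail coordinates
    are shrunk on almost every slice, then the head coordinate on almost every line. *)
Lemma average_le n (x : Rn R n) (r r' : R) (v h : Rn R n -> R) :
  (0 < r')%R -> (r' <= r)%R ->
  measurable_fun setT v -> (forall z, 0 <= v z)%R ->
  measurable_fun setT h -> (forall z, 0 <= h z)%R ->
  acl x r v h ->
  ((2 * r') ^+ n)%:E * \int[lebn R n]_(z in cube x r) (v z)%:E <=
  ((2 * r) ^+ n)%:E * \int[lebn R n]_(z in cube x r') (v z)%:E +
  (n%:R * (2 * r) ^+ n * (2 * r'))%:E * \int[lebn R n]_(z in cube x r) (h z)%:E.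
Proof.
move=> r'0 r'r; have r0 : (0 < r)%R by exact: lt_le_trans r'r.
elim: n x v h => [|k IH] x v h mv v0 mh h0.
  by move=> _; rewrite !mul0r mul0e adde0 !expr0 !mul1e.
move=> [acl1 acl2].
have mve : measurable_fun setT (fun z => (v z)%:E) by exact/measurable_EFinP.
have mhe : measurable_fun setT (fun z => (h z)%:E) by exact/measurable_EFinP.
have ve0 z : 0 <= (v z)%:E by rewrite lee_fin.
have he0 z : 0 <= (h z)%:E by rewrite lee_fin.
have mb s : measurable (ball (x.1 : R) s) by exact: measurable_ball.
have mc s : measurable (cube x.2 s) by exact: measurable_cube.
pose B s := ball (x.1 : R) s.
have F (G : Rn R k.+1 -> \bar R) s s' mG G0 := @integral_setX _ _ _ _ mu1 (lebn R k) (B s) (cube x.2 s') G (mb s) (mc s') mG G0.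
have M (G : Rn R k.+1 -> \bar R) s s' mG G0 := @integral_setX_meas _ _ _ _ mu1 (lebn R k) (B s) (cube x.2 s') G (mb s) (mc s') mG G0.
have II (G : Rn R k.+1 -> \bar R) s s' := \int[lebn R k.+1]_(z in B s `*` cube x.2 s') G z.
pose Iv s s' := \int[lebn R k.+1]_(z in B s `*` cube x.2 s') (v z)%:E.
pose Ih s s' := \int[lebn R k.+1]_(z in B s `*` cube x.2 s') (h z)%:E.
have Iv0 s s' : 0 <= Iv s s' by apply: integral_ge0.
have Ih0 s s' : 0 <= Ih s s' by apply: integral_ge0.
have pw (e : R) m : (0 < e)%R -> (0 <= (2 * e) ^+ m)%R by move=> e0; rewrite exprn_ge0// mulr_ge0// ltW.
have step1 : ((2 * r') ^+ k)%:E * Iv r r <= ((2 * r) ^+ k)%:E * Iv r r' +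
    (k%:R * (2 * r) ^+ k * (2 * r'))%:E * Ih r r.
  have c0 : (0 <= k%:R * (2 * r) ^+ k * (2 * r'))%R by rewrite !mulr_ge0// ?pw// ltW.
  rewrite /Iv /Ih (F _ r r mve ve0).1 (F _ r r' mve ve0).1 (F _ r r mhe he0).1.
  apply: ae_integral_comb; rewrite ?pw//.
  - exact: mb.
  - exact: (M _ r r mve ve0).1.
  - exact: (M _ r r' mve ve0).1.
  - exact: (M _ r r mhe he0).1.
  - by move=> t; exact: integral_ge0.
  - by move=> t; exact: integral_ge0.
  - by move=> t; exact: integral_ge0.
  apply: ae_mono acl2 => t ht tr; apply: IH => //.
  - exact: measurable_slice1.
  - exact: measurable_slice1.
  - by apply: ht; rewrite distrC.
have step2 : (2 * r')%:E * Iv r r' <= (2 * r)%:E * Iv r' r' + ((2 * r) * (2 * r'))%:E * Ih r r'.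
  have c0 : (0 <= (2 * r) * (2 * r'))%R by rewrite !mulr_ge0// ltW.
  have c1 (e : R) : (0 < e)%R -> (0 <= 2 * e)%R by move=> e0; rewrite mulr_ge0// ltW.
  rewrite /Iv /Ih (F _ r r' mve ve0).2 (F _ r' r' mve ve0).2 (F _ r r' mhe he0).2.
  apply: ae_integral_comb; rewrite ?c1//.
  - exact: (M _ r r' mve ve0).2.
  - exact: (M _ r' r' mve ve0).2.
  - exact: (M _ r r' mhe he0).2.
  - by move=> t; exact: integral_ge0.
  - by move=> t; exact: integral_ge0.
  - by move=> t; exact: integral_ge0.
  apply: ae_mono acl1 => y hy yr'; apply: line_average => //.
  - by apply: integral_ge0.
  - exact: measurable_slice2.
  - by apply: hy; exact: cubeS yr'.
have Ihr : Ih r r' <= Ih r r.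
  apply: ge0_subset_integral => //.
  - exact: (@measurableX _ _ (measurableTypeR R) (Rn R k) _ _ (mb r) (mc r')).
  - exact: (@measurableX _ _ (measurableTypeR R) (Rn R k) _ _ (mb r) (mc r)).
  - exact: measurable_funTS.
  - by move=> z [z1 z2]; split => //; exact: cubeS z2.
rewrite !cubeSE -/(Iv r r) -/(Iv r' r') -/(Ih r r).
have p0 (e : R) : (0 < e)%R -> (0 <= 2 * e)%R by move=> e0; rewrite mulr_ge0// ltW.
have s1 := lee_wpmul2l _ step1.
have {}s1 := s1 (2 * r')%:E; rewrite lee_fin p0// in s1; have {}s1 := s1 isT.
have {}step2 := le_trans step2 (leeD (le_refl _) (lee_wpmul2l _ Ihr)).
rewrite lee_fin in step2; have {}step2 := step2 (mulr_ge0 (p0 _ r0) (p0 _ r'0)).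
have s2 := lee_wpmul2l _ step2.
have {}s2 := s2 ((2 * r) ^+ k)%:E; rewrite lee_fin pw// in s2; have {}s2 := s2 isT.
have c0 : (0 <= k%:R * (2 * r) ^+ k * (2 * r'))%R by rewrite !mulr_ge0// ?pw// ltW.
rewrite exprS EFinM -muleA; apply: le_trans s1 _.
rewrite ge0_muleDr ?mule_ge0 ?lee_fin ?pw//.
rewrite muleCA; apply: le_trans (leeD s2 (le_refl _)) _.
rewrite ge0_muleDr ?mule_ge0 ?lee_fin ?p0 ?mulr_ge0 ?p0 ?(ltW r0) ?(ltW r'0)//.
rewrite !muleA -!EFinM -addeA.
rewrite -exprSr.
apply: leeD => //; rewrite -ge0_muleDl ?lee_fin ?mulr_ge0 ?pw ?p0 ?(ltW r0) ?(ltW r'0)//.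
apply: lee_wpmul2r => //; rewrite -EFinD lee_fin.
rewrite -(natr1 k) exprS; set P := ((2 * r) ^+ k)%R.
have P0 : (0 <= P)%R by exact: pw.
(* This is exactly the slack between the claimed coefficient and the sum of the costs of the two
   steps. *)
have : (0 <= k%:R * P * (2 * r') * (2 * r - 2 * r'))%R.
  have d0 : (0 <= 2 * r - 2 * r')%R by rewrite subr_ge0 ler_pM2l.
  exact: mulr_ge0 (mulr_ge0 (mulr_ge0 _ P0) (p0 _ r'0)) d0.
by move=> hP; rewrite -subr_ge0; apply: le_trans hP _; rewrite le_eqVlt; apply/orP; left; apply/eqP; ring.
Qed.

End average.

(** * The modulus of continuity and the pointwise splitting *)

Section reals.
Variable R : realType.

Lemma sqr_le_exp2 j : ((j.+1) ^ 2 <= 4 * 2 ^ j)%N.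
Proof.
elim: j => [//|j IH]; rewrite [in leqRHS]expnS.
case: j IH => [//|[//|[//|j]]] IH.
have : (j.+4 ^ 2 <= 4 * 2 ^ j.+3)%N by [].
move: (2 ^ j.+3)%N => a; rewrite -!mulnn; nia.
Qed.

Lemma ln_expR1D_ge1 (a : R) : 0 <= a -> 1 <= ln (expR 1 + a).
Proof.
move=> a0; rewrite -[leLHS]expRK ler_ln ?posrE ?expR_gt0//; first by rewrite lerDl.
by rewrite ltr_wpDr// expR_gt0.
Qed.

(** Raise the assumption to the fourth power. Since [(2 ^+ k) ^+ 4 <= 2 ^+ j] by [4 * k <= j], and
    [j.+1%:R ^+ 4 <= 16 * (2 ^+ j) ^+ 2] by [sqr_le_exp2], one factor [2 ^+ j] survives and is at
    most [(2 * a / del) ^+ 4]. Taking logarithms bounds [j]. *)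
Lemma ln_lower (del : R) : 0 < del <= 1 -> exists2 C : R, 1 <= C &
  forall (a : R) (j k : nat), 0 <= a -> (4 * k <= j)%N ->
    del * 2 ^+ j / j.+1%:R < 2 ^+ k * a -> j.+1%:R <= C * ln (expR 1 + a).
Proof.
move=> /andP[d0 d1].
have ln2 : 0 < ln (2 : R) by rewrite ln_gt0// ltr1n.
have lnd : 0 <= ln (2 / del) by rewrite ln_ge0// ler_pdivlMr// mul1r (le_trans d1)// ler1n.
exists (1 + 4 / ln 2 * (1 + ln (2 / del))).
  by rewrite lerDl mulr_ge0 ?divr_ge0 ?(ltW ln2)// addr_ge0.
move=> a j k a0 kj h.
set L := ln (expR 1 + a); have L1 : 1 <= L by exact: ln_expR1D_ge1.
have a0' : 0 < a.
  rewrite lt_neqAle a0 andbT; apply/eqP => a00; move: h; rewrite -a00 mulr0 ltNge divr_ge0//.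
  by rewrite mulr_ge0 ?exprn_ge0// ltW.
have h1 : del * 2 ^+ j < 2 ^+ k * a * j.+1%:R by rewrite -ltr_pdivrMr.
have h4 : (del * 2 ^+ j) ^+ 4 <= (2 ^+ k * a * j.+1%:R) ^+ 4.
  by rewrite lerXn2r ?nnegrE ?mulr_ge0 ?exprn_ge0 ?(ltW d0) ?(ltW h1).
have k4 : (2 ^+ k) ^+ 4 <= 2 ^+ j :> R by rewrite -exprM mulnC ler_weXn2l// ler1n.
have j4 : j.+1%:R ^+ 4 <= 16 * (2 ^+ j) ^+ 2 :> R.
  rewrite (_ : 4%N = (2 * 2)%N)// exprM -(_ : 4 ^+ 2 = 16 :> R); last by rewrite -natrX.
  rewrite -exprMn lerXn2r ?nnegrE ?exprn_ge0 ?mulr_ge0 ?exprn_ge0//.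
  by have := sqr_le_exp2 j; rewrite -(ler_nat R) !natrX natrM natrX.
have h5 : 2 ^+ j <= (2 * a / del) ^+ 4.
  rewrite expr_div_n ler_pdivlMr ?exprn_gt0//.
  have p0 : 0 < (2 ^+ j) ^+ 3 :> R by rewrite !exprn_gt0.
  rewrite -(ler_pM2l p0); apply: (le_trans (y := (del * 2 ^+ j) ^+ 4)).
    by rewrite le_eqVlt; apply/orP; left; apply/eqP; ring.
  apply: le_trans h4 _.
  rewrite !exprMn.
  apply: (@le_trans _ _ (2 ^+ j * a ^+ 4 * (16 * (2 ^+ j) ^+ 2))).
    by rewrite ler_pM ?mulr_ge0 ?exprn_ge0// ler_wpM2r ?exprn_ge0.
  by rewrite le_eqVlt; apply/orP; left; apply/eqP; ring.
have h6 : j%:R * ln 2 <= 4 * (L + ln (2 / del)).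
  have : ln (2 ^+ j : R) <= ln ((2 * a / del) ^+ 4).
    by rewrite ler_ln ?posrE ?exprn_gt0// divr_gt0// mulr_gt0.
  rewrite !lnXn ?divr_gt0 ?mulr_gt0// -[leLHS]mulr_natl -[leRHS]mulr_natl => /le_trans; apply.
  rewrite ler_wpM2l//.
  rewrite (_ : 2 * a / del = a * (2 / del)); last by rewrite mulrAC mulrC.
  rewrite lnM ?posrE ?divr_gt0// lerD2r /L ler_ln ?posrE//; first by rewrite lerDr expR_ge0.
  by rewrite ltr_wpDr// expR_gt0.
rewrite -natr1 addrC mulrDl mul1r lerD//.
rewrite -(ler_pM2r ln2) (le_trans h6)//.
rewrite (_ : _ * L * ln 2 = 4 * ((1 + ln (2 / del)) * L)); last by field; rewrite gt_eqF.
have h7 : 0 <= ln (2 / del) * (L - 1) by rewrite mulr_ge0// subr_ge0.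
move: (ln (2 / del)) h7 => l; nra.
Qed.

(* If the first term on the right does not dominate, then for j >= 4k the value of a is
   exponentially large in j, so log (e + a) is comparable to j. *)
Lemma pointwise_split (m : nat) (lam del : R) : (0 < m)%N -> 0 <= lam <= m%:R ->
  0 < del <= 1 -> exists2 M : R, 0 < M &
  forall (a : R) (j k : nat), 0 <= a ->
    2 ^+ k * a * (2 ^+ j) ^+ m <=
    del * (2 ^+ j) ^+ m.+1 * ((j < 4 * k)%N%:R + powR j.+1%:R (- (lam / m%:R)))
    + M * ((2 ^+ k) ^+ m.+1 * (a ^+ m.+1 * powR (ln (expR 1 + a)) lam)).
Proof.
move=> m0 /andP[l0 l1] hdel; have /andP[d0 d1] := hdel.
have [C C1 hC] := ln_lower hdel.
have m0' : 0 < m%:R :> R by rewrite ltr0n.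
have C0 : 0 < C by rewrite (lt_le_trans ltr01).
exists (del ^- m * powR C lam); first by rewrite mulr_gt0 ?powR_gt0// invr_gt0 exprn_gt0.
move=> a j k a0; set p := 2 ^+ k * a; set L := ln _.
have L1 : 1 <= L by exact: ln_expR1D_ge1.
have p0 : 0 <= p by rewrite mulr_ge0// exprn_ge0.
have t0 : 0 < 2 ^+ j :> R by rewrite exprn_gt0.
have Ll : 1 <= powR L lam by rewrite -(powRr0 L) ler_powR.
have Cl : 1 <= powR C lam by rewrite -(powRr0 C) ler_powR.
set q := powR j.+1%:R _.
have q0 : 0 < q by rewrite powR_gt0.
have T0 : 0 <= (2 ^+ k) ^+ m.+1 * (a ^+ m.+1 * powR L lam).
  by rewrite !mulr_ge0 ?exprn_ge0 ?powR_ge0// ltW.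
have pT : (2 ^+ k) ^+ m.+1 * (a ^+ m.+1 * powR L lam) = p ^+ m.+1 * powR L lam.
  by rewrite /p exprMn mulrA.
rewrite pT; have M0 : 0 <= del ^- m by rewrite invr_ge0 exprn_ge0// ltW.
(* The dichotomy is whether [p] exceeds [del * 2 ^+ j * b]. If not, the first term dominates; if so,
   [2 ^+ j] is at most [p / (del * b)], which trades [(2 ^+ j) ^+ m] for powers of [p]. It is used
   with [b = 1] for [j < 4 * k] and with [b = q] otherwise. *)
have low (b : R) : 0 <= b -> p <= del * 2 ^+ j * b ->
    p * (2 ^+ j) ^+ m <= del * (2 ^+ j) ^+ m.+1 * b.
  move=> b0 h; rewrite (_ : del * _ * b = del * 2 ^+ j * b * (2 ^+ j) ^+ m); last by rewrite exprS; ring.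
  by rewrite ler_wpM2r// exprn_ge0// ltW.
have high (b : R) : 0 < b -> del * 2 ^+ j * b < p ->
    p * (2 ^+ j) ^+ m <= p ^+ m.+1 * del ^- m * b ^- m.
  move=> b0 h; have : 2 ^+ j <= p / (del * b).
    by rewrite ler_pdivlMr ?mulr_gt0// mulrA [_ * del]mulrC ltW.
  move=> h'; rewrite (_ : p ^+ m.+1 * _ * _ = p * (p / (del * b)) ^+ m); last first.
    by rewrite expr_div_n [(del * b) ^+ m]exprMn invfM exprS; move: (p) => p'; ring.
  by rewrite ler_wpM2l// lerXn2r ?nnegrE ?(ltW t0)// divr_ge0// mulr_ge0// ltW.
have [jk|kj] := ltnP j (4 * k).
  have [h|h] := leP p (del * 2 ^+ j * 1).
    apply: (@le_trans _ _ (del * (2 ^+ j) ^+ m.+1 * 1)); first exact: low.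
    rewrite -[leLHS]addr0 lerD//.
      by rewrite ler_wpM2l ?lerDl ?(ltW q0)// mulr_ge0 ?exprn_ge0 ?(ltW t0) ?(ltW d0).
    by rewrite !mulr_ge0 ?exprn_ge0 ?powR_ge0.
  apply: le_trans (high 1 ltr01 h) _; rewrite expr1n invr1 mulr1.
  rewrite ler_wpDl//; first by rewrite mulr_ge0 ?addr_ge0 ?(ltW q0)// mulr_ge0 ?exprn_ge0 ?(ltW t0) ?(ltW d0).
  rewrite (_ : _ * _ * _ = p ^+ m.+1 * del ^- m * (powR C lam * powR L lam)); last ring.
  rewrite -[leLHS]mulr1 ler_wpM2l ?mulr_ge0 ?exprn_ge0//.
  by rewrite -[leLHS]mulr1 ler_pM.
rewrite add0r.
have [h|h] := leP p (del * 2 ^+ j * q).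
  by rewrite -[leLHS]addr0 lerD ?low ?(ltW q0)// !mulr_ge0 ?exprn_ge0 ?powR_ge0.
apply: le_trans (high q q0 h) _.
rewrite ler_wpDl//; first by rewrite !mulr_ge0 ?exprn_ge0 ?(ltW q0) ?(ltW t0) ?(ltW d0).
(* The exponent in [q] is chosen so that this is precisely the power of [j.+1] that the logarithmic
   factor can absorb. *)
have qm : q ^- m = powR j.+1%:R lam.
  rewrite /q powRN exprVn invrK -powR_mulrn ?powR_ge0// -powRrM divfK//.
  by rewrite gt_eqF.
(* Here [lam <= m] enters: the weight is no smaller than [j.+1%:R^-1], which supplies the assumption
   of [ln_lower]. *)
have qj : j.+1%:R^-1 <= q.
  rewrite /q powRN lef_pV2 ?posrE ?powR_gt0//.
  rewrite -[leRHS]powRr1//; apply: ler_powR; first by rewrite ler1n.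
  by rewrite ler_pdivrMr// mul1r.
have jL : j.+1%:R <= C * L.
  apply: hC a0 kj _; apply: le_lt_trans h.
  by rewrite ler_wpM2l// mulr_ge0// ltW.
rewrite qm (_ : _ * powR C lam * _ = p ^+ m.+1 * del ^- m * (powR C lam * powR L lam)); last ring.
rewrite ler_wpM2l ?mulr_ge0 ?exprn_ge0// -powRM ?(ltW C0) ?(le_trans ler01 L1)//.
by rewrite ge0_ler_powR ?nnegrE// mulr_ge0 ?(ltW C0)// (le_trans ler01).
Qed.

(** With [A] the right-hand side, apply [ln x <= x - 1] at [y / A] and at [A^-1] with weights [al]
    and [1 - al]; the bounds add up to 0. *)
Lemma powR_le_tangent (y al : R) : 0 <= y -> 0 < al <= 1 -> powR y al <= 1 + al * (y - 1).
Proof.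
move=> y0 /andP[a0 a1].
have [->|yn0] := eqVneq y 0; first by rewrite powR0 ?gt_eqF// sub0r mulrN1 subr_ge0.
have {}y0 : 0 < y by rewrite lt_neqAle eq_sym yn0.
set A := 1 + _; have A0 : 0 < A.
  rewrite (_ : A = al * y + (1 - al)); last by rewrite /A; ring.
  by rewrite ltr_pwDl ?mulr_gt0// subr_ge0.
have lnx (x : R) : 0 < x -> ln x <= x - 1.
  move=> x0; rewrite -[in leLHS](subrK 1 x) addrC le_ln1Dx//.
  by rewrite ltrBrDl subrr.
rewrite -ler_ln ?posrE ?powR_gt0// ln_powR.
have h1 := lnx (y / A) (divr_gt0 y0 A0).
have h2 := lnx A^-1; rewrite invr_gt0 in h2; have {}h2 := h2 A0.
rewrite ln_div ?posrE// in h1; rewrite lnV ?posrE// in h2.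
have h3 : al * (ln y - ln A) + (1 - al) * (- ln A) <= al * (y / A - 1) + (1 - al) * (A^-1 - 1).
  by rewrite lerD// ler_wpM2l ?subr_ge0// ltW.
have h4 : al * (y / A - 1) + (1 - al) * (A^-1 - 1) = 0.
  have -> : al * (y / A - 1) + (1 - al) * (A^-1 - 1) = (1 + al * (y - 1)) / A - 1 by ring.
  by rewrite -/A divff ?subrr ?gt_eqF.
by rewrite h4 in h3; lra.
Qed.

(** The tangent bound at [J%:R / J.+1%:R] says that [al] times the new summand is at most the
    increment of the power from [J] to [J.+1], so the sum telescopes. *)
Lemma sum_powR_le (al : R) J : 0 < al <= 1 ->
  \sum_(0 <= j < J) powR j.+1%:R (al - 1) <= powR J%:R al / al.
Proof.
move=> /andP[a0 a1]; elim: J => [|J IH].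
  by rewrite big_geq// divr_ge0 ?powR_ge0// ltW.
rewrite big_nat_recr//= (le_trans (lerD IH (lexx _)))//.
rewrite -(ler_pM2r a0) mulrDl !divfK ?gt_eqF//.
have J0 : 0 < J.+1%:R :> R by rewrite ltr0n.
have h := @powR_le_tangent (J%:R / J.+1%:R) al; rewrite divr_ge0// a0 a1 in h.
have {}h := h isT isT.
have e1 : powR J%:R al = powR (J%:R / J.+1%:R) al * powR J.+1%:R al.
  by rewrite -powRM ?divr_ge0// divfK// gt_eqF.
have e2 : powR J.+1%:R (al - 1) = powR J.+1%:R al / J.+1%:R.
  by rewrite powRB ?powRr1// (gt_eqF J0) implybT.
rewrite e1 e2; set P := powR J.+1%:R al.
have P0 : 0 <= P by exact: powR_ge0.
have e3 : J%:R / J.+1%:R - 1 = - J.+1%:R^-1 :> R.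
  apply: (mulIf (lt0r_neq0 J0)); rewrite mulrBl divfK ?lt0r_neq0// mulNr mulVf ?lt0r_neq0// mul1r -natr1; ring.
rewrite e3 in h; have := ler_wpM2r P0 h; move: (_.+1%:R^-1) (powR _ al) => y z; lra.
Qed.

Lemma harmonic_le J : \sum_(0 <= j < J.+1) (j.+1%:R : R)^-1 <= 1 + ln J.+1%:R.
Proof.
elim: J => [|J IH]; first by rewrite big_nat1 invr1 ln1 addr0.
rewrite big_nat_recr//= (le_trans (lerD IH (lexx _)))// -addrA lerD2l.
have J0 : 0 < J.+1%:R :> R by rewrite ltr0n.
have J1 : 0 < J.+2%:R :> R by rewrite ltr0n.
have e : J.+1%:R / J.+2%:R - 1 = - J.+2%:R^-1 :> R.
  apply: (mulIf (lt0r_neq0 J1)); rewrite mulrBl divfK ?lt0r_neq0// mulNr mulVf ?lt0r_neq0// mul1r -(natr1 J.+1); ring.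
have := @le_ln1Dx R (J.+1%:R / J.+2%:R - 1); rewrite (addrC 1) subrK e ln_div ?posrE//.
by rewrite ltrN2 invf_lt1// ltr1n => /(_ isT); move: (_^-1) (ln _) (ln _) => y z t; lra.
Qed.

Definition modulus (m : nat) (lam mu rho : R) : R :=
  if 0 < 1 - lam / m%:R then expR (- (mu * powR (ln rho^-1) (1 - lam / m%:R)))
  else powR (ln rho^-1) (- mu).

(** This is where the shape of the modulus matters. Pushing it below [2 ^- K] takes a value of
    [ln rho^-1] of order K^(1/alpha); [J] is of that order, and the sum, of order J^alpha, is linear
    in [K]. For alpha = 0, [J] is exponential in [K] and the sum is harmonic. The factor [2 ^+ c]
    leaves room for comparing norms. *)
Lemma modulus_scale (m c : nat) (lam mu : R) : (0 < m)%N -> 0 <= lam <= m%:R -> 0 < mu ->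
  exists2 C : R, 0 < C & forall K : nat, exists J : nat,
  (forall rho, 0 < rho -> rho <= 2 ^+ c / 2 ^+ J -> modulus m lam mu rho <= 2 ^- K) /\
  \sum_(0 <= j < J) powR j.+1%:R (- (lam / m%:R)) <= C * K.+1%:R.
Proof.
move=> m0 /andP[l0 l1] mu0.
have m0' : 0 < m%:R :> R by rewrite ltr0n.
have ln2 : 0 < ln (2 : R) by rewrite ln_gt0// ltr1n.
have lnrho (t : R) rho : 0 <= t -> 0 < rho ->
    rho <= 2 ^+ c / 2 ^+ (c + (Num.truncn (t / ln 2)).+1) -> t <= ln rho^-1.
  move=> t0 rho0; set N := (Num.truncn _).+1 => h.
  have hN : t / ln 2 < N%:R by rewrite truncnS_gt.
  rewrite (le_trans (y := N%:R * ln 2)) -?ler_pdivrMr ?(ltW hN)//.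
  rewrite lnV ?posrE// lerNr.
  rewrite (_ : - (N%:R * ln 2) = ln (2 ^- N)); last first.
    by rewrite lnV ?posrE ?exprn_gt0// lnXn// mulr_natl.
  rewrite ler_ln ?posrE ?invr_gt0 ?exprn_gt0// (le_trans h)//.
  by rewrite exprD invfM mulrA divff ?mul1r// expf_neq0.
have hJ (t : R) : 0 <= t -> (c + (Num.truncn (t / ln 2)).+1)%:R <= c.+1%:R + t / ln 2.
  move=> t0; by rewrite addnS -addSn natrD lerD2l truncn_le// divr_ge0// (ltW ln2).
rewrite /modulus; set al := 1 - lam / m%:R.
have al1 : al <= 1 by rewrite gerBl divr_ge0// ltW.
have [al0|al0] := ltP 0 al.
  have ealp : - (lam / m%:R) = al - 1 by rewrite /al; ring.
  exists ((powR (2 * c.+1%:R) al + powR (2 / ln 2) al * ln 2 / mu) / al).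
    by rewrite divr_gt0// ltr_pwDl ?powR_gt0 ?mulr_gt0// divr_ge0 ?(ltW mu0)// mulr_ge0 ?powR_ge0 ?(ltW ln2).
  (* [t] solves [mu * powR t al = K%:R * ln 2], so the modulus equals [2 ^- K] at
     [rho = expR (- t)]. *)
  move=> K; pose t := powR (K%:R * ln 2 / mu) al^-1.
  have t0 : 0 <= t by exact: powR_ge0.
  have k0 : 0 <= K%:R * ln 2 / mu by rewrite divr_ge0 ?(ltW mu0)// mulr_ge0 ?(ltW ln2).
  have tal : powR t al = K%:R * ln 2 / mu by rewrite /t -powRrM mulVf ?gt_eqF// powRr1.
  exists (c + (Num.truncn (t / ln 2)).+1)%N; split.
    move=> rho rho0 h; have h1 := lnrho t rho t0 rho0 h.
    have -> : 2 ^- K = expR (- (K%:R * ln 2)) :> R.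
      by rewrite expRN -[2 ^- K]lnK ?posrE ?invr_gt0 ?exprn_gt0// lnV ?posrE ?exprn_gt0// lnXn// expRN mulr_natl.
    rewrite ler_expR lerN2 -(divfK (_ : mu != 0) (K%:R * ln 2)) ?gt_eqF// mulrC ler_pM2l// -tal.
    by apply: ge0_ler_powR; rewrite ?(ltW al0) ?nnegrE// (le_trans t0).
  rewrite ealp; set J := (c + _)%N.
  apply: le_trans (sum_powR_le J _) _; first by rewrite al0.
  rewrite mulrAC ler_wpM2r ?invr_ge0 ?(ltW al0)//.
  apply: (@le_trans _ _ (powR (2 * c.+1%:R) al + powR (2 * (t / ln 2)) al)).
    have [h|h] := leP (c.+1%:R) (t / ln 2).
      rewrite ler_wpDl ?powR_ge0//; apply: ge0_ler_powR; rewrite ?(ltW al0) ?nnegrE ?mulr_ge0 ?invr_ge0 ?(ltW ln2)//.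
      by rewrite (le_trans (hJ t t0))// mulr2n mulrDl mul1r lerD2r.
    rewrite ler_wpDr ?powR_ge0//; apply: ge0_ler_powR; rewrite ?(ltW al0) ?nnegrE ?mulr_ge0//.
    by rewrite (le_trans (hJ t t0))// mulr2n mulrDl mul1r lerD2l ltW.
  rewrite (mulrC t) mulrA.
  rewrite [powR (_ * t) _]powRM ?divr_ge0 ?(ltW ln2)// tal [leRHS]mulrDl lerD//.
    by rewrite ler_peMr ?powR_ge0// ler1n.
  rewrite (_ : powR (2 / ln 2) al * (K%:R * ln 2 / mu) = powR (2 / ln 2) al * ln 2 / mu * K%:R); last by field; rewrite gt_eqF.
  by rewrite ler_wpM2l ?ler_nat// divr_ge0 ?(ltW mu0)// mulr_ge0 ?powR_ge0 ?(ltW ln2).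
have lm : lam / m%:R = 1.
  apply/eqP; rewrite eq_le ler_pdivrMr// mul1r l1/=.
  by move: al0; rewrite subr_le0.
set c1 : R := c.+1%:R + (ln 2)^-1.
have c11 : 1 <= c1 by rewrite ler_wpDr ?invr_ge0 ?(ltW ln2)// ler1n.
have c10 : 0 < c1 by rewrite (lt_le_trans ltr01).
exists (1 + ln c1 + ln 2 / mu).
  by rewrite ltr_wpDr ?divr_ge0 ?(ltW ln2) ?(ltW mu0)// ltr_wpDr// ln_ge0.
move=> K; pose t := expR (K%:R * ln 2 / mu).
have t1 : 1 <= t by rewrite -[leLHS]expR0 ler_expR divr_ge0 ?(ltW mu0)// mulr_ge0 ?(ltW ln2).
have t0 : 0 < t by rewrite (lt_le_trans ltr01).
exists (c + (Num.truncn (t / ln 2)).+1)%N; split.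
  move=> rho rho0 h; have h1 := lnrho t rho (ltW t0) rho0 h.
  rewrite powRN lef_pV2 ?posrE ?exprn_gt0 ?powR_gt0//; last exact: lt_le_trans h1.
  have -> : 2 ^+ K = powR t mu :> R.
    by rewrite /t -expRM divfK ?gt_eqF// mulr_natl -lnXn// lnK// posrE exprn_gt0.
  by apply: ge0_ler_powR; rewrite ?(ltW mu0) ?nnegrE ?(ltW t0)// (le_trans (ltW t0)).
rewrite lm addnS; under eq_bigr do rewrite powR_inv1//.
apply: le_trans (harmonic_le _) _.
rewrite -addnS.
have hJ' : (c + (Num.truncn (t / ln 2)).+1)%:R <= c1 * t.
  apply: le_trans (hJ t (ltW t0)) _; rewrite /c1 mulrDl lerD//.
    by rewrite ler_peMr.
  by rewrite mulrC.
rewrite (le_trans (y := 1 + ln (c1 * t)))//.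
  by rewrite lerD2l ler_ln ?posrE ?mulr_gt0// ltr0n addnS.
rewrite lnM ?posrE// expRK addrA.
have K1 : 1 <= K.+1%:R :> R by rewrite ler1n.
rewrite mulrDl lerD//; first by rewrite ler_peMr// addr_ge0// ln_ge0.
rewrite -mulrA mulrC ler_wpM2l ?divr_ge0 ?(ltW ln2) ?(ltW mu0)//.
by rewrite ler_nat.
Qed.

Lemma geometric_le m i j : (0 < m)%N ->
  \sum_(i <= l < j.+1) (2 ^+ l) ^+ m <= 2 * (2 ^+ j) ^+ m :> R.
Proof.
move=> m0; elim: j => [|j IH].
  case: i => [|i]; first by rewrite big_nat1 expr0 expr1n mulr1 ler1n.
  by rewrite big_geq// mulr_ge0// !exprn_ge0.
have [ij|ij] := leqP i j.+1; last by rewrite big_geq// mulr_ge0// !exprn_ge0.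
rewrite big_nat_recr//= mulr2n mulrDl !mul1r lerD2r (le_trans IH)//.
rewrite exprS exprMn ler_wpM2r ?exprn_ge0//.
by case: m m0 {IH} => // m _; rewrite -[1 + 1]/(2%:R) exprS ler_peMr// exprn_ege1// ler1n.
Qed.

(** Applying the hypothesis term by term would count [N] once per scale. Only the last scale with
    [Q] true is used: the geometric sum up to it is at most twice its last term, so [N] enters
    once. *)
Lemma nested_sum_le (m : nat) (p N : R) (Q : nat -> bool) (D : nat -> R) i j :
  (0 < m)%N -> 0 <= p -> 0 <= N -> (forall l, 0 <= D l) ->
  (forall l, p * (2 ^+ l) ^+ m <= D l + N) ->
  \sum_(i <= l < j) (2 ^+ l) ^+ m * (Q l)%:R * p <=
    2 * (\sum_(i <= l < j) D l * (Q l)%:R) + 2 * N.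
Proof.
move=> m0 p0 N0 D0 h; elim: j => [|j IH].
  by rewrite !big_geq// mulr0 add0r mulr_ge0.
have [ij|ij] := leqP i j; last by rewrite !big_geq// mulr0 add0r mulr_ge0.
have sD : 0 <= \sum_(i <= l < j) D l * (Q l)%:R.
  by apply: sumr_ge0 => l _; rewrite mulr_ge0.
case Qj : (Q j); last first.
  by rewrite !big_nat_recr//= Qj !(mulr0, mul0r, addr0).
rewrite [in leRHS]big_nat_recr//= Qj mulr1 -mulrDr.
apply: (@le_trans _ _ (\sum_(i <= l < j.+1) (2 ^+ l) ^+ m * p)).
  by apply: ler_sum => l _; rewrite ler_wpM2r// ler_piMr ?exprn_ge0// lern1 leq_b1.
rewrite -mulr_suml (le_trans (ler_wpM2r p0 (geometric_le _ _ m0)))//.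
rewrite -mulrA ler_wpM2l// mulrC (le_trans (h j))// -addrA ler_wpDl//.
Qed.

(** At a given point at most one [S k] is true. The scale term, made independent of [k] by enlarging
    [j < 4 * k] to [j < 4 * K], is thus paid once in total, and each [k] pays only its own energy
    term. *)
Lemma double_sum_le (m : nat) (lam del M a : R) (Q S : nat -> bool) j0 J k0 K :
  (0 < m)%N -> 0 <= a -> 0 < del -> 0 < M ->
  (forall (j k : nat),
    2 ^+ k * a * (2 ^+ j) ^+ m <=
    del * (2 ^+ j) ^+ m.+1 * ((j < 4 * k)%N%:R + powR j.+1%:R (- (lam / m%:R)))
    + M * ((2 ^+ k) ^+ m.+1 * (a ^+ m.+1 * powR (ln (expR 1 + a)) lam))) ->
  (\sum_(k0 <= k < K) (S k)%:R <= 1 :> R) ->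
  \sum_(k0 <= k < K) \sum_(j0 <= j < J) (2 ^+ j) ^+ m * (Q j)%:R * (2 ^+ k * a * (S k)%:R) <=
  2 * \sum_(j0 <= j < J) del * (2 ^+ j) ^+ m.+1 * ((j < 4 * K)%N%:R + powR j.+1%:R (- (lam / m%:R))) * (Q j)%:R
  + 2 * \sum_(k0 <= k < K) M * ((2 ^+ k) ^+ m.+1 * (a ^+ m.+1 * powR (ln (expR 1 + a)) lam)) * (S k)%:R.
Proof.
move=> m0 a0 d0 M0 h hS; set X := \sum_(j0 <= j < J) del * _ * _ * _.
pose D j := del * (2 ^+ j) ^+ m.+1 * ((j < 4 * K)%N%:R + powR j.+1%:R (- (lam / m%:R))).
have D0 j : 0 <= D j by rewrite !mulr_ge0 ?addr_ge0 ?powR_ge0 ?exprn_ge0// ltW.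
have X0 : 0 <= X by apply: sumr_ge0 => j _; rewrite mulr_ge0// D0.
pose N k := M * ((2 ^+ k) ^+ m.+1 * (a ^+ m.+1 * powR (ln (expR 1 + a)) lam)).
have N0 k : 0 <= N k by rewrite !mulr_ge0 ?powR_ge0 ?exprn_ge0// ltW.
apply: (@le_trans _ _ (\sum_(k0 <= k < K) (2 * X * (S k)%:R + 2 * (N k * (S k)%:R)))); last first.
  rewrite big_split/= -!mulr_sumr lerD2r -[leRHS]mulr1 ler_wpM2l// mulr_ge0//.
rewrite big_nat_cond [leRHS]big_nat_cond; apply: ler_sum => k; rewrite andbT => /andP[_ kK].
case: (S k); last by rewrite !mulr0 addr0 big1// => j _; rewrite !mulr0.
rewrite (_ : true%:R = 1 :> R)// !mulr1.
apply: (@nested_sum_le m _ (N k) Q D) => // [|l].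
  by rewrite mulr_ge0// exprn_ge0.
rewrite (le_trans (h l k))// lerD2r ler_wpM2l ?mulr_ge0 ?exprn_ge0 ?(ltW d0)//.
rewrite lerD2r ler_nat; case: ltnP => //= lk.
by rewrite (leq_trans lk)// leq_mul2l ltnW.
Qed.

End reals.

(** * Mass of preimages of balls *)

Section masks.
Context d (T : measurableType d) (R : realType) (mu : {measure set T -> \bar R}).

Lemma integral_indic_factor (A B : set T) (f : T -> R) : B `<=` A ->
  (\int[mu]_(z in A) (f z * \1_B z)%:E = \int[mu]_(z in B) (f z)%:E)%E.
Proof.
move=> /setIidPr BA; rewrite -{2}BA integral_mkcondr; apply: eq_integral => z _.
by rewrite /patch indicE; case: ifPn; rewrite ?mulr1 ?mulr0.
Qed.

Lemma integral_sum_nat (A : set T) (F : nat -> T -> R) i j :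
  measurable A -> (forall a, measurable_fun setT (F a)) -> (forall a z, 0 <= F a z) ->
  (\int[mu]_(z in A) (\sum_(i <= a < j) F a z)%R%:E =
   \sum_(i <= a < j) \int[mu]_(z in A) (F a z)%:E)%E.
Proof.
move=> mA mF F0; under eq_integral do rewrite -sumEFin.
rewrite ge0_integral_sum//; last by move=> a z _; rewrite lee_fin.
by move=> a; apply: measurable_funTS; apply/measurable_EFinP.
Qed.

Lemma integral_scale_indic (A B : set T) (f : T -> R) (c : R) :
  measurable A -> measurable B -> measurable_fun setT f -> (forall z, 0 <= f z) -> 0 <= c ->
  B `<=` A ->
  (\int[mu]_(z in A) (c * \1_B z * f z)%:E = c%:E * \int[mu]_(z in B) (f z)%:E)%E.
Proof.
move=> mA mB mf f0 c0 BA; rewrite -(integral_indic_factor _ BA) -ge0_integralZl_EFin//.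
- by apply: eq_integral => z _; rewrite -EFinM mulrAC mulrA.
- by move=> z _; rewrite lee_fin mulr_ge0.
- apply: measurable_funTS; apply/measurable_EFinP; apply: measurable_funM => //.
Qed.

End masks.

(** * Telescoping over scales, summing over strips *)

Section chain.
Variables (R : realType) (m : nat).
Implicit Types (x : Rn R m.+1) (v h D H : Rn R m.+1 -> R).
Let mu := lebn R m.+1.

Lemma exp2N j : 2 * 2 ^- j.+1 = 2 ^- j :> R.
Proof. by rewrite exprS invfM mulrA divff// mul1r. Qed.

Lemma exp2D j : 2 ^- j.+1 + 2 ^- j.+1 = 2 ^- j :> R.
Proof. by rewrite -[RHS]exp2N mulr_natl mulr2n. Qed.

Lemma telescope_le (a b : nat -> \bar R) (C : R) i j : (i <= j)%N -> 0 <= C ->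
  (forall l, 0 <= b l)%E -> (forall l, (i <= l)%N -> a l <= a l.+1 + C%:E * b l)%E ->
  (a i <= a j + C%:E * \sum_(i <= l < j) b l)%E.
Proof.
move=> + C0 b0 h; elim: j => [|j IH].
  by rewrite leqn0 => /eqP ->; rewrite big_geq// mule0 adde0.
rewrite leq_eqVlt => /orP[/eqP <-|]; first by rewrite big_geq// mule0 adde0.
rewrite ltnS => ij; apply: le_trans (IH ij) _.
rewrite big_nat_recr// ge0_muleDr ?sume_ge0//.
by rewrite [leRHS]addeA [leRHS]addeAC leeD2r// h.
Qed.

(** With [t = 2 ^+ J] the premise is [average_le] for the radii [t^-1] and half of it; multiplying
    by [t ^+ m.+1] twice gives a form that telescopes, and explains the constant
    [m.+1%:R * 2 ^+ m.+1]. *)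
Lemma rescale_step (t : R) (a a' b : \bar R) : 0 < t -> (0 <= a')%E -> (0 <= b)%E ->
  ((t^-1 ^+ m.+1)%:E * a <=
    ((2 / t) ^+ m.+1)%:E * a' + (m.+1%:R * (2 / t) ^+ m.+1 / t)%:E * b)%E ->
  ((t ^+ m.+1)%:E * a <=
    ((2 * t) ^+ m.+1)%:E * a' + (m.+1%:R * 2 ^+ m.+1)%:E * ((t ^+ m)%:E * b))%E.
Proof.
move=> t0 a0 b0.
have q0 : (0 <= (t ^+ m.+1 * t ^+ m.+1)%:E :> \bar R)%E.
  by rewrite lee_fin mulr_ge0 ?exprn_ge0// ltW.
have tV : t * t^-1 = 1 by rewrite divff// gt_eqF.
have tm : t ^+ m.+1 * t^-1 ^+ m.+1 = 1 by rewrite -exprMn tV expr1n.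
move=> /(lee_wpmul2l q0); rewrite ge0_muleDr ?mule_ge0 ?lee_fin ?mulr_ge0 ?exprn_ge0 ?divr_ge0 ?invr_ge0 ?(ltW t0)//.
rewrite !muleA -!EFinM => h2; apply: le_trans (le_trans h2 _).
  by rewrite -mulrA tm mulr1.
rewrite le_eqVlt; apply/orP; left; apply/eqP; congr (_%:E * _ + _%:E * _)%E.
  by rewrite -mulrA -exprMn (mulrCA t 2) tV mulr1 -exprMn mulrC.
rewrite exprMn (_ : t ^+ m = t ^+ m.+1 * t^-1); last by rewrite exprSr -mulrA tV mulr1.
rewrite -[RHS]mulr1 -tm; ring.
Qed.

Lemma average_chain x v h j0 J : (j0 <= J)%N ->
  measurable_fun setT v -> (forall z, 0 <= v z) ->
  measurable_fun setT h -> (forall z, 0 <= h z) ->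
  (forall j, (j0 <= j)%N -> acl x (2 ^- j) v h) ->
  (((2 ^+ j0) ^+ m.+1)%:E * \int[mu]_(z in cube x (2 ^- j0)) (v z)%:E <=
   ((2 ^+ J) ^+ m.+1)%:E * \int[mu]_(z in cube x (2 ^- J)) (v z)%:E +
   (m.+1%:R * 2 ^+ m.+1)%:E *
     \sum_(j0 <= j < J) ((2 ^+ j) ^+ m)%:E * \int[mu]_(z in cube x (2 ^- j)) (h z)%:E)%E.
Proof.
move=> j0J mv v0 mh h0 hacl.
apply: (@telescope_le (fun j => ((2 ^+ j) ^+ m.+1)%:E * \int[mu]_(z in cube x (2 ^- j)) (v z)%:E)%E
  (fun j => ((2 ^+ j) ^+ m)%:E * \int[mu]_(z in cube x (2 ^- j)) (h z)%:E)%E) => // [j|{j0J}J jJ].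
- by rewrite mule_ge0 ?lee_fin ?exprn_ge0// integral_ge0// => z _; rewrite lee_fin.
have p0 : (0 : R) < 2 ^- J.+1 by rewrite invr_gt0 exprn_gt0.
have pS : 2 ^- J.+1 <= 2 ^- J :> R by rewrite lef_pV2 ?posrE ?exprn_gt0// ler_weXn2l// ler1n.
have := average_le p0 pS mv v0 mh h0 (hacl _ jJ).
rewrite exp2N; set a := integral _ _ _; set a' := integral _ _ _; set b := integral _ _ _ => h1.
have a0 : (0 <= a')%E by apply: integral_ge0 => z _; rewrite lee_fin.
have b0 : (0 <= b)%E by apply: integral_ge0 => z _; rewrite lee_fin.
by rewrite (exprS (2 : R) J); apply: rescale_step => //; rewrite exprn_gt0.
Qed.

(** The cube has [2 ^+ m.+1] times the measure allowed for the low set, so the truncation equals 1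
    on a set of measure at least [(2 ^- j0) ^+ m.+1]. *)
Lemma level_lower x D j0 (s : R) : 0 < s -> measurable_fun setT D ->
  (mu (cube x (2 ^- j0) `&` [set z | (D z < s + s)%R]) <= ((2 ^- j0) ^+ m.+1)%:E)%E ->
  (1 <= ((2 ^+ j0) ^+ m.+1)%:E * \int[mu]_(z in cube x (2 ^- j0)) (trunc s (D z))%:E)%E.
Proof.
move=> s0 mD hmu; set Q := cube x (2 ^- j0).
have mQ : measurable Q by exact: measurable_cube.
pose A := Q `&` [set z | (s + s <= D z)%R].
have mA : measurable A.
  apply: measurableI => //; rewrite [X in measurable X](_ : _ = D @^-1` `[s + s, +oo[).
    by rewrite -[X in measurable X]setTI; apply: mD => //.
  by apply/seteqP; split => z /=; rewrite in_itv/= andbT.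
pose B := Q `&` [set z | (D z < s + s)%R].
have mB : measurable B.
  apply: measurableI => //; rewrite [X in measurable X](_ : _ = D @^-1` `]-oo, (s + s)[).
    by rewrite -[X in measurable X]setTI; apply: mD => //.
  by apply/seteqP; split => z /=; rewrite in_itv.
have tr0 z : 0 <= trunc s (D z) by have /andP[] := trunc01 s (D z).
have mtr : measurable_fun setT (fun z => trunc s (D z)).
  rewrite /trunc; apply: measurable_minr => //; apply: measurable_maxr => //.
  by apply: measurable_funB => //; apply: measurable_funM.
have p0 : 0 < (2 ^+ j0) ^+ m.+1 :> R by rewrite !exprn_gt0.
have muQ : mu Q = ((2 * 2 ^- j0) ^+ m.+1)%:E by rewrite lebn_cube// invr_ge0 exprn_ge0.
have hQ : mu Q = (mu A + mu B)%E.
  rewrite -measureU//.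
    by rewrite -setIUr; congr (mu _); apply/seteqP; split => [z Qz|z []//]; split => //; case: (leP (s + s) (D z)) => h; [left|right].
  by apply/seteqP; split => z // [[_ /= h1] [_ /= h2]]; move: h1; rewrite leNgt h2.
have hA : (((2 ^- j0) ^+ m.+1)%:E <= mu A)%E.
  have fB : mu B \is a fin_num.
    by rewrite ge0_fin_numE// (le_lt_trans hmu)// ltry.
  rewrite -(leeD2rE _ _ fB) -hQ muQ; apply: le_trans (leeD2l _ hmu) _.
  rewrite -EFinD lee_fin exprMn -mulr2n -[leLHS]mulr_natl ler_wpM2r//.
    by rewrite exprS ler_peMr// exprn_ege1// ler1n.
have hI : (mu A <= \int[mu]_(z in Q) (trunc s (D z))%:E)%E.
  rewrite -[mu A]mul1e -integral_cst//.
  apply: (@le_trans _ _ (\int[mu]_(z in A) (trunc s (D z))%:E)%E).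
    apply: ge0_le_integral => //.
    - by apply: measurable_funTS; apply/measurable_EFinP.
    - move=> z [_ /= h]; rewrite lee_fin /trunc le_min lexx/= le_max lerBrDr.
      by rewrite ler_pdivlMr// mulrDl mul1r h orbT.
  apply: ge0_subset_integral => //.
  - by apply: measurable_funTS; apply/measurable_EFinP.
  - by move=> z _; rewrite lee_fin.
  - exact: subIsetl.
have := lee_wpmul2l (_ : (0 <= ((2 ^+ j0) ^+ m.+1)%:E)%E) (le_trans hA hI).
rewrite lee_fin (ltW p0) => /(_ isT); apply: le_trans.
by rewrite -EFinM -exprMn divff ?expr1n// expf_neq0.
Qed.

(** The constants appear in the order of their dependence: [del] small against [C], then [M] from
    the splitting for this [del], then [c] small against [M]. The last clause is the final balance
    for a window of [k] strips: the scales cost at most one half of [k], the energy one quarter. *)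
Lemma level_budget (lam C : R) : (0 < m)%N -> 0 <= lam <= m%:R -> 0 < C ->
  exists (del M c : R), [/\ 0 < del <= 1, 0 < M, 0 < c <= 1,
    forall (a : R) (j k : nat), 0 <= a ->
    2 ^+ k * a * (2 ^+ j) ^+ m <=
    del * (2 ^+ j) ^+ m.+1 * ((j < 4 * k)%N%:R + powR j.+1%:R (- (lam / m%:R)))
    + M * ((2 ^+ k) ^+ m.+1 * (a ^+ m.+1 * powR (ln (expR 1 + a)) lam)) &
    forall k, (0 < k)%N ->
      m.+1%:R * 2 ^+ m.+1 * (2 * (del * 2 ^+ m.+1 * ((4 * (2 * k))%:R + C * (2 * k).+1%:R))
        + 2 * (M * c * 2 ^+ m.+1 * k%:R)) < k%:R].
Proof.
move=> m0 hl C0; pose B : R := m.+1%:R * 2 ^+ m.+1 * 2 * 2 ^+ m.+1.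
have B1 : 1 <= B.
  by rewrite /B -!natrX -!natrM ler1n !muln_gt0/= !expn_gt0.
have B0 : 0 < B by rewrite (lt_le_trans ltr01).
(* [B] collects the dimensional factors. Taking [del = e^-1] turns the enlarged scale cost into
   exactly [k%:R / 2], and [g] below plays the same role for the energy. *)
pose e := 4 * B * (4 + 2 * C).
have e1 : 1 <= e by rewrite /e; nra.
have e0 : 0 < e by rewrite (lt_le_trans ltr01).
have hdel : 0 < e^-1 <= 1 by rewrite invr_gt0 e0 invf_le1.
have [M M0 hM] := pointwise_split m0 hl hdel.
pose g := 1 + 4 * B * M.
have BM0 : 0 < B * M by rewrite mulr_gt0.
have g0 : 0 < g by rewrite /g; nra.
exists e^-1, M, g^-1; split => //.
  by rewrite invr_gt0 g0 invf_le1// /g -mulrA lerDl mulr_ge0// ltW.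
move=> k k0; have k1 : 1 <= k%:R :> R by rewrite ler1n.
have h1 : (4 * (2 * k))%:R + C * (2 * k).+1%:R <= (4 + 2 * C) * (2 * k%:R) :> R.
  by rewrite -[in (2 * k).+1%:R]natr1 !natrM; nra.
have h2 : B * e^-1 * ((4 + 2 * C) * (2 * k%:R)) = k%:R / 2.
  by rewrite /e; field; rewrite !gt_eqF//; nra.
have h3 : B * M * g^-1 <= 4^-1.
  by rewrite ler_pdivrMr// /g; lra.
apply: (@le_lt_trans _ _ (B * e^-1 * ((4 + 2 * C) * (2 * k%:R)) + B * M * g^-1 * k%:R)).
  have -> (X : R) : m.+1%:R * 2 ^+ m.+1 * (2 * (e^-1 * 2 ^+ m.+1 * X) + 2 * (M * g^-1 * 2 ^+ m.+1 * k%:R))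
     = B * e^-1 * X + B * M * g^-1 * k%:R by rewrite /B; ring.
  by rewrite lerD2r ler_wpM2l// mulr_ge0// ?invr_ge0 ltW.
rewrite h2; have : B * M * g^-1 * k%:R <= 4^-1 * k%:R by rewrite ler_wpM2r.
lra.
Qed.

Definition level x D j0 k := cube x (2 ^- j0) `&` [set z | (D z < 2 ^- k)%R].

Definition energy lam H z := H z ^+ m.+1 * powR (ln (expR 1 + H z)) lam.

Lemma energy_ge0 lam H z : (0 <= H z) -> 0 <= energy lam H z.
Proof. by move=> H0; rewrite mulr_ge0 ?exprn_ge0 ?powR_ge0. Qed.

Lemma measurable_energy lam H : measurable_fun setT H -> measurable_fun setT (energy lam H).
Proof.
move=> mH; apply: measurable_funM; first exact: measurable_funX.
apply: (measurableT_comp (measurable_powR lam)).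
by apply: measurableT_comp => //; apply: measurable_funD.
Qed.

Lemma measurable_strip D (a b : R) : measurable_fun setT D ->
  measurable [set z | (a < D z < b)%R].
Proof.
move=> mD; rewrite [X in measurable X](_ : _ = D @^-1` `]a, b[).
  by rewrite -[X in measurable X]setTI; apply: mD.
by apply/seteqP; split => z /=; rewrite in_itv.
Qed.

Lemma measurable_level x D j0 k : measurable_fun setT D -> measurable (level x D j0 k).
Proof.
move=> mD; apply: measurableI; first exact: measurable_cube.
rewrite [X in measurable X](_ : _ = D @^-1` `]-oo, (2 ^- k)[).
  by rewrite -[X in measurable X]setTI; apply: mD.
by apply/seteqP; split => z /=; rewrite in_itv.
Qed.

(** Consecutive strips have only one level in common and both inequalities are strict, so the strips
    are disjoint. *)
Lemma strip_unique (a : R) i j : \sum_(i <= k < j) (2 ^- k < a < 2 ^- k + 2 ^- k)%R%:R <= 1 :> R.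
Proof.
elim: j => [|j IH]; first by rewrite big_geq.
have [ij|ij] := leqP i j; last by rewrite big_geq.
rewrite big_nat_recr//; case: (boolP (2 ^- j < a < _)) => [/andP[_ h1]|_]; last by rewrite /= addr0.
rewrite /= big_nat_cond big1 ?add0r// => k; rewrite andbT => /andP[_ kj].
case: (boolP (_ < a < _)) => // /andP[h2 _]; move: (lt_trans h2 h1).
case: j kj {IH h1 ij} => // j kj; rewrite exp2D ltNge.
by rewrite lef_pV2 ?posrE ?exprn_gt0// ler_weXn2l// ler1n.
Qed.

(** The summand 1 in the density gives the bound on the measure, the energy gives the other one. The
    strip of index [k.+1] ends at the level [2 ^- k], hence lies in the level set of index [k];
    changing the index costs [2 ^+ m.+1]. *)
Lemma level_strip x D j0 k (c : R) H lam : (forall z, 0 <= H z) ->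
  measurable_fun setT H -> measurable_fun setT D ->
  (\int[mu]_(z in level x D j0 k) (energy lam H z + 1)%:E < (c * (2 ^- k) ^+ m.+1)%:E)%E ->
  (mu (level x D j0 k) <= (c * (2 ^- k) ^+ m.+1)%:E)%E /\
  (\int[mu]_(z in cube x (2 ^- j0) `&` [set z | (2 ^- k.+1 < D z < 2 ^- k.+1 + 2 ^- k.+1)%R])
    (energy lam H z)%:E <= (c * 2 ^+ m.+1 * (2 ^- k.+1) ^+ m.+1)%:E)%E.
Proof.
move=> H0 mH mD h; have mL := measurable_level x j0 k mD.
have mE := measurable_energy lam mH.
have mE1 : measurable_fun (level x D j0 k) (fun z => (energy lam H z + 1)%:E).
  by apply: measurable_funTS; apply/measurable_EFinP; apply: measurable_funD.
split.
  apply: le_trans (ltW h); rewrite -[leLHS]mul1e -integral_cst//; apply: ge0_le_integral => //.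
  by move=> z _; rewrite lee_fin lerDr energy_ge0.
rewrite -mulrA -exprMn exp2N; apply: le_trans (ltW h).
apply: (@le_trans _ _ (\int[mu]_(z in level x D j0 k) (energy lam H z)%:E)%E).
  apply: ge0_subset_integral => //.
  - by apply: measurableI; [exact: measurable_cube|exact: measurable_strip].
  - by apply: measurable_funTS; apply/measurable_EFinP.
  - by move=> z _; rewrite lee_fin energy_ge0.
  - move=> z [Qz /= /andP[_ h2]]; split => //=.
    by rewrite -exp2N mulr_natl mulr2n.
apply: ge0_le_integral => //.
- by move=> z _; rewrite lee_fin energy_ge0.
- by apply: measurable_funTS; apply/measurable_EFinP.
- by move=> z _; rewrite lee_fin lerDl.
Qed.

(** On the smallest cube the truncation vanishes, so only gradient terms remain after telescoping.
    They are all written over the largest cube, with indicators, so that they can later be added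
    under one integral. *)
Lemma strip_chain x D H j0 J (s : R) : (j0 <= J)%N -> (forall z, 0 <= H z) ->
  measurable_fun setT H -> measurable_fun setT D -> 0 < s ->
  (forall j, (j0 <= j)%N ->
    acl x (2 ^- j) (fun z => trunc s (D z))
     (fun z => s^-1 * H z * \1_[set z | (s < D z < s + s)%R] z)) ->
  (mu (cube x (2 ^- j0) `&` [set z | (D z < s + s)%R]) <= ((2 ^- j0) ^+ m.+1)%:E)%E ->
  (forall z, cube x (2 ^- J) z -> D z <= s) ->
  (1 <= (m.+1%:R * 2 ^+ m.+1)%:E * \sum_(j0 <= j < J)
   \int[mu]_(z in cube x (2 ^- j0))
    ((2 ^+ j) ^+ m * \1_(cube x (2 ^- j)) z *
      (s^-1 * H z * \1_[set z | (s < D z < s + s)%R] z))%:E)%E.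
Proof.
move=> jJ H0 mH mD s0 hacl hmu hJ.
have mtr : measurable_fun setT (fun z => trunc s (D z)).
  rewrite /trunc; apply: measurable_minr => //; apply: measurable_maxr => //.
  by apply: measurable_funB => //; apply: measurable_funM.
have tr0 z : 0 <= trunc s (D z) by have /andP[] := trunc01 s (D z).
have mh : measurable_fun setT (fun z => s^-1 * H z * \1_[set z | (s < D z < s + s)%R] z).
  apply: measurable_funM; first exact: measurable_funM.
  by apply: measurable_indic; exact: measurable_strip.
have h0 z : 0 <= s^-1 * H z * \1_[set z | (s < D z < s + s)%R] z.
  by rewrite !mulr_ge0 ?invr_ge0// ltW.
have := le_trans (level_lower s0 mD hmu) (average_chain jJ mtr tr0 mh h0 hacl).
rewrite [X in (_ * X + _)%E](_ : _ = 0%E) ?mule0 ?add0e.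
  move=> /le_trans; apply; apply: lee_wpmul2l; first by rewrite lee_fin mulr_ge0 ?exprn_ge0.
  rewrite le_eqVlt; apply/orP; left; apply/eqP; rewrite big_nat_cond [RHS]big_nat_cond.
  apply: eq_bigr => j; rewrite andbT => /andP[j0j _].
  symmetry; apply: integral_scale_indic => //; try exact: measurable_cube; try by rewrite exprn_ge0// exprn_ge0.
  by apply: cubeS; rewrite lef_pV2 ?posrE ?exprn_gt0// ler_weXn2l// ler1n.
apply: integral0_eq => z /hJ Ds; congr (_%:E); rewrite /trunc.
by rewrite max_l ?min_r// subr_le0 ler_pdivrMr// mul1r.
Qed.

(** If all levels from [k0] on had small mass, [strip_chain] would apply to each strip of the
    window; adding these inequalities and using [double_sum_le] under the integral contradicts the
    balance of [level_budget]. *)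
Lemma level_mass (lam C : R) : (0 < m)%N -> 0 <= lam <= m%:R -> 0 < C ->
  exists2 c : R, 0 < c & forall x D H j0 k0,
  (forall z, 0 <= H z) -> measurable_fun setT H -> measurable_fun setT D ->
  (forall j s, (j0 <= j)%N -> 0 < s ->
    acl x (2 ^- j) (fun z => trunc s (D z))
     (fun z => s^-1 * H z * \1_[set z | (s < D z < s + s)%R] z)) ->
  (forall K : nat, exists J : nat,
    (forall z, cube x (2 ^- J) z -> cube x (2 ^- j0) z -> D z <= 2 ^- K) /\
    \sum_(0 <= j < J) powR j.+1%:R (- (lam / m%:R)) <= C * K.+1%:R) ->
  exists2 k, (k0 <= k)%N &
    ((c * (2 ^- k) ^+ m.+1)%:E <= \int[mu]_(z in level x D j0 k) (energy lam H z + 1)%:E)%E.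
Proof.
move=> m0 hl C0; have [del [M [c [hdel M0 /andP[c0 c1] hsplit hbud]]]] := level_budget m0 hl C0.
have /andP[d0 d1] := hdel.
exists c => // x D H j0 k0 H0 mH mD hacl hmod; apply: contrapT => hno.
have hlow k : (k0 <= k)%N ->
    (\int[mu]_(z in level x D j0 k) (energy lam H z + 1)%:E < (c * (2 ^- k) ^+ m.+1)%:E)%E.
  by move=> kk; rewrite ltNge; apply/negP => h; apply: hno; exists k.
(* Being beyond [j0] makes the low sets small against the cube of radius [2 ^- j0]; the successor
   makes up for the index shift in [level_strip]. The window up to [2 * k1] contains exactly [k1]
   strips. *)
pose k1 := (maxn k0 j0).+1; pose K := (2 * k1)%N.
(* The modulus is used at the finest level only: [D <= 2 ^- K] on the cube of radius [2 ^- J], so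
   all truncations of the window vanish on this one cube. *)
have [J' [hJ' sJ']] := hmod K; pose J := maxn J' j0.
have jJ : (j0 <= J)%N by exact: leq_maxr.
pose S k := [set z | (2 ^- k < D z < 2 ^- k + 2 ^- k)%R].
have mS k : measurable (S k) by exact: measurable_strip.
pose Q j := cube x (2 ^- j : R).
have mQ j : measurable (Q j) by exact: measurable_cube.
have QS j : (j0 <= j)%N -> Q j `<=` Q j0.
  by move=> h; apply: cubeS; rewrite lef_pV2 ?posrE ?exprn_gt0// ler_weXn2l// ler1n.
have hstrip k : (k1 <= k)%N -> 
    (mu (Q j0 `&` [set z | (D z < 2 ^- k + 2 ^- k)%R]) <= ((2 ^- j0) ^+ m.+1)%:E)%E /\
    (\int[mu]_(z in Q j0 `&` S k) (energy lam H z)%:E <= (c * 2 ^+ m.+1 * (2 ^- k) ^+ m.+1)%:E)%E.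
  case: k => // k; rewrite ltnS geq_max => /andP[k0k j0k].
  have [h1 h2] := level_strip H0 mH mD (hlow k k0k); split => //.
  rewrite -mulr2n -[_ *+ 2]mulr_natl exp2N; apply: le_trans h1 _; rewrite lee_fin.
  rewrite -[leRHS]mul1r ler_pM ?(ltW c0) ?exprn_ge0 ?invr_ge0 ?exprn_ge0//.
  by rewrite lerXn2r ?nnegrE ?invr_ge0 ?exprn_ge0// lef_pV2 ?posrE ?exprn_gt0// ler_weXn2l// ler1n.
pose F k j z := (2 ^+ j) ^+ m * \1_(Q j) z * (2 ^+ k * H z * \1_(S k) z).
have F0 k j z : 0 <= F k j z by rewrite /F !mulr_ge0 ?exprn_ge0.
have mF k j : measurable_fun setT (F k j).
  apply: measurable_funM; first by apply: measurable_funM => //; exact: measurable_indic.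
  by apply: measurable_funM; [exact: measurable_funM|exact: measurable_indic].
have hF k : (k1 <= k < K)%N ->
    (1 <= (m.+1%:R * 2 ^+ m.+1)%:E * \sum_(j0 <= j < J) \int[mu]_(z in Q j0) (F k j z)%:E)%E.
  move=> /andP[kk kK]; have [h1 _] := hstrip k kk.
  have s0 : (0 : R) < 2 ^- k by rewrite invr_gt0 exprn_gt0.
  have := strip_chain jJ H0 mH mD s0 (fun j jj => hacl j _ jj s0) h1.
  rewrite invrK; apply => z Jz.
  apply: (@le_trans _ _ (2 ^- K)).
    apply: hJ'; last exact: QS Jz.
    by move: Jz; apply: cubeS; rewrite lef_pV2 ?posrE ?exprn_gt0// ler_weXn2l ?ler1n// leq_maxl.
  by rewrite lef_pV2 ?posrE ?exprn_gt0// ler_weXn2l ?ler1n// ltnW.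
pose q j : R := (j < 4 * K)%N%:R + powR j.+1%:R (- (lam / m%:R)).
have q0 j : 0 <= q j by rewrite addr_ge0 ?powR_ge0.
pose G1 j z := del * (2 ^+ j) ^+ m.+1 * q j * \1_(Q j) z.
pose G2 k z := M * ((2 ^+ k) ^+ m.+1) * \1_(S k) z * energy lam H z.
have e0 z : 0 <= energy lam H z by exact: energy_ge0.
have G10 j z : 0 <= G1 j z by rewrite /G1 !mulr_ge0 ?exprn_ge0// ltW.
have G20 k z : 0 <= G2 k z by rewrite /G2 mulr_ge0 ?e0// !mulr_ge0 ?exprn_ge0// ltW.
have mG1 j : measurable_fun setT (G1 j).
  by apply: measurable_funM => //; exact: measurable_indic.
have mG2 k : measurable_fun setT (G2 k).
  apply: measurable_funM; last exact: measurable_energy.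
  by apply: measurable_funM => //; exact: measurable_indic.
have hpt z : \sum_(k1 <= k < K) \sum_(j0 <= j < J) F k j z <=
    2 * (\sum_(j0 <= j < J) G1 j z) + 2 * (\sum_(k1 <= k < K) G2 k z).
  have hS : \sum_(k1 <= k < K) (z \in S k)%:R <= 1 :> R.
    apply: le_trans (strip_unique (D z) k1 K); apply: ler_sum => k _.
    by rewrite ler_nat; case: (boolP (z \in S k)) => // /set_mem /= ->.
  have := @double_sum_le R m lam del M (H z) (fun j => z \in Q j) (fun k => z \in S k)
    j0 J k1 K m0 (H0 z) d0 M0 (fun j k => hsplit (H z) j k (H0 z)) hS.
  rewrite (_ : \sum_(k1 <= k < K) G2 k z = \sum_(k1 <= k < K) M *
    (2 ^+ k ^+ m.+1 * (H z ^+ m.+1 * powR (ln (expR 1 + H z)) lam)) * (z \in S k)%:R)//.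
  by apply: eq_bigr => k _; rewrite /G2 /energy indicE; ring.
have I1 j : (j0 <= j)%N -> (\int[mu]_(z in Q j0) (G1 j z)%:E = (del * 2 ^+ m.+1 * q j)%:E)%E.
  move=> jj; rewrite /G1 (integral_indic_factor mu (fun=> del * (2 ^+ j) ^+ m.+1 * q j) (QS j jj)).
  have muQ : mu (Q j) = ((2 * 2 ^- j) ^+ m.+1)%:E by rewrite /mu /Q lebn_cube// invr_ge0 exprn_ge0.
  rewrite integral_cst// -[X in (_ * X)%E]/(mu (Q j)) muQ -EFinM; congr (_%:E).
  have tV : (2 ^+ j) ^+ m.+1 * (2 ^- j) ^+ m.+1 = 1 :> R by rewrite -exprMn divff ?expr1n// expf_neq0.
  transitivity (del * 2 ^+ m.+1 * q j * ((2 ^+ j) ^+ m.+1 * (2 ^- j) ^+ m.+1)).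
    by rewrite exprMn; ring.
  by rewrite tV mulr1.
have I2 k : (k1 <= k)%N -> (\int[mu]_(z in Q j0) (G2 k z)%:E <= (M * c * 2 ^+ m.+1)%:E)%E.
  move=> /hstrip[_ h2]; rewrite (_ : \int[mu]_(z in Q j0) _ = 
     \int[mu]_(z in Q j0) (M * 2 ^+ k ^+ m.+1 * \1_(Q j0 `&` S k) z * energy lam H z)%:E)%E; last first.
    apply: eq_integral => z Qz; rewrite /G2 !indicE; congr ((_ * _%:R * _)%:E).
    by rewrite in_setI Qz.
  rewrite integral_scale_indic//; last 3 first.
  - exact: measurableI.
  - exact: measurable_energy.
  - by rewrite mulr_ge0 ?exprn_ge0// ltW.
  apply: le_trans (lee_wpmul2l _ h2) _; first by rewrite lee_fin mulr_ge0 ?exprn_ge0// ltW.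
  rewrite -EFinM lee_fin [leLHS](_ : _ = M * c * 2 ^+ m.+1 * (2 ^+ k * 2 ^- k) ^+ m.+1).
    by rewrite divff ?expf_neq0// expr1n mulr1.
  by rewrite exprMn; ring.
(* At most [4 * K] indices satisfy [j < 4 * K], and the weights sum to what the modulus allows. *)
have sq : \sum_(j0 <= j < J) q j <= (4 * (2 * k1))%:R + C * (2 * k1).+1%:R.
  have : \sum_(j0 <= j < J) q j <= \sum_(0 <= j < J') q j.
    have [h|h] := leqP J' j0.
      by rewrite /J (maxn_idPr h) [leLHS]big_geq// sumr_ge0.
    rewrite /J (maxn_idPl (ltnW h)) (@big_cat_nat _ _ _ j0 0)/= ?(ltnW h)//.
    by rewrite lerDr sumr_ge0.
  move=> /le_trans; apply; rewrite big_split/= lerD//.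
  rewrite -natr_sum ler_nat -/K; elim: (J') => [|j IHj]; first by rewrite big_geq.
  rewrite big_nat_recr//=; case: ltnP => [h|_]; last by rewrite addn0.
  rewrite addn1; apply: leq_trans h; rewrite ltnS.
  apply: leq_trans (leq_sum _ (fun i _ => leq_b1 _)) _.
  by rewrite sum_nat_const_nat muln1 subn0.
have Kk : (K - k1 = k1)%N by rewrite /K mul2n -addnn addnK.
have : ((K - k1)%:R%:E <= (m.+1%:R * 2 ^+ m.+1)%:E *
    \sum_(k1 <= k < K) \sum_(j0 <= j < J) \int[mu]_(z in Q j0) (F k j z)%:E)%E.
  rewrite ge0_sume_distrr//; last first.
    by move=> k _; apply: sume_ge0 => j _; apply: integral_ge0 => z _; rewrite lee_fin.
  rewrite (_ : (K - k1)%:R%:E = \sum_(k1 <= k < K) 1%:E :> \bar R)%E; last first.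
    by rewrite sumEFin big_const_nat iter_addr_0.
  rewrite big_nat_cond [leRHS]big_nat_cond; apply: lee_sum => k; rewrite andbT => hk.
  exact: hF.
rewrite Kk (_ : (\sum_(k1 <= k < K) _)%E =
    \int[mu]_(z in Q j0) (\sum_(k1 <= k < K) \sum_(j0 <= j < J) F k j z)%R%:E)%E; last first.
  rewrite integral_sum_nat//.
  - by apply: eq_bigr => k _; rewrite integral_sum_nat.
  - by move=> k; exact: measurable_sum.
  - by move=> k z; exact: sumr_ge0.
have nn0 : (0 <= (m.+1%:R * 2 ^+ m.+1)%:E :> \bar R)%E by rewrite lee_fin mulr_ge0 ?exprn_ge0.
move=> /le_trans/(_ (lee_wpmul2l nn0 (_ : _ <= (2 * (del * 2 ^+ m.+1 * ((4 * (2 * k1))%:R + C * (2 * k1).+1%:R))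
        + 2 * (M * c * 2 ^+ m.+1 * k1%:R))%:E)%E)) => hh.
have := hbud k1 isT; rewrite ltNge => /negP; apply; rewrite -lee_fin [in leRHS]EFinM.
apply: hh.
have mz1 : measurable_fun setT (fun z => \sum_(j0 <= j < J) G1 j z) by exact: measurable_sum.
have mz2 : measurable_fun setT (fun z => \sum_(k1 <= k < K) G2 k z) by exact: measurable_sum.
have s10 z : 0 <= \sum_(j0 <= j < J) G1 j z by exact: sumr_ge0.
have s20 z : 0 <= \sum_(k1 <= k < K) G2 k z by exact: sumr_ge0.
apply: (@le_trans _ _ (\int[mu]_(z in Q j0)
    (2%:E * (\sum_(j0 <= j < J) G1 j z)%:E + 2%:E * (\sum_(k1 <= k < K) G2 k z)%:E))%E).
  apply: ge0_le_integral => //.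
  - by move=> z _; rewrite lee_fin; apply: sumr_ge0 => k _; exact: sumr_ge0.
  - apply: measurable_funTS; apply/measurable_EFinP.
    by apply: measurable_sum => k; exact: measurable_sum.
  - apply: measurable_funTS; apply/measurable_EFinP.
    by apply: measurable_funD; exact: measurable_funM.
  - by move=> z _; rewrite -!EFinM -EFinD lee_fin hpt.
have mz1' : measurable_fun (Q j0) (fun z => (\sum_(j0 <= j < J) G1 j z)%:E).
  by apply: measurable_funTS; apply/measurable_EFinP.
have mz2' : measurable_fun (Q j0) (fun z => (\sum_(k1 <= k < K) G2 k z)%:E).
  by apply: measurable_funTS; apply/measurable_EFinP.
rewrite ge0_integralD//; last 4 first.
- by move=> z _; rewrite mule_ge0// lee_fin.
- exact: measurable_funeM.
- by move=> z _; rewrite mule_ge0// lee_fin.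
- exact: measurable_funeM.
rewrite !ge0_integralZl_EFin//; try by [move=> z _; rewrite lee_fin].
rewrite !integral_sum_nat// [leRHS]EFinD [X in (_ <= X + _)%E]EFinM [X in (_ <= _ + X)%E]EFinM; apply: leeD; apply: lee_wpmul2l => //.
  rewrite (_ : \sum_(j0 <= j < J) _ = \sum_(j0 <= j < J) (del * 2 ^+ m.+1 * q j)%:E)%E; last first.
    rewrite big_nat_cond [RHS]big_nat_cond; apply: eq_bigr => j; rewrite andbT => /andP[jj _].
    exact: I1.
  by rewrite sumEFin lee_fin -mulr_sumr ler_wpM2l// mulr_ge0 ?exprn_ge0// ltW.
apply: (@le_trans _ _ (\sum_(k1 <= k < K) (M * c * 2 ^+ m.+1)%:E)%E).
  rewrite big_nat_cond [leRHS]big_nat_cond; apply: lee_sum => k; rewrite andbT => /andP[hk _].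
  exact: I2.
by rewrite sumEFin lee_fin big_const_nat iter_addr_0 Kk mulr_natr.
Qed.

End chain.

(** * Outer regularity *)

Section density.
Context d (T : measurableType d) (R : realType) (mu : {measure set T -> \bar R}).
Variable f : T -> \bar R.

(** Made a measure so that regularity and the covering argument apply to the energy itself, not just
    to Lebesgue measure. *)
Definition density of measurable_fun setT f & (forall x, 0 <= f x)%E :=
  fun A => (\int[mu]_(x in A) f x)%E.

Variables (mf : measurable_fun setT f) (f0 : forall x, (0 <= f x)%E).

Let density0 : density mf f0 set0 = 0%E.
Proof. exact: integral_set0. Qed.

Let density_ge0 A : (0 <= density mf f0 A)%E.
Proof. exact: integral_ge0. Qed.

Let density_sigma_additive : semi_sigma_additive (density mf f0).
Proof. exact: semi_sigma_additive_nng_induced. Qed.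

HB.instance Definition _ := isMeasure.Build _ _ _ (density mf f0)
  density0 density_ge0 density_sigma_additive.

End density.

Lemma nonincreasing_small d (T : measurableType d) (R : realType)
    (nu : {measure set T -> \bar R}) (G : (set T)^nat) (e : \bar R) :
  (nu setT < +oo)%E -> (forall i, measurable (G i)) -> measurable (\bigcap_i G i) ->
  (forall i j, (i <= j)%N -> G j `<=` G i) ->
  (nu (\bigcap_i G i) < e)%E -> exists N, (nu (G N) < e)%E.
Proof.
move=> nuT mG mI dG h; apply: contrapT => /forallNP hno.
have cG : nu (G N) @[N --> \oo] --> nu (\bigcap_N G N).
  apply: nonincreasing_cvg_mu => //.
    by apply: le_lt_trans nuT; apply: le_measure; rewrite ?inE.
  by move=> i j ij; apply/subsetPset; exact: dG.
have : (e <= nu (\bigcap_N G N))%E.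
  rewrite -(cvg_lim _ cG)//; apply: lime_ge; first by apply/cvg_ex; exists (nu (\bigcap_N G N)).
  by apply: nearW => N; rewrite leNgt; apply/negP; exact: hno.
by rewrite leNgt h.
Qed.

Section regular.
Context d (T : measurableType d) (R : realType) (nu : {measure set T -> \bar R}).
Variable O : set (set T).
Hypotheses (Om : O `<=` measurable) (OT : O setT) (O0 : O set0)
  (OI : forall U V, O U -> O V -> O (U `&` V))
  (OU : forall F : (set T)^nat, (forall i, O (F i)) -> O (\bigcup_i F i)).
Hypothesis nuT : (nu setT < +oo)%E.

Definition regular (A : set T) := forall e : R, 0 < e -> exists U F,
  [/\ O U, O (~` F), F `<=` A, A `<=` U & (nu (U `\` F) < e%:E)%E].

Let mF F : O (~` F) -> measurable F.
Proof. by move=> /Om/measurableC; rewrite setCK. Qed.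

Lemma regularC A : regular A -> regular (~` A).
Proof.
move=> h e /h[U [F [OU' OF FA AU UF]]]; exists (~` F), (~` U); split => //.
- by rewrite setCK.
- exact: subsetC.
- exact: subsetC.
- by rewrite setDE setCK setIC -setDE.
Qed.

(** A countable union of closed sets need not be closed. Since [nu] is finite, continuity from above
    replaces it by a finite union at the cost of the remaining half of [e]. *)
Lemma regular_bigcup (A : (set T)^nat) : (forall i, regular (A i)) -> regular (\bigcup_i A i).
Proof.
move=> h e e0; have e20 : 0 < e / 2 by rewrite divr_gt0.
have /choice[U /choice[F hUF]] : forall i, exists U F,
    [/\ O U, O (~` F), F `<=` A i, A i `<=` U & (nu (U `\` F) < (e / 2 / (2 ^ i.+1)%:R)%:E)%E].
  by move=> i; apply: h; rewrite divr_gt0// ltr0n expn_gt0.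
have OUi i : O (U i) by have [] := hUF i.
have mU i : measurable (U i) by exact: Om.
have mFi i : measurable (F i) by have [_ /mF] := hUF i.
pose V := \bigcup_i U i; pose G N := V `\` \bigcup_(i < N) F i.
have OV : O V by exact: OU.
have mV : measurable V by exact: Om.
have mB N : measurable (\bigcup_(i < N) F i) by apply: bigcup_measurable.
have mB' : measurable (\bigcup_i F i) by exact: bigcup_measurable.
have GI : \bigcap_N G N = V `\` \bigcup_i F i.
  apply/seteqP; split => [z hz|z [Vz hz] N _].
    split; first by have [] := hz 0%N I.
    by move=> [i _ Fi]; have [_] := hz i.+1 I; apply; exists i => //=.
  by split => // -[i _ Fi]; apply: hz; exists i.
have nuI : (nu (\bigcap_N G N) <= (e / 2)%:E)%E.
  apply: (@le_trans _ _ (\sum_(0 <= i <oo) nu (U i `\` F i))%E).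
    rewrite GI; apply: measure_sigma_subadditive.
    - by move=> i; exact: measurableD.
    - exact: measurableD.
    - move=> z [[i _ Ui] hz]; exists i => //; split => // Fi; apply: hz; by exists i.
  apply: le_trans (epsilon_trick0 xpredT (ltW e20)).
  by apply: lee_nneseries => // i _; have [_ _ _ _ /ltW] := hUF i.
have [N hN] : exists N, (nu (G N) < e%:E)%E.
  apply: nonincreasing_small => //.
  - by move=> N; exact: measurableD.
  - by rewrite GI; exact: measurableD.
  - move=> i j ij; apply: setDS => z [l li Fl]; exists l => //.
    exact: leq_trans ij.
  - by apply: le_lt_trans nuI _; rewrite lte_fin ltr_pdivrMr// mulr_natr mulr2n ltrDl.
exists V, (\bigcup_(i < N) F i); split => //.
- elim: N {hN} => [|N IH]; first by rewrite bigcup_mkord big_ord0 setC0.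
  rewrite bigcup_mkord big_ord_recr/= setCU -bigcup_mkord; apply: OI => //.
  by have [] := hUF N.
- by move=> z [i _ Fi]; exists i => //; have [_ _ /(_ z Fi)] := hUF i.
- by move=> z [i _ Ai]; exists i => //; have [_ _ _ /(_ z Ai)] := hUF i.
Qed.

Lemma regular_sigma_algebra : sigma_algebra setT regular.
Proof.
split.
- move=> e e0; exists set0, set0; split => //; first by rewrite setC0.
  by rewrite setD0 measure0 lte_fin.
- by move=> A; rewrite setTD; exact: regularC.
- exact: regular_bigcup.
Qed.

End regular.

(** * Regularity of finite measures on [Rn] *)

Section regular_Rn.
Variable R : realType.

Lemma cubeopenU n (F : (set (Rn R n))^nat) :
  (forall i, cubeopen (F i)) -> cubeopen (\bigcup_i F i).
Proof.
move=> h x [i _ Fx]; have [r r0 hr] := h i x Fx.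
by exists r => // y /hr Fy; exists i.
Qed.

Lemma cubeopenT n : cubeopen [set: Rn R n].
Proof. by move=> x _; exists 1. Qed.

Lemma cubeopen0 n : cubeopen (@set0 (Rn R n)).
Proof. by []. Qed.

Lemma sigma_algebra_preimage_class (T1 T2 : Type) (g : T2 -> T1) (C : set (set T2)) :
  sigma_algebra setT C -> sigma_algebra setT [set A | C (g @^-1` A)].
Proof.
move=> [C0 CD CU]; split => /=.
- by rewrite preimage_set0.
- by move=> A CA; rewrite setTD preimage_setC -setTD; exact: CD.
- by move=> F CF; rewrite preimage_bigcup; exact: CU.
Qed.

Lemma cubeopen_fst_ray k (x : R) : cubeopen [set z : Rn R k.+1 | x < z.1].
Proof.
move=> z /= xz; exists (z.1 - x); first by rewrite subr_gt0.
by move=> y [/= + _]; rewrite ltr_distl => /andP[+ _]; lra.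
Qed.

Lemma cubeopen_fst_lray k (x : R) : cubeopen [set z : Rn R k.+1 | z.1 < x].
Proof.
move=> z /= xz; exists (x - z.1); first by rewrite subr_gt0.
by move=> y [/= + _]; rewrite ltr_distl => /andP[_]; lra.
Qed.

Lemma regular_ray k (nu : {measure set (Rn R k.+1) -> \bar R}) (x : R) :
  (nu setT < +oo)%E -> regular nu (@cubeopen R k.+1) [set z : Rn R k.+1 | x < z.1].
Proof.
move=> nuT e e0.
pose F N := [set z : Rn R k.+1 | x + N.+1%:R^-1 <= z.1].
pose U := [set z : Rn R k.+1 | x < z.1].
have oF N : cubeopen (~` F N).
  rewrite (_ : ~` F N = [set z : Rn R k.+1 | z.1 < x + N.+1%:R^-1]); first exact: cubeopen_fst_lray.
  by apply/seteqP; split => z /=; rewrite ltNge => /negP.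
have oU : cubeopen U by exact: cubeopen_fst_ray.
have mU : measurable U by exact: measurable_cubeopen.
have mF N : measurable (F N) by rewrite -[F N]setCK; apply: measurableC; exact: measurable_cubeopen.
have G0 : \bigcap_N (U `\` F N) = set0.
  apply/seteqP; split => // z hz.
  have [xz _] := hz 0%N I.
  pose N := Num.truncn (z.1 - x)^-1.
  have [_ /=] := hz N I; apply; rewrite /F/=.
  rewrite -lerBrDl -[leRHS]invrK lef_pV2 ?posrE// ?invr_gt0 ?subr_gt0//.
  by rewrite ltW// truncnS_gt.
have [N hN] : exists N, (nu (U `\` F N) < e%:E)%E.
  apply: nonincreasing_small => //.
  - by move=> N; exact: measurableD.
  - by rewrite G0.
  - move=> i j ij; apply: setDS => z; apply: le_trans.
    by rewrite lerD2l lef_pV2 ?posrE// ler_nat ltnS.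
  - by rewrite G0 measure0 lte_fin.
exists U, (F N); split => //.
by move=> z; apply: lt_le_trans; rewrite ltrDl invr_gt0.
Qed.

(** Regular sets form a sigma-algebra, so generators of the product suffice: rays in the first
    coordinate, and preimages under the second projection. For the latter the induction hypothesis
    is applied to a pushforward of [nu], which is why all finite measures are treated at once. *)
Lemma regular_measurable n (nu : {measure set (Rn R n) -> \bar R}) (A : set (Rn R n)) :
  (nu setT < +oo)%E -> measurable A -> regular nu (@cubeopen R n) A.
Proof.
elim: n nu A => [|k IH] nu A nuT mA.
  by move=> e e0; exists A, A; split => //; [move=> x Ax; exists 1 => // -[]; case: x Ax
    | move=> x Ax; exists 1 => // -[]; case: x Ax | rewrite setDv measure0 lte_fin].
have sr := regular_sigma_algebra (@measurable_cubeopen R k.+1) (@cubeopenT k.+1)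
  (@cubeopen0 k.+1) (@cubeopenI R k.+1) (@cubeopenU k.+1) nuT.
move: A mA; apply: smallest_sub => // B [[C mC <-]|[C mC <-]]; rewrite setTI.
  have : (@RGenOInfty.G R).-sigma.-measurable C by rewrite -RGenOInfty.measurableE.
  move: C {mC}; apply: smallest_sub; first exact: sigma_algebra_preimage_class.
  move=> _ [x ->]; rewrite /= (_ : _ @^-1` _ = [set z : Rn R k.+1 | x < z.1]); first exact: regular_ray.
  by apply/seteqP; split => z /=; rewrite in_itv/= andbT.
have ms : measurable_fun setT (@snd R (Rn R k)) by exact: measurable_snd.
have nuT' : (pushforward nu (@snd R (Rn R k)) setT < +oo)%E by rewrite /pushforward preimage_setT.
move=> e e0; have := IH (pushforward nu (@snd R (Rn R k))) C nuT' mC e e0.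
move=> [U [F [oU oF FC CU UF]]]; exists (snd @^-1` U), (snd @^-1` F).
have h V : cubeopen V -> @cubeopen R k.+1 (@snd R (Rn R k) @^-1` V).
  move=> oV z /oV[r r0 hr]; exists r => // y [_ /= hy]; exact: hr.
split => //.
- exact: h.
- exact: (h _ oF).
- by move=> z /FC.
- by move=> z /CU.
Qed.

(** Regularity is applied to the measure with density [g]. The closed set inside the null set is
    itself null, so removing it from [U] leaves the integral of [g] unchanged. *)
Lemma null_cover n (g : Rn R n -> \bar R) (Z : set (Rn R n)) (e : R) :
  measurable_fun setT g -> (forall z, 0 <= g z)%E -> (\int[lebn R n]_z g z < +oo)%E ->
  (lebn R n).-negligible Z -> 0 < e ->
  exists U, [/\ cubeopen U, Z `<=` U & (\int[lebn R n]_(z in U) g z < e%:E)%E].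
Proof.
move=> mg g0 gT [N [mN N0 ZN]] e0.
have [U [F [oU oF FN NU UF]]] := @regular_measurable n (density (lebn R n) mg g0) N gT mN e e0.
exists U; split => //; first exact: subset_trans ZN NU.
have mU := measurable_cubeopen oU.
have mF : measurable F by rewrite -[F]setCK; apply: measurableC; exact: measurable_cubeopen.
have FU : F `<=` U by exact: subset_trans FN NU.
have F0 : (lebn R n F = 0)%E by exact: subset_measure0 mF mN FN N0.
rewrite -(setDUK FU) ge0_integral_setU//; last 3 first.
- exact: measurableD.
- exact: measurable_funTS.
- by apply/disj_set2P; rewrite setDE setICA setICr setI0.
by rewrite null_set_integral ?add0e//; exact: measurable_funTS.
Qed.

End regular_Rn.

(** * Covering in the target *)

Section vitali.
Variables (R : realType) (I T : Type) (B : I -> set T) (r : I -> R) (V : set I) (S : R).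
Hypotheses (r0 : forall i, V i -> 0 < r i <= S) (Bn : forall i, V i -> B i !=set0).

Definition pairwise_disjoint (G : set I) :=
  forall i j, G i -> G j -> B i `&` B j !=set0 -> i = j.

(** The last clause only constrains balls that already meet the family. It is therefore vacuous for
    the empty family and passes to unions of chains, as Zorn's lemma requires. *)
Definition dominating (G : set I) := [/\ G `<=` V, pairwise_disjoint G &
  forall i j, V i -> G j -> B i `&` B j !=set0 ->
    exists2 k, G k & B i `&` B k !=set0 /\ r i <= 2 * r k].

(* A maximal dominating family meets every ball: a missed ball of nearly maximal radius
   could be added. *)
Lemma vitali_selection : exists G : set I, [/\ G `<=` V, pairwise_disjoint G &
  forall i, V i -> exists2 k, G k & B i `&` B k !=set0 /\ r i <= 2 * r k].
Proof.
have [F FP Ftot|G [[GV Gd Gh] Gmax]] := @Zorn_bigcup I dominating.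
  split.
  - by move=> i [X /FP[XV _ _] /XV].
  - move=> i j [X FX Xi] [Y FY Yj].
    have [XY|YX] := Ftot X Y FX FY.
      by have [_ + _] := FP _ FY; apply => //; exact: XY.
    by have [_ + _] := FP _ FX; apply => //; exact: YX.
  - move=> i j Vi [X FX Xj] ij; have [_ _ /(_ i j Vi Xj ij)[k Xk hk]] := FP _ FX.
    by exists k => //; exists X.
exists G; split => //; apply: contrapT => /existsNP[i0 /not_implyP[Vi0 hi0]].
pose W := [set i | V i /\ forall k, G k -> ~ (B i `&` B k !=set0)].
have Wi0 : W i0.
  by split => // k Gk ik; apply: hi0; have [l Gl hl] := Gh i0 k Vi0 Gk ik; exists l.
have hW : has_sup (r @` W).
  split; first by exists (r i0), i0.
  by exists S => _ [i [/r0/andP[_ ?] _] <-].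
have t0 : 0 < sup (r @` W).
  apply: lt_le_trans (_ : r i0 <= _); first by have /andP[] := r0 Vi0.
  by apply: sup_upper_bound => //; exists i0.
have [_ [i1 [Vi1 hi1] <-] hr] := @sup_adherent R _ _ (divr_gt0 t0 (ltr0n R 2)) hW.
have i1G : ~ G i1.
  by move=> Gi1; apply: (hi1 _ Gi1); rewrite setIid; exact: Bn.
apply: (Gmax (G `|` [set i1])).
  split; first by move=> i Gi; left.
  by move=> /(_ i1 (or_intror erefl)).
split.
- by move=> i [/GV//|->].
- move=> i j [Gi|->] [Gj|->] ij //; first exact: Gd.
    by exfalso; apply: (hi1 i Gi); rewrite setIC.
  by exfalso; exact: (hi1 j Gj).
- move=> i j Vi + ij.
  have [[k Gk ik] _|nG] := pselect (exists2 k, G k & B i `&` B k !=set0).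
    by have [l Gl hl] := Gh i k Vi Gk ik; exists l => //; left.
  move=> Gj; have {Gj} ji1 : j = i1.
    by case: Gj => // Gj; exfalso; apply: nG; exists j.
  exists i1; first by right.
  split; first by rewrite -ji1.
  have : r i <= sup (r @` W).
    apply: sup_upper_bound => //; exists i => //; split => // k Gk ik.
    by apply: nG; exists k.
  by lra.
Qed.

End vitali.

(** * Hausdorff content bounded by a measure on the source *)

Section hausdorff.
Variables (R : realType) (m : nat).
Implicit Types (y : 'rV[R]_m) (s : R).

Definition vball y s := [set p : 'rV[R]_m | forall j, `|p ord0 j - y ord0 j| < s].

Lemma vballxx y s : 0 < s -> vball y s y.
Proof. by move=> s0 j; rewrite subrr normr0. Qed.

Lemma vball_dense y s : 0 < s -> exists q : 'rV[rat]_m, vball y s (map_mx ratr q).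
Proof.
move=> s0.
have hq i : exists q : rat, `|ratr q - y ord0 i| < s.
  have [q] := @rat_in_itvoo R (y ord0 i - s) (y ord0 i + s) ltac:(lra).
  by rewrite in_itv/= -ltr_distlC distrC; exists q.
have [q hqi] := fin_all_exists hq.
by exists (\row_i q i) => j; rewrite !mxE.
Qed.

(** The factor 5 is the radius [s'] plus a diameter [2 * s], itself at most [4 * s']. *)
Lemma vball_fatten y y' s s' : vball y s `&` vball y' s' !=set0 -> s <= 2 * s' ->
  vball y s `<=` vball y' (5 * s').
Proof.
move=> [p [py py']] ss q qy j; have := py j; have := py' j; have := qy j.
by rewrite !ltr_distl => /andP[? ?] /andP[? ?] /andP[? ?]; apply/andP; lra.
Qed.

Lemma ediam_vball y s : 0 <= s -> (ediam (vball y s) <= (m%:R * (2 * s))%:E)%E.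
Proof.
move=> s0; apply: ub_ereal_sup => _ [->|[p py [q qy <-]]].
  by rewrite lee_fin mulr_ge0// mulr_ge0.
rewrite lee_fin; apply: enorm_le; first by rewrite mulr_ge0.
move=> j; rewrite !mxE; have := py j; have := qy j.
by rewrite !ltr_distl ler_norml => /andP[? ?] /andP[? ?]; apply/andP; lra.
Qed.

Lemma ediam_ge0 (C : set 'rV[R]_m) : (0 <= ediam C)%E.
Proof. by apply: ereal_sup_ubound; left. Qed.

Lemma ediam0 : ediam (@set0 'rV[R]_m) = 0%E.
Proof.
apply/eqP; rewrite eq_le ediam_ge0 andbT.
by apply: ub_ereal_sup => _ [->|[p []]].
Qed.

Lemma epown_le (x : \bar R) (r : R) n : (0 <= x)%E -> (x <= r%:E)%E -> (epown x n <= (r ^+ n)%:E)%E.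
Proof.
case: x => [x| |]//=; rewrite !lee_fin => x0 xr.
by rewrite lerXn2r ?nnegrE// (le_trans x0).
Qed.

Lemma epown_ge0 (x : \bar R) n : (0 <= x)%E -> (0 <= epown x n)%E.
Proof. by case: x => [x| |]//=; rewrite !lee_fin => x0; rewrite exprn_ge0. Qed.

(** The selected balls are disjoint, hence so are their preimages, whose masses add up to at most
    [nu W]; the balls enlarged five times cover [A]. In the constant, 10 is this enlargement times
    the passage from radius to diameter, and [m] compares the Euclidean norm with the sup norm. *)
Lemma hausdorff_delta_le d (X : measurableType d) (nu : {measure set X -> \bar R})
    (g : X -> 'rV[R]_m) (W : set X) (A : set 'rV[R]_m) (n : nat) (c de : R) :
  (0 < n)%N -> 0 < c -> 0 < de -> measurable W ->
  (forall y s, measurable (W `&` g @^-1` (vball y s))) ->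
  (forall y t, A y -> 0 < t -> exists s, [/\ 0 < s, s <= t &
     ((c * s ^+ n)%:E <= nu (W `&` g @^-1` (vball y s)))%E]) ->
  (hausdorff_delta n de A <= ((m%:R * 10) ^+ n / c)%:E * nu W)%E.
Proof.
move=> n0 c0 de0 mW mg hA.
(* The summand 1 keeps the denominator positive even for [m = 0]; enlarged balls then have diameter
   at most [de]. *)
pose t := de / (m%:R * 10 + 1).
have t0 : 0 < t by rewrite divr_gt0// ltr_wpDl// mulr_ge0.
pose P y s := [/\ 0 < s, s <= t & ((c * s ^+ n)%:E <= nu (W `&` g @^-1` (vball y s)))%E].
pose V : set ('rV[R]_m * R) := [set p | A p.1 /\ P p.1 p.2].
pose B (p : 'rV[R]_m * R) := vball p.1 p.2.
have V0 (p : 'rV[R]_m * R) : V p -> 0 < p.2 <= t by move=> [_ [-> ->]].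
have VB (p : 'rV[R]_m * R) : V p -> B p !=set0 by move=> [_ [? _ _]]; exists p.1; exact: vballxx.
have [G [GV Gd Gh]] := vitali_selection V0 VB.
have /choice[phi hphi] : forall p : 'rV[R]_m * R, exists q : 'rV[rat]_m, G p -> B p (map_mx ratr q).
  move=> p; have [Gp|nGp] := pselect (G p); last by exists 0.
  have [_ [p0 _ _]] := GV p Gp; have [q hq] := vball_dense p.1 p0; by exists q.
have phi_inj (p p' : 'rV[R]_m * R) : G p -> G p' -> pickle (phi p) = pickle (phi p') -> p = p'.
  move=> Gp Gp' /(pcan_inj pickleK) e; apply: Gd => //.
  by exists (map_mx ratr (phi p)); split; [exact: hphi|rewrite e; exact: hphi].
have /choice[h hh] : forall j, exists o : option ('rV[R]_m * R),
    match o with Some p => G p /\ pickle (phi p) = j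
    | None => forall p, G p -> pickle (phi p) <> j end.
  move=> j; have [[p Gp pj]|np] := pselect (exists2 p, G p & pickle (phi p) = j).
    by exists (Some p).
  by exists None => p Gp pj; apply: np; exists p.
pose C j := if h j is Some p then vball p.1 (5 * p.2) else set0.
pose F j := if h j is Some p then W `&` g @^-1` (B p) else set0.
have mF j : measurable (F j) by rewrite /F; case: (h j) => [p|//]; exact: mg.
have tF : trivIset setT F.
  move=> i j _ _ [z []]; rewrite /F; move: (hh i) (hh j).
  case: (h i) => [p|//]; case: (h j) => [q|//] [Gp pi] [Gq qj] [_ zp] [_ zq].
  by rewrite -pi -qj (Gd p q)//; exists (g z).
have hdiam j : (ediam (C j) <= (m%:R * 10 * (if h j is Some p then p.2 else 0))%:E)%E.
  rewrite /C; have := hh j; case: (h j) => [p [/GV[_ [p0 _ _]] _]|_]; last by rewrite ediam0 mulr0.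
  apply: le_trans (ediam_vball _ _) _; first by rewrite mulr_ge0// ltW.
  by rewrite lee_fin le_eqVlt; apply/orP; left; apply/eqP; ring.
apply: (@le_trans _ _ (\sum_(0 <= j <oo) epown (ediam (C j)) n)%E).
  apply: ereal_inf_lbound; exists C => //; split.
    move=> y Ay; have [s hs] := hA y t Ay t0.
    have [p Gp [h1 h2]] := Gh (y, s) (conj Ay hs).
    exists (pickle (phi p)) => //; rewrite /C; have := hh (pickle (phi p)).
    case: (h _) => [q [Gq qp]|/(_ p Gp)//].
    rewrite (phi_inj _ _ Gq Gp qp).
    apply: (vball_fatten h1 h2); apply: vballxx.
    by have [] := hs.
  move=> j; apply: le_trans (hdiam j) _; rewrite lee_fin.
  have := hh j; case: (h j) => [p [/GV[_ [p0 pt _]] _]|_]; last by rewrite mulr0 ltW.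
  apply: (@le_trans _ _ ((m%:R * 10 + 1) * t)).
    by apply: ler_pM => //; rewrite ?mulr_ge0// ?lerDl// ltW.
  by rewrite /t mulrC divfK// gt_eqF// ltr_wpDl// mulr_ge0.
apply: (@le_trans _ _ (\sum_(0 <= j <oo) ((m%:R * 10) ^+ n / c)%:E * nu (F j))%E).
  apply: lee_nneseries => [j _ _|j _]; first by rewrite epown_ge0// ediam_ge0.
  apply: le_trans (epown_le n (ediam_ge0 _) (hdiam j)) _.
  rewrite /F; have := hh j; case: (h j) => [p [/GV[_ [p0 _ hp]] _]|_]; last first.
    by rewrite mulr0 expr0n eqn0Ngt n0 measure0 mule0.
  apply: le_trans (lee_wpmul2l _ hp).
    by rewrite -EFinM lee_fin exprMn mulrA divfK// gt_eqF.
  by rewrite lee_fin divr_ge0 ?exprn_ge0 ?(ltW c0)// mulr_ge0.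
rewrite nneseriesZl//; apply: lee_wpmul2l.
  by rewrite lee_fin divr_ge0 ?exprn_ge0 ?(ltW c0)// mulr_ge0.
rewrite -measure_semi_bigcup//; last exact: bigcup_measurable.
apply: le_measure; rewrite ?inE//; first exact: bigcup_measurable.
by move=> z [j _]; rewrite /F; case: (h j) => [p []|].
Qed.

Lemma hausdorff_eq0 (n : nat) (A : set 'rV[R]_m) :
  (forall de e : R, 0 < de -> 0 < e -> (hausdorff_delta n de A <= e%:E)%E) ->
  hausdorff n A = 0%E.
Proof.
move=> h; apply/eqP; rewrite eq_le; apply/andP; split.
  apply: ub_ereal_sup => _ [de /= de0 <-].
  by apply/lee_addgt0Pr => e e0; rewrite add0e; exact: h.
apply: (@le_trans _ _ (hausdorff_delta n 1 A)); last first.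
  by apply: ereal_sup_ubound; exists 1 => //=.
apply: le_ereal_inf_tmp => _ [C _ <-]; apply: nneseries_ge0 => j _ _.
by rewrite epown_ge0// ediam_ge0.
Qed.

End hausdorff.

Section sigma_cover.
Variable R : realType.

(** The density to be used contains the constant 1 on a possibly unbounded domain, so its integral
    is finite on bounded cubes only. The cube of index [M] gets the share [e / (2 ^ M.+1)%:R]. *)
Lemma null_cover_local n (g : Rn R n -> \bar R) (Z : set (Rn R n)) (e : R) :
  measurable_fun setT g -> (forall z, 0 <= g z)%E ->
  (forall M : nat, \int[lebn R n]_(z in cube (unvec 0) M.+1%:R) g z < +oo)%E ->
  (lebn R n).-negligible Z -> 0 < e ->
  exists U, [/\ cubeopen U, Z `<=` U & (\int[lebn R n]_(z in U) g z <= e%:E)%E].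
Proof.
move=> mg g0 gM nZ e0; pose Q M := cube (unvec 0 : Rn R n) M.+1%:R.
have mQ M : measurable (Q M) by exact: measurable_cube.
have /choice[U hU] M : exists U, [/\ cubeopen U, Z `<=` U &
    (\int[lebn R n]_(z in U) (g \_ (Q M)) z < (e / (2 ^ M.+1)%:R)%:E)%E].
  apply: null_cover => //.
  - by apply/(measurable_restrictT _ (mQ M)); exact: measurable_funTS.
  - by move=> z; rewrite /patch; case: ifP.
  - by rewrite -integral_mkcondr setTI; exact: gM.
  - by rewrite divr_gt0// ltr0n expn_gt0.
have mU M : measurable (U M) by have [/measurable_cubeopen] := hU M.
exists (\bigcup_M (U M `&` Q M)); split.
- apply: cubeopenU => M; apply: cubeopenI; first by have [] := hU M.
  exact: cubeopen_cube.
- move=> z Zz; pose a : R := \sum_(i < n) `|vecn z ord0 i|.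
  exists (Num.truncn a) => //; split; first by have [_ /(_ z Zz)] := hU (Num.truncn a).
  apply/cubeP => i; rewrite unvecK mxE subr0; apply: le_lt_trans (truncnS_gt _).
  by rewrite /a (bigD1 i)//= lerDl sumr_ge0.
apply: (@le_trans _ _ (\sum_(0 <= M <oo) \int[lebn R n]_(z in U M `&` Q M) g z)%E).
  apply: (@measure_sigma_subadditive _ _ _ (density (lebn R n) mg g0)) => //.
  - by move=> M; exact: measurableI.
  - by apply: bigcup_measurable => M _; exact: measurableI.
apply: le_trans (epsilon_trick0 xpredT (ltW e0)).
apply: lee_nneseries => [M _ _|M _]; first exact: integral_ge0.
by rewrite integral_mkcondr ltW//; have [] := hU M.
Qed.

End sigma_cover.

(** * Weak differentials *)

Section weak.
Variable R : realType.

Definition cubebar n (x : Rn R n) r :=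
  [set z : Rn R n | forall i, `|vecn z ord0 i - vecn x ord0 i| <= r].

Lemma cubebar_sub n (x : Rn R n) r : 0 < r -> cubebar x r `<=` cube x (r + r).
Proof. by move=> r0 z hz; apply/cubeP => i; rewrite (le_lt_trans (hz i))// ltrDl. Qed.

Lemma cube_cubebar n (x : Rn R n) r : cube x r `<=` cubebar x r.
Proof. by move=> z /cubeP hz i; exact: ltW. Qed.

Lemma measurable_cubebar n (x : Rn R n) r : measurable (cubebar x r).
Proof.
rewrite -[cubebar _ _]setCK; apply: measurableC; apply: measurable_cubeopen.
move=> z /existsNP[i /negP]; rewrite -ltNge => hi.
exists (`|vecn z ord0 i - vecn x ord0 i| - r); first by rewrite subr_gt0.
move=> w /cubeP/(_ i) hw /(_ i); apply/negP; rewrite -ltNge.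
have := ler_normD (vecn w ord0 i - vecn x ord0 i) (vecn z ord0 i - vecn w ord0 i).
rewrite addrC addrA subrK => h.
by rewrite distrC in hw; lra.
Qed.

(** The closed cube among row vectors, where compactness is available; [preimage_box] takes it back
    to [Rn]. *)
Definition box n (x : Rn R n) r : set 'rV[R]_n :=
  [set v | forall i, `[vecn x ord0 i - r, vecn x ord0 i + r]%classic (v ord0 i)].

Lemma compact_box n (x : Rn R n) r : compact (box x r).
Proof.
apply: (@rV_compact _ _ (fun i => `[vecn x ord0 i - r, vecn x ord0 i + r]%classic)) => i.
exact: segment_compact.
Qed.

Lemma preimage_box n (x : Rn R n) r : @vecn R n @^-1` box x r = cubebar x r.
Proof.
by apply/seteqP; split => z h i; have := h i; rewrite /= in_itv/= ler_distl.
Qed.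

Lemma tensE n s (z : Rn R n) :
  tens s z = tensor (fun (i : 'I_n) k => psi (nth prm0 s i) k) (fun=> 0%N) (vecn z).
Proof.
rewrite /tensor; elim: n s z => [|k IH] s z; first by rewrite big_ord0.
rewrite big_ord_recl/= vecn0E nth0 IH; congr (_ * _).
by apply: eq_bigr => i _; rewrite vecnSE nth_behead.
Qed.

Lemma dtensE n s (z : Rn R n) (i : 'I_n) :
  dtens i s z = tensor (fun (i : 'I_n) k => psi (nth prm0 s i) k) (fun l => (l == i) + 0)%N (vecn z).
Proof.
rewrite /tensor; elim: n s z i => [|k IH] s z i; first by case: i.
rewrite big_ord_recl/= vecn0E nth0; case: (unliftP ord0 i) => [j|] ->.
  rewrite /= IH; congr (_ * _); apply: eq_bigr => l _.
  by rewrite vecnSE nth_behead (inj_eq lift_inj).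
rewrite /= tensE; congr (_ * _); apply: eq_bigr => l _.
by rewrite vecnSE nth_behead.
Qed.

Lemma admP n (x : Rn R n) r s : adm x r s ->
  forall i : 'I_n, adm1 (vecn x ord0 i) r (nth prm0 s i).
Proof.
elim: n x s => [|k IH] x s; first by move=> _ [].
move=> [h1 h2] i; case: (unliftP ord0 i) => [j|] ->; last by rewrite vecn0E nth0.
by rewrite vecnSE -nth_behead; exact: IH.
Qed.

Lemma tensor_out n (x : Rn R n) r s c (v : 'rV[R]_n) : adm x r s -> ~ box x r v ->
  tensor (fun (i : 'I_n) k => psi (nth prm0 s i) k) c v = 0.
Proof.
move=> hs /existsNP[i /negP]; rewrite in_itv/= negb_and -!ltNge => hi.
rewrite /tensor (bigD1 i)//= [psi _ _ _]bump_out ?mul0r//.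
have [h1 h2] := admP hs i; case/orP: hi => hi; [left|right]; apply: ltW.
  exact: lt_trans h1.
exact: lt_trans hi.
Qed.

Lemma test_fun_tens n (O : set 'rV[R]_n) (x : Rn R n) r s : box x r `<=` O -> adm x r s ->
  test_fun O (tensor (fun (i : 'I_n) k => psi (nth prm0 s i) k) (fun=> 0%N)).
Proof.
move=> bO hs.
apply: (@test_fun_tensor _ _ _ _ _ _ (fun i => ratr (nth prm0 s i).1.1) (fun i => ratr (nth prm0 s i).1.2)).
- by move=> i k t; exact: is_derive_bump.
- by move=> i t h; exact: bump_out.
- move=> v hv; apply: bO => i; have [h1 h2] := admP hs i; have /andP[h3 h4] := hv i.
  by rewrite /= in_itv/= (le_trans (ltW h1))// (le_trans h4)// ltW.
Qed.

(** Since [k] lives in the box, [h] may be cut off there. For locally integrable [h] the cut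
    function is integrable on the whole space, as the slicing lemmas require. *)
Lemma leb_int_cut n (O : set 'rV[R]_n) (x : Rn R n) r (h k : 'rV[R]_n -> R) :
  box x r `<=` O -> (forall v, ~ box x r v -> k v = 0) ->
  leb_int O (fun v => (h v * k v)%:E) =
  (\int[lebn R n]_z (((h \o @vecn R n) \_ (cubebar x r)) z * k (vecn z))%:E)%E.
Proof.
move=> bO k0; rewrite /leb_int integral_mkcond; apply: eq_integral => z _.
rewrite -preimage_box /patch; case: ifPn => [zO|zO].
  case: ifPn => // zb; rewrite k0 ?mulr0 ?mul0r//.
  by move=> hb; move: zb; rewrite notin_setE; apply.
rewrite ifN ?mul0r//.
by move: zO; rewrite !notin_setE; apply: contra_not => /bO.
Qed.

Lemma integrable_cut n (O : set 'rV[R]_n) (x : Rn R n) r (h : 'rV[R]_n -> R) :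
  box x r `<=` O -> loc_integrable O h ->
  (lebn R n).-integrable setT (EFin \o ((h \o @vecn R n) \_ (cubebar x r))).
Proof.
move=> bO hO; rewrite -restrict_EFin; apply/(integrable_mkcond _ (measurable_cubebar x r)).
by rewrite -preimage_box; apply: hO => //; exact: compact_box.
Qed.

(** Extension by 0 from ordinals to naturals, the index type of [tensor_weak]. *)
Definition coordfun n (G : 'I_n -> Rn R n -> R) (i : nat) : Rn R n -> R :=
  if insub i is Some k then G k else fun=> 0.

Lemma coordfunE n (G : 'I_n -> Rn R n -> R) (i : 'I_n) : coordfun G i = G i.
Proof. by rewrite /coordfun valK. Qed.

(** The cutoff radius [r] stays fixed while the test radius [r'] varies, so the same cut functions
    serve on all smaller cubes. *)
Lemma weak_diff_tensor n d (O : set 'rV[R]_n) (f : 'rV[R]_n -> 'rV[R]_d) Df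
    (x : Rn R n) (r r' : R) (j : 'I_d) :
  weak_diff O f Df -> box x r `<=` O -> r' <= r ->
  tensor_weak x r' (((fun v => f v ord0 j) \o @vecn R n) \_ (cubebar x r))
    (coordfun (fun i => ((fun v => Df v j i) \o @vecn R n) \_ (cubebar x r))).
Proof.
move=> [fL [DL hw]] bO rr i s lin hs.
have bS : box x r' `<=` box x r.
  by move=> v hv k; have := hv k; rewrite /= !in_itv/= => /andP[? ?]; apply/andP; lra.
have bO' : box x r' `<=` O by exact: subset_trans bS bO.
pose k := Ordinal lin; rewrite -[i]/(nat_of_ord k) coordfunE.
have iu := integrable_cut bO (fL j).
have ig := integrable_cut bO (DL j k).
rewrite RintegralD//; [|exact: integrable_mul_dtens|exact: integrable_mul_tens].
pose phi : 'rV[R]_n -> R := tensor (fun (i : 'I_n) k => psi (nth prm0 s i) k) (fun=> 0%N).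
have := hw j k phi (test_fun_tens bO' hs).
have -> : pder k phi = tensor (fun (i : 'I_n) k => psi (nth prm0 s i) k) (fun l => (l == k) + 0)%N.
  by apply: pder_tensor => l c t; exact: is_derive_bump.
rewrite /phi.
rewrite !(leb_int_cut _ bO); last 2 first.
- by move=> v nb; apply: (tensor_out _ hs); by move=> /bS.
- by move=> v nb; apply: (tensor_out _ hs); by move=> /bS.
move=> e; rewrite /Rintegral.
under eq_integral do rewrite dtensE.
under [X in _ + fine X]eq_integral do rewrite tensE.
by rewrite e fineN addNr.
Qed.

Lemma measurable_fun_local n (U : set (Rn R n)) (h : Rn R n -> R) : cubeopen U ->
  (forall x r, 0 < r -> cube x (r + r) `<=` U -> measurable_fun (cube x r) h) ->
  measurable_fun U h.
Proof.
move=> oU hl; have [V [UE hV]] := cubeopen_cover oU; rewrite UE.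
apply/measurable_fun_bigcup.
  by move=> i; have [->|[x [r [_ -> _]]]] := hV i; [exact: measurable0|exact: measurable_cube].
move=> i; have [->|[x [r [r0 -> sU]]]] := hV i; first exact: measurable_fun_set0.
exact: hl.
Qed.

Definition mnormv n d (Df : 'rV[R]_n -> 'I_d -> 'I_n -> R) (z : Rn R n) : R := mnorm (Df (vecn z)).

Lemma mnorm_coord n d (A : 'I_d -> 'I_n -> R) j i : `|A j i| <= mnorm A.
Proof.
rewrite -sqrtr_sqr /mnorm ler_wsqrtr// (bigD1 j)//= (bigD1 i)//=.
rewrite -addrA lerDl addr_ge0//; apply: sumr_ge0 => k _; first exact: sqr_ge0.
by apply: sumr_ge0 => l _; exact: sqr_ge0.
Qed.

Lemma measurable_mnorm e (T : measurableType e) (E : set T) n d (A : T -> 'I_d -> 'I_n -> R) :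
  (forall j i, measurable_fun E (fun z => A z j i)) -> measurable_fun E (fun z => mnorm (A z)).
Proof.
move=> mA; apply: (@measurableT_comp _ _ _ _ _ _ (@Num.sqrt R)).
  apply: continuous_measurable_fun; exact: sqrt_continuous.
apply: measurable_sum => j; apply: measurable_sum => i.
by apply: measurable_funX; exact: mA.
Qed.

Lemma box_sub n (O : set 'rV[R]_n) (x : Rn R n) r : 0 < r ->
  cube x (r + r) `<=` @vecn R n @^-1` O -> box x r `<=` O.
Proof.
move=> r0 h v hv; have := h (unvec v); rewrite /= unvecK; apply.
by apply: cubebar_sub => //; rewrite -preimage_box /= unvecK.
Qed.

(** Local integrability gives measurability on compact boxes in [O]; a countable cover by cubes
    whose doubles stay in the domain extends it. *)
Lemma measurable_mnormv n d (O : set 'rV[R]_n) (f : 'rV[R]_n -> 'rV[R]_d) Df :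
  eopen O -> weak_diff O f Df -> measurable_fun (@vecn R n @^-1` O) (mnormv Df).
Proof.
move=> oO [_ [DL _]]; apply: measurable_fun_local; first exact: cubeopen_eopen.
move=> x r r0 sO; apply: measurable_mnorm => j i.
have /integrableP[/measurable_EFinP mD _] := DL j i _ (@compact_box n x r) (box_sub r0 sO).
apply: measurable_funS mD; rewrite preimage_box; first exact: measurable_cubebar.
exact: cube_cubebar.
Qed.

End weak.

(** * Luzin's condition (N) *)

Section luzin.
Variables (R : realType) (m d : nat).
Let n := m.+1.
Variables (O : set 'rV[R]_n) (lam mu : R) (f : 'rV[R]_n -> 'rV[R]_d)
  (Df : 'rV[R]_n -> 'I_d -> 'I_n -> R).
Hypotheses (oO : eopen O) (m0 : (0 < m)%N) (hl : 0 <= lam <= m%:R) (mu0 : 0 < mu)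
  (wDf : weak_diff O f Df)
  (hmod : forall x y, O x -> O y -> 0 < enorm (x - y) -> enorm (x - y) < 1 ->
     enorm (f x - f y) <= modulus m lam mu (enorm (x - y))).

Let V := @vecn R n @^-1` O.

(** The Euclidean norm is at most [n] times the sup norm and [n < 2 ^ n], which is the shift taken
    in [modulus_scale]. The cube of radius [2 ^- n] keeps distances below 1, where the hypothesis on
    [f] speaks. *)
Lemma oscillation_scale : exists2 C : R, 0 < C & forall K : nat, exists J : nat,
  (forall z w, V z -> V w -> cube z (2 ^- J) w -> cube z (2 ^- n) w ->
     forall j, `|f (vecn w) ord0 j - f (vecn z) ord0 j| <= 2 ^- K) /\
  \sum_(0 <= j < J) powR j.+1%:R (- (lam / m%:R)) <= C * K.+1%:R.
Proof.
have [C C0 hC] := modulus_scale n m0 hl mu0; exists C => // K.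
have [J [hJ sJ]] := hC K; exists J; split => // z w Vz Vw zJ zn j.
have en (r : R) : 0 <= r -> cube z r w -> enorm (vecn w - vecn z) <= n%:R * r.
  move=> r0 /cubeP h; apply: enorm_le => // i.
  by have := ltW (h i); rewrite !mxE.
have p0 (k : nat) : 0 <= 2 ^- k :> R by rewrite invr_ge0 exprn_ge0.
have n2 : n%:R < 2 ^+ n :> R by rewrite -natrX ltr_nat ltn_expl.
have [e0|e0] := eqVneq (enorm (vecn w - vecn z)) 0.
  have -> : vecn w = vecn z.
    apply/eqP; rewrite -subr_eq0; apply/eqP/rowP => i; rewrite [RHS]mxE.
    by apply/eqP; rewrite -normr_le0 -e0; exact: enorm_coord.
  by rewrite subrr normr0.
have {}e0 : 0 < enorm (vecn w - vecn z) by rewrite lt_neqAle eq_sym e0 sqrtr_ge0.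
have := @enorm_coord R d (f (vecn w) - f (vecn z)) j; rewrite !mxE => /le_trans; apply.
apply: le_trans (hmod Vw Vz e0 _) _.
  apply: le_lt_trans (en _ (p0 _) zn) _.
  by rewrite ltr_pdivrMr ?mul1r// exprn_gt0.
apply: hJ => //; apply: le_trans (en _ (p0 _) zJ) _.
by rewrite ler_wpM2r// ltW.
Qed.

Lemma cubecont_coord j : cubecont V (fun z => f (vecn z) ord0 j).
Proof.
have [C C0 hC] := oscillation_scale; move=> z Vz e e0.
have [J [hJ _]] := hC (Num.truncn e^-1).
have p0 (k : nat) : 0 < 2 ^- k :> R by rewrite invr_gt0 exprn_gt0.
exists (Num.min (2 ^- J) (2 ^- n)); first by rewrite lt_min !p0.
move=> w zw Vw; apply: le_lt_trans (hJ z w Vz Vw _ _ j) _.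
- by apply: cubeS zw; rewrite ge_min lexx.
- by apply: cubeS zw; rewrite ge_min lexx orbT.
rewrite -[ltRHS]invrK ltf_pV2 ?posrE ?invr_gt0 ?exprn_gt0//.
apply: lt_le_trans (truncnS_gt _) _.
by rewrite -natrX ler_nat ltn_expl.
Qed.

Lemma cubeopen_preim_vball (U : set (Rn R n)) y s : cubeopen U -> U `<=` V ->
  cubeopen (U `&` (f \o @vecn R n) @^-1` (vball y s)).
Proof.
move=> oU UV z [Uz hz]; have [r0 r00 hr0] := oU z Uz.
have /fin_all_exists2[r rpos hr] : forall j : 'I_d, exists2 r, 0 < r &
    forall w, cube z r w -> V w -> `|f (vecn w) ord0 j - y ord0 j| < s.
  move=> j; have := hz j; rewrite -subr_gt0 => e0.
  have [r rp hr] := cubecont_coord j (UV z Uz) e0; exists r => // w zw Vw.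
  rewrite -(subrK (f (vecn z) ord0 j) (f (vecn w) ord0 j)) -addrA.
  rewrite (le_lt_trans (ler_normD _ _))// -ltrBrDr; exact: hr.
have hm : forall j, \big[Num.min/r0]_j r j <= r j.
  by move=> j; rewrite (bigD1 j)//= ge_min lexx.
exists (\big[Num.min/r0]_j r j).
  by elim/big_rec: _ => // j t _ t0; rewrite lt_min rpos.
move=> w zw; have Uw : U w.
  apply: hr0; apply: cubeS zw; elim/big_rec: _ => // j t _ tr.
  by rewrite ge_min tr orbT.
by split => // j; apply: hr (UV w Uw); exact: cubeS zw.
Qed.

(** |Df|, and next Phi + 1, extended by 0 off the domain. Unlike the functions cut off at a cube,
    they do not depend on the centre, so all preimages of balls are measured by the same density. *)
Let Hbar := mnormv Df \_ V.
Let G := (fun z => energy lam Hbar z + 1) \_ V.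

Let mV : measurable V.
Proof. exact/measurable_cubeopen/cubeopen_eopen. Qed.

Lemma measurable_cutoff_norm : measurable_fun setT Hbar.
Proof. by apply/(measurable_restrictT _ mV); exact: measurable_mnormv wDf. Qed.

Lemma cutoff_norm_ge0 z : 0 <= Hbar z.
Proof. by rewrite /Hbar /patch; case: ifP => // _; rewrite sqrtr_ge0. Qed.

Lemma measurable_cutoff_energy : measurable_fun setT G.
Proof.
apply/(measurable_restrictT _ mV); apply: measurable_funTS; apply: measurable_funD => //.
by apply: measurable_energy; exact: measurable_cutoff_norm.
Qed.

Lemma cutoff_energy_ge0 z : 0 <= G z.
Proof.
rewrite /G /patch; case: ifP => // _.
by rewrite addr_ge0// energy_ge0// cutoff_norm_ge0.
Qed.

(** [level_mass] on a cube about [x] inside [U], where the cut functions agree with the original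
    ones. The constant [c] is chosen before [U] and [x], as the covering argument needs. *)
Lemma preimage_ball_mass : exists2 c : R, 0 < c & forall (U : set (Rn R n)) x (k0 : nat),
  cubeopen U -> U `<=` V -> U x -> exists2 k, (k0 <= k)%N &
    ((c * (2 ^- k) ^+ n)%:E <= \int[lebn R n]_(z in
       U `&` (f \o @vecn R n) @^-1` (vball (f (vecn x)) (2 ^- k))) (G z)%:E)%E.
Proof.
have [C C0 hC] := oscillation_scale; have [c c0 hc] := level_mass m0 hl C0.
exists c => // U x k0 oU UV Ux; have [r r0 hr] := oU x Ux.
have p0 (k : nat) : 0 < 2 ^- k :> R by rewrite invr_gt0 exprn_gt0.
have pS (k l : nat) : (k <= l)%N -> 2 ^- l <= 2 ^- k :> R.
  by move=> kl; rewrite lef_pV2 ?posrE ?exprn_gt0// ler_weXn2l// ler1n.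
have [J0 [hJ0 _]] := hC 0%N.
(* Three demands on the starting scale: oscillation at most 1, hence boundedness, from [J0];
   distances below 1 from [n]; the doubled cube inside [U] from the last term. *)
pose j0 := maxn (maxn J0 n) (Num.truncn r^-1).+1.
have j0J : (J0 <= j0)%N by rewrite !leq_max leqnn.
have j0n : (n <= j0)%N by rewrite !leq_max leqnn orbT.
pose rho : R := 2 ^- j0.
have rho0 : 0 < rho by exact: p0.
have rr : rho + rho <= r.
  apply: (@le_trans _ _ (2 ^- (Num.truncn r^-1))).
    by rewrite -exp2D lerD// pS// leq_max leqnn orbT.
  rewrite -[leRHS]invrK lef_pV2 ?posrE ?invr_gt0 ?exprn_gt0//.
  by rewrite (le_trans (ltW (truncnS_gt _)))// -natrX ler_nat ltn_expl.
have cU : cube x rho `<=` U by apply: subset_trans hr; apply: cubeS; apply: le_trans rr; rewrite lerDl ltW.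
have bO : box x rho `<=` O.
  by apply: box_sub => //; apply: subset_trans UV; apply: subset_trans hr; exact: cubeS.
pose u j := ((fun v => f v ord0 j) \o @vecn R n) \_ (cubebar x rho).
pose g j := coordfun (fun i => ((fun v => Df v j i) \o @vecn R n) \_ (cubebar x rho)).
pose H z := mnorm (fun j i => (((fun v => Df v j i) \o @vecn R n) \_ (cubebar x rho)) z).
pose y0 j := f (vecn x) ord0 j.
pose D z := dist y0 (fun j => u j z).
have uE j z : cube x rho z -> u j z = f (vecn z) ord0 j.
  by move=> /cube_cubebar hz; rewrite /u /patch mem_set.
have Vx : V x by exact: UV.
have hD J K : (forall z w, V z -> V w -> cube z (2 ^- J) w -> cube z (2 ^- n) w ->
     forall j, `|f (vecn w) ord0 j - f (vecn z) ord0 j| <= 2 ^- K) ->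
    forall z, cube x (2 ^- J) z -> cube x rho z -> forall j, `|u j z - y0 j| <= 2 ^- K.
  move=> h z zJ zr j; rewrite uE//; apply: h => //; first exact/UV/cU.
  by apply: cubeS zr; exact: pS.
have iu j : (lebn R n).-integrable setT (EFin \o u j).
  exact: (integrable_cut bO (proj1 wDf j)).
have ig j i : (lebn R n).-integrable setT (EFin \o (((fun v => Df v j i) \o @vecn R n) \_ (cubebar x rho))).
  exact: (integrable_cut bO (proj1 (proj2 wDf) j i)).
have mH : measurable_fun setT H.
  by apply: measurable_mnorm => j i; have /integrableP[/measurable_EFinP] := ig j i.
have H0 z : 0 <= H z by exact: sqrtr_ge0.
have mD : measurable_fun setT D.
  by apply: measurable_dist => j; have /integrableP[/measurable_EFinP] := iu j.
have hacl j s : (j0 <= j)%N -> 0 < s ->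
    acl x (2 ^- j) (fun z => trunc s (D z))
     (fun z => s^-1 * H z * \1_[set z | (s < D z < s + s)%R] z).
  move=> jj s0; have cj : cube x (2 ^- j) `<=` cube x rho by apply: cubeS; exact: pS.
  apply: (@acl_trunc_dist R n d y0 x (2 ^- j) (\sum_k `|y0 k| + 1) s u g H) => //.
  - by move=> l i lin; rewrite -[i]/(nat_of_ord (Ordinal lin)) /g coordfunE; exact: ig.
  - move=> l z zj; rewrite -(subrK (y0 l) (u l z)) addrC (le_trans (ler_normD _ _))// lerD//.
      by rewrite (bigD1 l)//= lerDl sumr_ge0.
    apply: (@le_trans _ _ (2 ^- 0)); last by rewrite expr0 invr1.
    apply: (hD J0 0%N hJ0); last exact: cj.
    by apply: cubeS zj; exact/pS/(leq_trans j0J).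
  - move=> l z zj e e0; have [t t0 ht] := cubecont_coord l (UV _ (cU _ (cj _ zj))) e0.
    exists t => // w zw wj; rewrite !uE; try exact: cj.
    by apply: ht => //; exact/UV/cU/cj.
  - by move=> l; exact: (weak_diff_tensor l wDf bO (pS _ _ jj)).
  - move=> l i z lin zj; rewrite -[i]/(nat_of_ord (Ordinal lin)) /g coordfunE.
    exact: (@mnorm_coord _ _ _ (fun j i => (((fun v => Df v j i) \o @vecn R n) \_ (cubebar x rho)) z)).
have hmod' K : exists J : nat,
    (forall z, cube x (2 ^- J) z -> cube x (2 ^- j0) z -> D z <= 2 ^- K) /\
    \sum_(0 <= j < J) powR j.+1%:R (- (lam / m%:R)) <= C * K.+1%:R.
  have [J [hJ sJ]] := hC K; exists J; split => // z zJ zr.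
  apply: dist_le; first exact: ltW (p0 K).
  by move=> j; exact: (hD J K hJ).
have [k kk hk] := hc x D H j0 k0 H0 mH mD hacl hmod'.
exists k => //; apply: le_trans hk _.
have lE z : cube x rho z -> energy lam H z + 1 = G z.
  move=> zr; have Vz := UV _ (cU _ zr); rewrite /G /patch mem_set//.
  congr (_ + 1); rewrite /energy (_ : H z = Hbar z)// /Hbar /patch mem_set// /H.
  rewrite /mnormv; congr mnorm; apply/funext => j; apply/funext => i.
  by rewrite /patch mem_set//; exact: cube_cubebar.
rewrite (_ : integral _ _ _ = \int[lebn R n]_(z in level x D j0 k) (G z)%:E)%E; last first.
  by apply: eq_integral => z /set_mem[zr _]; rewrite lE.
apply: ge0_subset_integral.
- exact: measurable_level.
- by apply: measurable_cubeopen; exact: cubeopen_preim_vball.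
- by apply: measurable_funTS; apply/measurable_EFinP; exact: measurable_cutoff_energy.
- by move=> z _; rewrite lee_fin cutoff_energy_ge0.
- move=> z [zr /= hz]; split; first exact: cU.
  move=> j; rewrite -uE//; apply: le_lt_trans hz.
  exact: (@dist_coord R d y0 (fun j => u j z) j).
Qed.

Hypothesis hint : (leb_int O (fun y => (mnorm (Df y) ^+ n *
            powR (ln (expR 1 + mnorm (Df y))) lam)%:E) < +oo)%E.

Lemma cutoff_energy_locfin (M : nat) :
  (\int[lebn R n]_(z in cube (unvec 0) M.+1%:R) (G z)%:E < +oo)%E.
Proof.
pose Q : set (Rn R n) := cube (unvec 0) M.+1%:R.
have mQ : measurable Q by exact: measurable_cube.
have e0 z : (0 <= energy lam Hbar z) by exact/energy_ge0/cutoff_norm_ge0.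
have mE := measurable_energy lam measurable_cutoff_norm.
have -> : (\int[lebn R n]_(z in Q) (G z)%:E = \int[lebn R n]_(z in Q `&` V) ((energy lam Hbar z)%:E + 1%:E))%E.
  rewrite [RHS]integral_mkcondr; apply: eq_integral => z _.
  by rewrite /G /patch; case: ifP.
have mQV : measurable (Q `&` V) by exact: measurableI.
rewrite ge0_integralD//; last 2 first.
- by move=> z _; rewrite lee_fin.
- by apply: measurable_funTS; apply/measurable_EFinP.
apply: lte_add_pinfty; last first.
  rewrite integral_cst// mul1e; apply: (@le_lt_trans _ _ (lebn R n Q)).
    by apply: le_measure; rewrite ?inE.
  by rewrite lebn_cube// ltry.
apply: le_lt_trans hint; rewrite /leb_int -/V.
apply: (@le_trans _ _ (\int[lebn R n]_(z in V) (energy lam Hbar z)%:E)%E).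
  apply: ge0_subset_integral => //.
  - by apply: measurable_funTS; apply/measurable_EFinP.
  - by move=> z _; rewrite lee_fin.
rewrite le_eqVlt; apply/orP; left; apply/eqP; apply: eq_integral => z zV.
by rewrite /energy /Hbar /patch zV.
Qed.

(** [hausdorff_delta_le] is applied to the measure with density [G]: [preimage_ball_mass] provides
    arbitrarily small balls with enough mass, and the open set [W] around the preimage of [Z] can be
    given as little mass as desired. *)
Lemma luzin (Z : set 'rV[R]_n) : Z `<=` O -> leb_null Z -> hausdorff n (f @` Z) = 0%E.
Proof.
move=> ZO nZ; have [c c0 hc] := preimage_ball_mass.
apply: hausdorff_eq0 => de e de0 e0.
pose K : R := (d%:R * 10) ^+ n / c.
have K0 : 0 <= K by rewrite divr_ge0 ?(ltW c0)// exprn_ge0// mulr_ge0.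
have mG : measurable_fun setT (EFin \o G) by apply/measurable_EFinP; exact: measurable_cutoff_energy.
have G0 z : (0 <= (EFin \o G) z)%E by rewrite /= lee_fin cutoff_energy_ge0.
have e1 : 0 < e / (K + 1) by rewrite divr_gt0// ltr_wpDl.
have [U [oU ZU hU]] := null_cover_local mG G0 cutoff_energy_locfin nZ e1.
pose W := U `&` V.
have oW : cubeopen W by apply: cubeopenI => //; exact: cubeopen_eopen.
have WV : W `<=` V by move=> z [].
have mW : measurable W by exact: measurable_cubeopen.
have mU : measurable U by exact: measurable_cubeopen.
have := @hausdorff_delta_le R d _ (Rn R n) (density (lebn R n) mG G0) (f \o @vecn R n) W (f @` Z)
  n c de isT c0 de0 mW.
move=> /(_ (fun y s => measurable_cubeopen (cubeopen_preim_vball oW WV))) h.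
apply: le_trans (h _) _.
  move=> _ t [p Zp <-] t0.
  have Zu : (@vecn R n @^-1` Z) (unvec p) by change (Z (vecn (unvec p))); rewrite unvecK.
  have Wp : W (unvec p) by split; [exact: ZU|exact: ZO].
  have [k kk hk] := hc W (unvec p) (Num.truncn t^-1) oW WV Wp.
  rewrite unvecK in hk; exists (2 ^- k); split => //.
  rewrite -[leRHS]invrK lef_pV2 ?posrE ?invr_gt0 ?exprn_gt0//.
  apply: (le_trans (ltW (truncnS_gt _))); rewrite -natrX ler_nat.
  by apply: leq_ltn_trans kk _; exact: ltn_expl.
apply: (@le_trans _ _ (K%:E * (e / (K + 1))%:E)%E).
  apply: lee_wpmul2l; first by rewrite lee_fin.
  apply: le_trans hU; apply: ge0_subset_integral => //.
    exact: measurable_funTS.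
  by move=> z [].
by rewrite lee_fin mulrA ler_pdivrMr ?ltr_wpDl// mulrC ler_wpM2l ?(ltW e0)// lerDl.
Qed.

End luzin.

Theorem theorem1p1 (R : realType) (n d : nat) (hn : (2 <= n)%N) (hd : (1 <= d)%N)
  (Omega : set 'rV[R]_n) (hO : eopen Omega)
  (lambda : R) (hl0 : 0 <= lambda) (hl1 : lambda <= n%:R - 1)
  (f : 'rV[R]_n -> 'rV[R]_d) (Df : 'rV[R]_n -> 'I_d -> 'I_n -> R)
  (hDf : weak_diff Omega f Df)
  (hint : (leb_int Omega (fun y => (mnorm (Df y) ^+ n *
            powR (ln (expR 1 + mnorm (Df y))) lambda)%:E) < +oo)%E)
  (mu : R) (hmu : 0 < mu)
  (hmod : let alpha := 1 - lambda / (n%:R - 1) in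
     forall x y, Omega x -> Omega y -> 0 < enorm (x - y) -> enorm (x - y) < 1 ->
       enorm (f x - f y) <=
         (if 0 < alpha
          then expR (- (mu * powR (ln (enorm (x - y))^-1) alpha))
          else powR (ln (enorm (x - y))^-1) (- mu))) :
  forall Z : set 'rV[R]_n, Z `<=` Omega -> leb_null Z ->
    hausdorff n (f @` Z) = 0%E.
Proof.
move=> Z ZO nZ; case: n hn Omega hO hl1 f Df hDf hint hmod Z ZO nZ => // m m1 O oO.
have -> : m.+1%:R - 1 = m%:R :> R by rewrite -natr1 addrK.
move=> lm g Dg wDg hi hm Z ZO nZ.
apply: (luzin oO m1 _ hmu wDg hm hi ZO nZ).
by rewrite hl0.
Qed.
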